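(* Let $\Pi \subset \mathfrak{S}_3$ be a set of permutations of size $3$ with $\{123,321\}\not\subset \Pi$. Then the pattern-avoiding peak function $R_n(\Pi)$ is symmetric for all $n$ if and only if $\Pi$ is one of the sets listed in (1)–(8) below. In all of these cases $R_n(\Pi)$ is Schur $Q$-positive (for all $n$), and for every $n\geq 3$ its expansion into Schur $Q$-functions is the one indicated: (1) $\Pi=\emptyset$: $\displaystyle R_n(\Pi)=\sum_{\lambda} 2^{n-\ell(\lambda)}\,|\mathsf{SShT}(\lambda)|\,Q_\lambda$, the sum being over all strict partitions $\lambda$ of $n$. (2) $\Pi\in\big\{\{123\},\{213\},\{312\},\{321\}\big\}$: $\displaystyle R_n(\Pi)=\sum_{k=0}^{\lfloor n/2\rfloor}\left(\binom{n}{k+1}-\binom{n}{k-1}\right)Q_{(n-k,k)}$. (3) $\Pi\in\big\{\{213,132\},\{231,312\},\{123,132\},\{132,312\},\{213,231\},\{231,321\}\big\}$: $\displaystyle R_n(\Pi)=\sum_{k=0}^{\lfloor n/2\rfloor}(n-2k)\,Q_{(n-k,k)}$. (4) $\Pi=\{132,231\}$: $R_n(\Pi)=2^{n-1}Q_{(n)}$. (5) $\Pi\in\big\{\{123,132,312\},\{123,213,231\},\{132,312,321\},\{132,213,321\},\{132,213,312\},\{123,231,312\},\{213,231,321\},\{213,231,312\}\big\}$: $R_n(\Pi)=2Q_{(n)}+Q_{(n-1,1)}$. (6) $\Pi\in\big\{\{123,132,231\},\{132,213,231\},\{132,231,312\},\{132,231,321\}\big\}$: $R_n(\Pi)=nQ_{(n)}$.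 (7) $\Pi\in\big\{\{123,132,213,231\},\{123,132,231,312\},\{132,213,231,312\},\{132,213,231,321\},\{132,231,312,321\}\big\}$: $R_n(\Pi)=2Q_{(n)}$. (8) $\Pi\in\big\{\{123,132,213,231,312\},\{132,213,231,312,321\}\big\}$: $R_n(\Pi)=Q_{(n)}$.
   Context: Permutations. $[n]=\{1,\dots,n\}$ and $\mathfrak{S}_n$ is the set of permutations of $[n]$, written in one-line notation $\pi=\pi_1\cdots\pi_n$. A permutation $\pi$ contains $\tau\in\mathfrak{S}_k$ as a pattern if some subsequence of $\pi$ of length $k$ has the same relative order as $\tau$; otherwise $\pi$ avoids $\tau$. For a set $\Pi$ of permutations, $\mathrm{Av}_n(\Pi)$ is the set of $\pi\in\mathfrak{S}_n$ avoiding every element of $\Pi$. The descent set is $\mathrm{Des}(\pi)=\{i:\pi_i>\pi_{i+1}\}$. For a set $S$ of positive integers, $\mathrm{Peak}(S)=\{s\in S: s\neq 1,\ s-1\notin S\}$, and $\mathrm{Peak}(\pi):=\mathrm{Peak}(\mathrm{Des}(\pi))$. Quasisymmetric functions. For a composition $\alpha=(\alpha_1,\dots,\alpha_k)$ of $n$, $M_\alpha=\sum_{1\le i_1<\cdots<i_k}x_{i_1}^{\alpha_1}\cdots x_{i_k}^{\alpha_k}$, and $F_\alpha=\sum_\beta M_\beta$ over all compositions $\beta$ refining $\alpha$ (i.e. $\alpha$ is obtained from $\beta$ by adding adjacent parts). $\mathrm{set}(\beta)=\{\beta_1,\beta_1+\beta_2,\dots,\beta_1+\cdots+\beta_{k-1}\}\subseteq[n-1]$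 for $\beta=(\beta_1,\dots,\beta_k)$, and $\mathrm{set}(\beta)+1=\{x+1:x\in\mathrm{set}(\beta)\}$. For a peak set $S\subseteq[n-1]$ (meaning $1\notin S$ and $i\in S\Rightarrow i-1\notin S$), the peak function is $$K_{S,n}=2^{|S|+1}\sum_{\beta\vDash n,\ S\subseteq \mathrm{set}(\beta)\triangle(\mathrm{set}(\beta)+1)}F_\beta,$$ where $\triangle$ is symmetric difference; $K_S$ is written when $n$ is clear. The pattern-avoiding peak function is $$R_n(\Pi)=\sum_{\pi\in \mathrm{Av}_n(\Pi)}K_{\mathrm{Peak}(\pi),n}.$$ It is symmetric if it is invariant under permutations of the variables. Shifted tableaux and Schur $Q$-functions. A strict partition $\lambda$ of $n$ is a strictly decreasing sequence of positive integers with sum $n$; $\ell(\lambda)$ is its number of parts. The shifted diagram of $\lambda$ (French convention) has $\lambda_i$ cells in row $i$, with row 1 at the bottom and row $i$ indented one cell to the right relative to row $i-1$. $\mathsf{SShT}(\lambda)$ is the set of fillings of the shifted diagram by $1,\dots,n$, each used once, with rows increasing left to right and columns increasing bottom to top. For $T\in\mathsf{SShT}(\lambda)$, $\mathrm{Des}(T)=\{i: i+1\text{ is in a row strictly above that of } i\}$ and $\mathrm{Peak}(T):=\mathrm{Peak}(\mathrm{Des}(T))$. The Schur $Q$-function is $Q_\lambda=\sum_{T\in\mathsf{SShT}(\lambda)}K_{\mathrm{Peak}(T),n}$. A function is Schur $Q$-positive if it expands into Schur $Q$-functions with only nonnegative coefficients. Conventions: $(n,0)$ means $(n)$; $\binom{n}{-1}=0$;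 when $n=2k$ the coefficient of $Q_{(k,k)}$ in (2) and (3) is $0$ and that term is read as $0$. *)

(* Defs.v *)
From HB Require Import structures.
From mathcomp Require Import all_boot all_order all_algebra all_fingroup.
From mathcomp Require Import finmap.

Set Implicit Arguments.
Unset Strict Implicit.
Unset Printing Implicit Defensive.

Import GRing.Theory.
Local Open Scope fset_scope.
Local Open Scope ring_scope.

(* Formal power series over Z in countably many variables x_0, x_1, ...:     *)
(* a monomial is a finitely supported exponent vector, a series is its       *)
(* coefficient function.                                                     *)
Definition monom := {fsfun nat -> nat with 0%N}.
Definition series := monom -> int.

Definition sym_series (f : series) : Prop :=
  forall s : nat -> nat, bijective s ->
  forall m m' : monom, (forall i, m' (s i) = m i) -> f m' = f m.

(* Every sequence of positive integers with sum n is [parts b] for exactly   *)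
(* one b : bword n, so sums over compositions (or strict partitions) of n    *)
(* are sums over the finite type [bword n] filtered by a predicate.          *)
Definition bword (n : nat) := n.-bseq 'I_n.+1.
Definition parts (n : nat) (b : bword n) : seq nat := [seq val i | i <- b].

Definition is_comp (n : nat) (b : seq nat) : bool :=
  all (leq 1) b && (sumn b == n).

Definition is_strict (n : nat) (l : seq nat) : bool :=
  is_comp n l && sorted gtn l.

(* [a] is obtained from [b] by cutting [b] into consecutive nonempty blocks, *)
(* of sizes [sh], and adding up each block.                                  *)
Definition refines (b a : seq nat) : bool :=
  [exists sh : bword (size b),
     is_comp (size b) (parts sh) && (map sumn (reshape (parts sh) b) == a)].

(* {b_1, b_1 + b_2, ..., b_1 + ... + b_(k-1)} for b = (b_1, ..., b_k)        *)
Definition cset (b : seq nat) : {fset nat} :=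
  [fset sumn (take j b) | j in iota 1 (size b).-1].

Definition shift1 (A : {fset nat}) : {fset nat} := [fset x.+1 | x in A].

Definition symdiff (A B : {fset nat}) : {fset nat} :=
  (A `\` B) `|` (B `\` A).

Definition peak (S : {fset nat}) : {fset nat} :=
  [fset s in S | (s != 1%N) && (s.-1 \notin S)].

(* The nonzero exponents of m, in increasing order of the variables. Since   *)
(* the parts of a composition are positive, m occurs in the sum of the       *)
(* x_(i_1)^a_1 ... x_(i_k)^a_k over i_1 < ... < i_k exactly when this list   *)
(* is a, and then it occurs once.                                            *)
Definition expword (m : monom) : seq nat :=
  [seq m i | i <- sort leq (finsupp m)].

Definition qsymM (a : seq nat) : series := fun m => (expword m == a)%:R.

Definition qsymF (a : seq nat) : series := fun m =>
  \sum_(b : bword (sumn a) | is_comp (sumn a) (parts b) && refines (parts b) a)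
     qsymM (parts b) m.

Definition peakK (S : {fset nat}) (n : nat) : series := fun m =>
  2 ^+ (#|` S|).+1 *
  \sum_(b : bword n | is_comp n (parts b) &&
          (S `<=` symdiff (cset (parts b)) (shift1 (cset (parts b)))))
     qsymF (parts b) m.

(* 'S_n permutes {0, ..., n-1}; one-line notation uses the values 1, ..., n. *)
Definition oneline (n : nat) (p : 'S_n) : seq nat :=
  [seq (p i : nat).+1 | i <- enum 'I_n].

Definition perm_des (n : nat) (p : 'S_n) : {fset nat} :=
  [fset i in iota 1 n.-1 |
     nth 0%N (oneline p) i.-1 > nth 0%N (oneline p) i]%N.

Definition contains (n k : nat) (p : 'S_n) (t : 'S_k) : bool :=
  [exists f : {ffun 'I_k -> 'I_n},
     [forall a : 'I_k, forall b : 'I_k,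
        ((a < b)%N ==> (f a < f b)%N) &&
        ((p (f a) < p (f b))%N == (t a < t b)%N)]].

Definition Av (n k : nat) (Pi : {set 'S_k}) : {set 'S_n} :=
  [set p : 'S_n | [forall t in Pi, ~~ contains p t]].

Definition avoidR (k : nat) (Pi : {set 'S_k}) (n : nat) : series := fun m =>
  \sum_(p in Av n Pi) peakK (peak (perm_des p)) n m.

(* Cells of the shifted diagram; rows are numbered from the bottom, and row  *)
(* i (from 0) starts in column i.                                            *)
Definition shcell (l : seq nat) := {i : 'I_(size l) & 'I_(nth 0%N l i)}.
Definition cell_row (l : seq nat) (c : shcell l) : nat := tag c.
Definition cell_col (l : seq nat) (c : shcell l) : nat := (tag c + tagged c)%N.

(* The entry in cell c is (T c).+1, so that entries range over 1, ..., n.    *)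
Definition SShT (l : seq nat) : {set {ffun shcell l -> 'I_(sumn l)}} :=
  [set T : {ffun shcell l -> 'I_(sumn l)} |
     [&& [forall v, #|[set c | T c == v]| == 1%N],
         [forall c, forall d,
            (cell_row c == cell_row d) && (cell_col c < cell_col d)%N
              ==> (T c < T d)%N]
       & [forall c, forall d,
            (cell_col c == cell_col d) && (cell_row c < cell_row d)%N
              ==> (T c < T d)%N]]].

Definition tab_des (l : seq nat) (T : {ffun shcell l -> 'I_(sumn l)}) :
    {fset nat} :=
  [fset i in iota 1 (sumn l).-1 |
     [exists c, exists d,
        [&& (T c).+1 == i, (T d).+1 == i.+1 & (cell_row c < cell_row d)%N]]].

Definition schurQ (l : seq nat) : series := fun m =>
  \sum_(T in SShT l) peakK (peak (tab_des T)) (sumn l) m.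

Definition Qexpand (n : nat) (c : seq nat -> int) : series := fun m =>
  \sum_(b : bword n | is_strict n (parts b)) c (parts b) * schurQ (parts b) m.

(* Schur Q-positivity of a series that is homogeneous of degree n            *)
Definition schurQ_pos (n : nat) (f : series) : Prop :=
  exists c : seq nat -> int, (forall l, 0 <= c l) /\ f =1 Qexpand n c.

Definition two_row (n k : nat) : seq nat :=
  if k == 0%N then [:: n] else [:: n - k; k]%N.

(* 'C(n, k - 1), with the value 0 at k = 0                                   *)
Definition binpred (n k : nat) : nat := if k is k'.+1 then 'C(n, k') else 0%N.

Definition w123 : seq nat := [:: 1; 2; 3]%N.
Definition w132 : seq nat := [:: 1; 3; 2]%N.
Definition w213 : seq nat := [:: 2; 1; 3]%N.
Definition w231 : seq nat := [:: 2; 3; 1]%N.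
Definition w312 : seq nat := [:: 3; 1; 2]%N.
Definition w321 : seq nat := [:: 3; 2; 1]%N.

Definition perms3 (ws : seq (seq nat)) : {set 'S_3} :=
  [set p : 'S_3 | oneline p \in ws].

Definition list1 : seq {set 'S_3} := [:: set0].

Definition list2 : seq {set 'S_3} := map perms3
  [:: [:: w123]; [:: w213]; [:: w312]; [:: w321]].

Definition list3 : seq {set 'S_3} := map perms3
  [:: [:: w213; w132]; [:: w231; w312]; [:: w123; w132];
      [:: w132; w312]; [:: w213; w231]; [:: w231; w321]].

Definition list4 : seq {set 'S_3} := map perms3 [:: [:: w132; w231]].

Definition list5 : seq {set 'S_3} := map perms3
  [:: [:: w123; w132; w312]; [:: w123; w213; w231];
      [:: w132; w312; w321]; [:: w132; w213; w321];
      [:: w132; w213; w312]; [:: w123; w231; w312];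
      [:: w213; w231; w321]; [:: w213; w231; w312]].

Definition list6 : seq {set 'S_3} := map perms3
  [:: [:: w123; w132; w231]; [:: w132; w213; w231];
      [:: w132; w231; w312]; [:: w132; w231; w321]].

Definition list7 : seq {set 'S_3} := map perms3
  [:: [:: w123; w132; w213; w231]; [:: w123; w132; w231; w312];
      [:: w132; w213; w231; w312]; [:: w132; w213; w231; w321];
      [:: w132; w231; w312; w321]].

Definition list8 : seq {set 'S_3} := map perms3
  [:: [:: w123; w132; w213; w231; w312]; [:: w132; w213; w231; w312; w321]].

Definition listed : seq {set 'S_3} :=
  list1 ++ list2 ++ list3 ++ list4 ++ list5 ++ list6 ++ list7 ++ list8.

(* Main.v *)
Require Import Defs.
From HB Require Import structures.
From mathcomp Require Import all_boot all_order all_algebra all_fingroup.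
From mathcomp Require Import finmap zify ring.
From Stdlib Require Import FunctionalExtensionality.

Set Implicit Arguments.
Unset Strict Implicit.
Unset Printing Implicit Defensive.
Import GRing.Theory.
Local Open Scope fset_scope.
Local Open Scope ring_scope.

(** Why the theorem holds.

    In K_(S,n), for a peak set S, the coefficient of a monomial x^a, where a is
    a composition of n with set D of partial sums, is 2^(length of a) if S is
    contained in the union of D and D + 1, and 0 otherwise ([peakK_coef]): for
    each s in S exactly one of s - 1, s has to be chosen in the set of the
    composition indexing F, a choice that D must leave possible, and every
    element of D that S does not touch is free. If S is the peak set of a word,
    the condition says that no peak lies in the interior of a block, when the
    word is cut into blocks of lengths a_1, a_2, ...; that is, every block goes
    down and then up. So, up to the factor 2^(length of a), the coefficient of
    x^a in R_n(Pi) is the number [perm_count] of permutations that avoid Pi and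
    whose blocks are all valleys, and in Q_l it is the number [tab_count] of
    shifted standard tableaux of shape l with the same property. Everything
    becomes a statement about functions of the composition a: symmetry is
    invariance under permutations of a, and the expansions are identities
    between such functions.

    Both kinds of objects grow one entry at a time. If the future of an object
    depends only on a state, a block of length b contributes the operator
    (d + a) (a^(b-1) + d a^(b-2) + ... + d^(b-1)) on functions of the state,
    where d and a sum over the steps that create a descent or an ascent
    ([tree_valleys]).

    Shapes of at most two rows. Here only the difference of the two rows
    matters, and a block acts as J U_(b-1)(J), where J moves the difference by
    one in either direction and U_b is a polynomial in J satisfying
    U_(b+2) = J U_(b+1) - U_b. All blocks commute, so a sum of the Q_(n-k,k)
    whose coefficients form a function in the image of J is symmetric in a
    ([sum_two_row], [gap_blocks_perm]). For 213-avoiding permutations the state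
    is the last value, and T = d + a makes the blocks satisfy the same recursion
    with T in the place of J^2; the two operators have the same matrix
    coefficients at the relevant vectors ([paired_eval]), which gives [list2].
    For [list3] the coefficients n - 2k are an eigenvector of J and the count is
    2^(l-1) a_1 ... a_l; for [list5] the count is the sum of the min(a_i, 2); in
    [list4], [list6], [list7] and [list8] the patterns 132 and 231 forbid every
    peak, so that the count is the size of the class. The classes are treated
    through a few small automata, and reversal of permutations, which turns the
    count at a into the count at the reverse of a ([perm_count_rev]), gives the
    remaining ones.

    No pattern ([sum_all_shapes]). A shifted shape is recorded by the numbers
    k_0, k_1, ... of its cells on the diagonals, and u_c, d_c add or remove a
    cell on diagonal c. Let D' be the sum of the d_c, weighted by 1 for c = 0
    and by 2 otherwise; the n-th power of D' takes the indicator of the empty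
    shape to the function whose value at l is 2^(n - l(l)) |SShT(l)|. If V_b is
    the sum of the products of b letters u_c along a valley, then
    Q_b = 2 V_b satisfies Q_b D' = D' Q_b + 2 Q_(b-1) on shapes of size less
    than the number of available diagonals ([Valley_Down], [sgn_down_paths]).
    Hence the blocks a take that function to 2^n times a multinomial
    coefficient, and the same number counts all permutations with valley blocks
    ([perm_count_all]). As this count is symmetric, so is R_n of the empty set.

    For the other sets of patterns, comparing the counts at (3, 1) and (1, 3)
    or at the three arrangements of (1, 1, 3) shows that R_4 or R_5 is not
    symmetric ([all_sublists]). For n at most 2 no pattern of size 3 occurs, so
    that R_n is that of the empty set. *)

(** * Peak functions in the monomial basis *)

Lemma parts_inj n : injective (@parts n).
Proof. by move=> b c /(inj_map val_inj) /val_inj. Qed.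

Lemma sumn_ge_size b : all (leq 1) b -> (size b <= sumn b)%N.
Proof. by elim: b => //= x b IH /andP[hx /IH]; lia. Qed.

Lemma mem_leq_sumn b x : x \in b -> (x <= sumn b)%N.
Proof. by elim: b => //= y b IH; rewrite inE => /orP[/eqP->|/IH]; lia. Qed.

Lemma parts_surj n b : is_comp n b -> exists c : bword n, parts c = b.
Proof.
move=> /andP[hp /eqP hs].
have hsz : (size [seq inord x : 'I_n.+1 | x <- b] <= n)%N.
  by rewrite size_map -hs sumn_ge_size.
exists (Bseq hsz); rewrite /parts /= -map_comp -[RHS]map_id.
apply/eq_in_map => x /mem_leq_sumn hx /=; rewrite inordK //; lia.
Qed.

Lemma expword_pos m : all (leq 1) (expword m).
Proof.
apply/allP => x /mapP[i]; rewrite mem_sort mem_finsupp => hi ->.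
by rewrite lt0n.
Qed.
Lemma csetP b x :
  reflect (exists j, [/\ (0 < j)%N, (j < size b)%N & x = sumn (take j b)])
          (x \in cset b).
Proof.
rewrite /cset; apply: (iffP (imfsetP _ _ _ _)) => /= [[j hj ->]|[j [h0 h1 ->]]].
  by exists j; move: hj; rewrite mem_iota => hj; split=> //; lia.
by exists j => //; rewrite mem_iota; lia.
Qed.

Lemma in_cset_cons a b x :
  (x \in cset (a :: b)) =
  (b != [::]) && ((x == a) || (a <= x)%N && (x - a \in cset b)%N).
Proof.
apply/csetP/idP => [[[|j] [// _ /= hj ->]]|/andP[hb /orP[/eqP->|/andP[hx]]]].
- case: b hj => //= c b hj; case: j hj => [|j] hj; first by rewrite addn0 eqxx.
  apply/orP; right; rewrite leq_addr addKn; apply/csetP.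
  by exists j.+1; split=> //; lia.
- by exists 1%N; case: b hb => //= c b _; rewrite addn0.
- move/csetP=> [j [h0 h1 e]]; exists j.+1; split=> //=; lia.
Qed.

Lemma cset1 a : cset [:: a] = fset0.
Proof. by apply/fsetP => x; rewrite in_cset_cons. Qed.

Lemma cset0 : cset [::] = fset0.
Proof. by apply/fsetP => x; apply/csetP; case=> j []. Qed.

Lemma cset_bound b x : all (leq 1) b -> x \in cset b ->
  (0 < x < sumn b)%N.
Proof.
elim: b x => [x _|a b IH x /= /andP[ha hb]]; first by rewrite cset0 inE.
rewrite in_cset_cons => /andP[hn /orP[/eqP->|/andP[hx /(IH _ hb)]]]; last by lia.
by case: b hn hb {IH} => //= c b _ /andP[hc _]; lia.
Qed.

Lemma refinesP a b : reflect
  (exists sh, is_comp (size a) sh /\ map sumn (reshape sh a) = b) (refines a b).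
Proof.
apply: (iffP existsP) => [[sh /andP[h /eqP e]]|[sh [h e]]]; first by exists (parts sh).
by have [c hc] := parts_surj h; exists c; rewrite hc h e eqxx.
Qed.

Lemma cset_cat (a c : seq nat) : c != [::] -> a != [::] ->
  cset (a ++ c) = cset a `|` [fset sumn a] `|` [fset (sumn a + x)%N | x in cset c].
Proof.
move=> hc ha; apply/fsetP => x; rewrite !inE; apply/csetP/idP.
  case=> j [h0]; rewrite size_cat => h1 ->; rewrite take_cat.
  case: ltngtP => hj.
  - by have -> : sumn (take j a) \in cset a by apply/csetP; exists j.
  - apply/orP; right; apply/imfsetP; exists (sumn (take (j - size a) c)).
      by apply/csetP; exists (j - size a)%N; split=> //; lia.
    by rewrite sumn_cat.
  - by rewrite -hj subnn take0 cats0 eqxx orbT.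
case/orP => [/orP[/csetP[j [h0 h1 ->]]|/eqP->]|/imfsetP[/= y /csetP[j [h0 h1 ->]] ->]].
- by exists j; split=> //; [rewrite size_cat; lia | rewrite takel_cat //; lia].
- exists (size a); rewrite take_size_cat //; split=> //; first by case: (a) ha.
  by rewrite size_cat; case: (c) hc => //= *; lia.
- exists (size a + j)%N; rewrite size_cat take_cat; split; [lia|lia|].
  by rewrite ifN ?addKn ?sumn_cat //; lia.
Qed.

(** Cutting a into consecutive blocks means choosing which of the partial sums of a
    remain partial sums, so refinement is inclusion of the sets of partial sums. *)
Lemma refines_cset n a b : is_comp n a -> is_comp n b ->
  refines a b = (cset b `<=` cset a).
Proof.
move=> ha hb; apply/refinesP/fsubsetP => [[sh [hsh e]]|].
  elim: b n a sh ha hb hsh e => [n a sh _ _ _ _ x|b1 b IH n a [|s1 sh] //]; first by rewrite cset0 inE.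
  move=> /andP[pa /eqP sa] /andP[/= /andP[p1 pb] /eqP sb] /andP[/= /andP[q1 qs] /eqP ss].
  case=> e1 e x; rewrite in_cset_cons => /andP[hb /orP[/eqP->|]].
    rewrite -e1; apply/csetP; exists s1; split=> //.
    by case: sh ss e qs => [|s2 sh] /=; [move=> _ e; rewrite -e in hb | move=> ss _ /andP[]; lia].
  case/andP => hx hxb.
  have hdrop : all (leq 1) (drop s1 a).
    by apply/allP => y /mem_drop /(allP pa).
  have hsum : (sumn (drop s1 a) + b1 = n)%N.
    by rewrite -sa -{2}(cat_take_drop s1 a) sumn_cat e1; lia.
  have : (x - b1)%N \in cset (drop s1 a).
    apply: (IH (n - b1)%N (drop s1 a) sh) => //; rewrite /is_comp ?hdrop ?pb ?qs ?size_drop /=; lia.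
  case/csetP => j [j0 j1 ej]; apply/csetP; exists (s1 + j)%N; rewrite size_drop in j1.
  split; [lia|lia|].
  by rewrite takeD sumn_cat -ej e1; lia.
elim: b n a ha hb => [|b1 b IH] n a /andP[pa /eqP sa] /andP[/= pb /eqP sb] hsub.
  exists [::]; split=> //; have := sumn_ge_size pa; rewrite sa -sb /is_comp /=; lia.
have {}pb := andP pb; case: pb => p1 pb.
case: (b =P [::]) => [b0|/eqP bn].
  exists [:: size a]; split; last by rewrite /= take_size sa -sb b0 /= addn0.
  rewrite /is_comp /= addn0 eqxx !andbT; case: (a) sa => //=; lia.
have : b1 \in cset a by apply: hsub; rewrite in_cset_cons bn eqxx.
case/csetP => j [j0 j1 ej].
have hdrop : all (leq 1) (drop j a) by apply/allP => y /mem_drop /(allP pa).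
have hsum : (sumn (drop j a) + b1 = n)%N.
  by rewrite -sa -{2}(cat_take_drop j a) sumn_cat -ej; lia.
have [||x hx|sh [/andP[q1 /eqP q2] q3]] := IH (n - b1)%N (drop j a).
- by rewrite /is_comp hdrop; lia.
- by rewrite /is_comp pb; lia.
- have : (b1 + x)%N \in cset a.
    by apply: hsub; rewrite in_cset_cons bn addKn hx leq_addr orbT.
  rewrite -{1}(cat_take_drop j a) cset_cat; last 2 first.
  + by have : (0 < size (drop j a))%N by [rewrite size_drop; lia]; case: drop.
  + by have : (0 < size (take j a))%N by [rewrite size_take j1]; case: take.
  rewrite -ej !inE => /orP[/orP[/cset_bound|]|/imfsetP[/= y hy]].
  + have /[swap]/[apply] : all (leq 1) (take j a) by apply/allP => y /mem_take /(allP pa).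
    by rewrite -ej; lia.
  + by have := cset_bound pb hx; lia.
  + by move/addnI ->.
exists (j :: sh); split; last by rewrite /= -ej q3.
by rewrite /is_comp /= j0 q1 q2 size_drop; lia.
Qed.

Lemma cset_inj n a b : is_comp n a -> is_comp n b -> cset a = cset b -> a = b.
Proof.
elim: a n b => [|x a IH] n [|y b] //=.
- by move=> /andP[_ /eqP <-] /andP[/= /andP[h _]]; lia.
- by move=> /andP[/= /andP[h _]] hs /andP[_ /eqP /= h2]; lia.
move=> /andP[/= /andP[px pa] /eqP sa] /andP[/= /andP[py pb] /eqP sb] e.
have e' z := congr1 (fun A => z \in A) e.
have hx := e' x; have hy := e' y.
move: hx hy; rewrite !in_cset_cons !eqxx /= !andbT.
case: (a =P [::]) => [a0|/eqP an]; case: (b =P [::]) => [b0|/eqP bn] //=.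
  by move=> _ _; rewrite a0 b0 in sa sb *; congr (_ :: _); move: sa sb => /=; lia.
move=> /esym hx hy.
have exy : x = y.
  by move: hx hy; case: ltngtP => // h; rewrite ?orbF //; lia.
subst y; congr (_ :: _); apply: (IH (n - x)%N); rewrite /is_comp ?pa ?pb /=; try lia.
apply/fsetP => z; have := e' (x + z)%N; rewrite !in_cset_cons an bn addKn leq_addr /=.
case: z => [|z]; last by have -> : (x + z.+1 == x)%N = false by lia.
move=> _; apply/idP/idP => /cset_bound; rewrite ?pa ?pb => /(_ isT); lia.
Qed.

Lemma cset_surj n (B : {fset nat}) : (forall x, x \in B -> (0 < x < n)%N) ->
  exists b, is_comp n b /\ cset b = B.
Proof.
elim: n B => [|n IH] B hB.
  exists [::]; split; rewrite ?cset0 //; apply/fsetP => x; rewrite inE.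
  by apply/esym/negbTE/negP => /hB; lia.
have [x|b [/andP[pb /eqP sb] eb]] := IH [fset x.-1 | x in B & (1 < x)%N].
  by case/imfsetP => /= y; rewrite !inE => /andP[/hB] h1 h2 ->; lia.
have hb x : (x \in cset b) = (0 < x)%N && (x.+1 \in B).
  rewrite eb; apply/imfsetP/andP => /= [[y]|[h1 h2]].
    rewrite !inE => /andP[h1 h2] ->; have -> : y.-1.+1 = y by lia.
    by split=> //; lia.
  by exists x.+1; rewrite ?inE ?h2.
have [h1|h1] := boolP (1%N \in B).
  have bn : b != [::] by case: (b) sb => //=; have := hB _ h1; lia.
  exists (1%N :: b); split; first by rewrite /is_comp /= pb sb; lia.
  apply/fsetP => x; rewrite in_cset_cons hb bn.
  case: x => [|[|x]] /=; [|by rewrite h1|by rewrite subn1].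
  by apply/esym/negbTE/negP => /hB; lia.
case: b pb sb hb {eb} => [|y b] /= pb sb hb.
  exists [:: 1%N]; split; first by rewrite /is_comp -sb.
  by apply/fsetP => x; rewrite cset1; apply/esym/negbTE/negP => /hB; lia.
exists (y.+1 :: b); split; first by move: pb; rewrite /is_comp /= => /andP[_ ->]; lia.
apply/fsetP => x; rewrite in_cset_cons; have := hb x.-1; rewrite in_cset_cons.
have -> : (x.-1 - y = x - y.+1)%N by lia.
case: x => [|x] /=; last first.
  rewrite ltnS eqSS => ->; case: x => [|x] //=.
  by rewrite (negbTE h1).
rewrite andbF => _; apply/esym/negbTE/negP => /hB; lia.
Qed.
Lemma in_symdiff_shift (B : {fset nat}) s : (0 < s)%N ->
  (s \in symdiff B (shift1 B)) = (s \in B) (+) (s.-1 \in B).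
Proof.
move=> hs; have -> : (s.-1 \in B) = (s \in shift1 B).
  apply/idP/imfsetP => [h|[/= x hx ->]] //=; exists s.-1 => //=; lia.
by rewrite /symdiff !inE; case: (s \in B); case: (s \in shift1 B).
Qed.

Lemma qsymF_coef n b m : is_comp n b ->
  qsymF b m = (is_comp n (expword m) && refines (expword m) b)%:R.
Proof.
move=> /andP[_ /eqP sb]; rewrite /qsymF /qsymM sb.
have [ha|ha] /= := boolP (is_comp n (expword m)); last first.
  rewrite big1 // => g /andP[hg _]; case: eqP => // e.
  by rewrite e hg in ha.
have [g hg] := parts_surj ha.
have [hr|hr] := boolP (refines _ b).
  rewrite (bigD1 g) /= ?hg ?ha ?hr // eqxx big1 ?addr0 // => g' /andP[_ /eqP ne].
  by case: eqP => // e; case: ne; apply: parts_inj; rewrite hg -e.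
rewrite big1 // => g' /andP[_ hr']; case: eqP => // e.
by rewrite -e (negbTE hr) in hr'.
Qed.

(** S is a peak set, so the pairs {s - 1, s} for s in S are disjoint. A subset B of D is
    admissible when it contains exactly one element of each pair. Each pair meets D,
    so one element of the pair is determined by the rest of B, and the other elements
    of D are free. *)
Lemma card_exactly_one (D S : {fset nat}) :
  (forall s, s \in S -> (0 < s)%N && (s.-1 \notin S)) ->
  (forall s, s \in S -> (s \in D) || (s.-1 \in D)) ->
  (#|` S| + count (fun B : {fset nat} => S `<=` symdiff B (shift1 B))
    (fpowerset D))%N = (#|` S| + 2 ^ (#|` D| - #|` S|))%N /\ (#|` S| <= #|` D|)%N.
Proof.
move=> hS hD.
(* r s is an element of D in the pair of s, and o s is the other element of the pair;
   whether r s is in B is determined by o s. *)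
pose r s := if s \in D then s else s.-1.
pose o s := if s \in D then s.-1 else s.
have rinj : {in S &, injective r}.
  move=> s t hs ht; have := hS _ hs; have := hS _ ht.
  have hst : s = t.-1 -> t = s by move=> e; have := hS _ ht; rewrite -e hs andbF.
  have hts : t = s.-1 -> t = s by move=> e; have := hS _ hs; rewrite -e ht andbF.
  rewrite /r; case: ifP; case: ifP => // _ _ h1 h2 e; try lia.
pose R := [fset r s | s in S].
have cR : #|` R| = #|` S| by apply: card_in_imfset.
have RD : R `<=` D.
  apply/fsubsetP => x /imfsetP[/= s hs ->]; rewrite /r.
  by case: ifP (hD _ hs).
have oR s : s \in S -> o s \notin R.
  move=> hs; apply/negP => /imfsetP[/= t ht]; rewrite /o /r.
  have := hS _ hs; have := hS _ ht => /andP[t0 t1] /andP[s0 s1].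
  case: ifP => hsD; case: ifP => htD e.
  - by rewrite e ht in s1.
  - by rewrite (_ : s = t) ?htD in hsD; lia.
  - by rewrite e htD in hsD.
  - by rewrite -e hs in t1.
(* f extends a choice C outside R to the admissible set that it determines. *)
pose f (C : {fset nat}) := C `|` [fset r s | s in S & o s \notin C].
have inF C x : (x \in f C) = (x \in C) || has (fun s => (x == r s) && (o s \notin C)) S.
  rewrite !inE; congr orb; apply/imfsetP/hasP => /= [[s]|[s hs /andP[/eqP -> ho]]].
    by rewrite !inE => /andP[hs ho] ->; exists s; rewrite ?eqxx.
  by exists s; rewrite ?inE ?hs.
have roS B s : s \in S -> (s \in B) (+) (s.-1 \in B) = (r s \in B) (+) (o s \in B).
  by move=> hs; rewrite /r /o; case: ifP => // _; rewrite addbC.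
have oD B s : s \in S -> B `<=` D -> o s \in B -> o s \in D.
  by move=> hs /fsubsetP hB /hB.
have rR s : s \in S -> r s \in R by move=> hs; apply/imfsetP; exists s.
have inS B : (S `<=` symdiff B (shift1 B)) = all (fun s => (r s \in B) (+) (o s \in B)) S.
  apply/fsubsetP/allP => h s hs; have /andP[s0 _] := hS _ hs.
    by rewrite -roS // -in_symdiff_shift // h.
  by rewrite in_symdiff_shift // roS // h.
split; last by rewrite -cR fsubset_leq_card.
congr addn; rewrite -size_filter.
have <- : #|` fpowerset (D `\` R)| = (2 ^ (#|` D| - #|` S|))%N.
  by rewrite card_fpowerset cardfsD (fsetIidPr RD) cR.
rewrite -[RHS](size_map f); apply/esym/perm_size/uniq_perm.
- rewrite map_inj_in_uniq ?fset_uniq // => C C'; rewrite !fpowersetE => hC hC' e.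
  have key (A A' : {fset nat}) : A `<=` D `\` R -> f A = f A' -> A `<=` A'.
    move=> hA eA; apply/fsubsetP => x hx; have := fsubsetP hA _ hx; rewrite inE => /andP[hxR _].
    have : x \in f A by rewrite inF hx.
    rewrite eA inF => /orP[//|/hasP[s hs /andP[/eqP ex _]]].
    by rewrite ex rR in hxR.
  by apply/eqP; rewrite eqEfsubset; apply/andP; split; [apply: (key C C')|apply: (key C' C)].
- by rewrite filter_uniq ?fset_uniq.
move=> B; rewrite mem_filter fpowersetE inS; apply/mapP/andP => [[C]|[/allP hB hBD]].
  rewrite fpowersetE => hC ->.
  have hCR x : x \in C -> x \notin R by move/(fsubsetP hC); rewrite inE => /andP[].
  split; last first.
    apply/fsubsetP => x; rewrite inF => /orP[/(fsubsetP hC)|/hasP[s hs /andP[/eqP-> _]]].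
      by rewrite inE => /andP[].
    by apply: (fsubsetP RD); apply: rR.
  apply/allP => s hs.
  have -> : (o s \in f C) = (o s \in C).
    rewrite inF; case: hasP => [[t ht /andP[/eqP e _]]|_]; last by rewrite orbF.
    by have := oR _ hs; rewrite e rR.
  rewrite inF; have -> : (r s \in C) = false.
    by apply/negP => /hCR; rewrite rR.
  suff -> : has (fun t => (r s == r t) && (o t \notin C)) S = (o s \notin C) by case: (o s \in C).
  apply/hasP/idP => [[t ht /andP[/eqP e]]|h]; first by rewrite (rinj _ _ hs ht e).
  by exists s; rewrite ?eqxx.
exists (B `\` R).
  rewrite fpowersetE; apply/fsubsetP => x; rewrite !inE => /andP[-> /(fsubsetP hBD) ->].
  by [].
apply/fsetP => x; rewrite inF inE.
have [/imfsetP[/= s hs ->]|hx] /= := boolP (x \in R).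
  apply/idP/hasP => [h|[t ht /andP[/eqP e]]].
    exists s; rewrite ?eqxx //= inE (negbTE (oR _ hs)).
    by have := hB _ hs; rewrite h.
  by rewrite inE (oR _ ht) /= e; have := hB _ ht; case: (o t \in B); case: (r t \in B).
case: hasP => [[t ht /andP[/eqP e _]]|_]; last by rewrite orbF.
by rewrite e rR in hx.
Qed.
Lemma card_cset a : all (leq 1) a -> #|` cset a| = (size a).-1.
Proof.
elim: a => [|x a IH] /=; first by rewrite cset0 cardfs0.
case/andP=> hx ha; case: (a =P [::]) => [->|/eqP an]; first by rewrite cset1 cardfs0.
have -> : cset (x :: a) = x |` [fset (x + y)%N | y in cset a].
  apply/fsetP => z; rewrite in_cset_cons an !inE /=; congr orb.
  apply/andP/imfsetP => /= [[h1 h2]|[y hy ->]]; last by rewrite leq_addr addKn.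
  by exists (z - x)%N => //; lia.
rewrite cardfsU1 card_imfset; last exact: addnI.
rewrite IH //; have -> /= : x \notin [fset (x + y)%N | y in cset a].
  by apply/imfsetP => -[/= y /(cset_bound ha)]; lia.
by case: (a) an.
Qed.

(** The coefficient of M_a in the sum of the F_b is the number of the sets B inside
    D = set(a) to which [card_exactly_one] applies, which is 2^(|D| - |S|); together with
    the factor 2^(|S| + 1) this gives 2^(|D| + 1), and |D| + 1 is the number of parts.
    The exponent is written so that it is 1 for the empty composition. *)
Lemma peakK_coef S n m : (forall s, s \in S -> (1 < s < n)%N && (s.-1 \notin S)) ->
  peakK S n m =
  if is_comp n (expword m) &&
     (S `<=` cset (expword m) `|` shift1 (cset (expword m)))
  then 2 ^+ (size (expword m)).-1.+1 else 0.
Proof.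
move=> hS; set a := expword m; rewrite /peakK.
have -> : \sum_(b : bword n | is_comp n (parts b) &&
            (S `<=` symdiff (cset (parts b)) (shift1 (cset (parts b)))))
            qsymF (parts b) m =
   (count (fun b : bword n => [&& is_comp n a, is_comp n (parts b),
       cset (parts b) `<=` cset a &
       S `<=` symdiff (cset (parts b)) (shift1 (cset (parts b)))]) (enum {: bword n}))%:R :> int.
  rewrite -sum1_count natr_sum big_enum_cond /= big_mkcond [RHS]big_mkcond /=.
  apply: eq_bigr => b _; have [hb|] /= := boolP (is_comp n (parts b)); last by rewrite andbF.
  rewrite (qsymF_coef m hb) -/a; case: (boolP (is_comp n a)) => ha /=; last by rewrite if_same.
  by rewrite -(refines_cset ha hb) andbC; case: ifP => // _; case: (refines a _).
have [ha|_] /= := boolP (is_comp n a); last by rewrite (@eq_count _ _ pred0) // count_pred0 mulr0.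
set D := cset a.
have -> : count (fun b : bword n => [&& is_comp n (parts b), cset (parts b) `<=` D &
       S `<=` symdiff (cset (parts b)) (shift1 (cset (parts b)))]) (enum {: bword n})
   = count (fun B : {fset nat} => S `<=` symdiff B (shift1 B)) (fpowerset D).
  pose I := [seq cset (parts b) | b <- enum {: bword n} & is_comp n (parts b) && (cset (parts b) `<=` D)].
  have /seq.permP -> : perm_eq (fpowerset D) I.
    apply: uniq_perm; rewrite ?fset_uniq ?map_inj_in_uniq //.
    - by rewrite filter_uniq ?enum_uniq.
    - move=> b c; rewrite !mem_filter => /andP[/andP[hb _] _] /andP[/andP[hc _] _].
      by move/(cset_inj hb hc)/parts_inj.
    move=> B; rewrite fpowersetE; apply/idP/mapP => [hB|[b]]; last first.
      by rewrite mem_filter => /andP[/andP[_ h] _] ->.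
    have [x /(fsubsetP hB)|b [hb eb]] := @cset_surj n B.
      by case/andP: ha => pa /eqP <-; apply: cset_bound.
    have [c hc] := parts_surj hb; exists c; rewrite ?hc ?eb // mem_filter mem_enum hc hb eb.
    by rewrite hB.
  rewrite /I [RHS]count_map [RHS]count_filter; apply: eq_count => b /=.
  by rewrite andbA andbC.
have pa : all (leq 1) a by case/andP: ha.
have hS0 s : s \in S -> (0 < s)%N && (s.-1 \notin S).
  by move=> /hS /andP[/andP[h _] ->]; rewrite andbT; lia.
have hSD : (S `<=` D `|` shift1 D) = all (fun s => (s \in D) || (s.-1 \in D)) S.
  have e s : s \in S -> (s \in D `|` shift1 D) = (s \in D) || (s.-1 \in D).
    move=> hs; rewrite inE; congr orb; apply/imfsetP/idP => /= [[x hx ->] //|h].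
    by exists s.-1 => //; have := hS _ hs; lia.
  by apply/fsubsetP/allP => h s hs; [rewrite -e //|rewrite e //]; apply: h.
rewrite hSD; case: allP => h.
  have [/addnI -> hc] := card_exactly_one hS0 h.
  rewrite natrX -exprD -(card_cset pa); by rewrite -/D addSn subnKC.
rewrite (@eq_in_count _ _ pred0) ?count_pred0 ?mulr0 // => B; rewrite fpowersetE /= => hB.
apply/negbTE/negP => /fsubsetP hs; apply: h => s sS.
have := hs _ sS; rewrite in_symdiff_shift; last by case/andP: (hS0 _ sS).
case e1: (s \in B); case e2: (s.-1 \in B) => // _; first by rewrite (fsubsetP hB _ e1).
by rewrite (fsubsetP hB _ e2) orbT.
Qed.

(** * Valleys *)

(** A bit is true at a descent, so the descents come first and the ascents last. *)
Definition valley (u : seq bool) : bool := sorted (fun x y => y ==> x) u.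

(** The bit of a position compares an entry with the one before it. The first bit of a
    block belongs to the boundary between two blocks and is ignored. *)
Fixpoint valleys (a : seq nat) (w : seq bool) : bool :=
  if a is x :: a' then valley (behead (take x w)) && valleys a' (drop x w) else true.

Definition descents (w : seq bool) : {fset nat} :=
  [fset i in iota 1 (size w).-1 | nth false w i].

(** A peak is a descent i with no descent at i - 1. It is harmless only if i or i - 1
    is the end of a block. *)
Lemma valleysP a w : all (leq 1) a -> size w = sumn a ->
  reflect (forall i, (1 < i < size w)%N -> nth false w i -> ~~ nth false w i.-1 ->
             (i \in cset a) || (i.-1 \in cset a)) (valleys a w).
Proof.
elim: a w => [|x a IH] w /=.
  by move=> _ hw; apply: ReflectT => i; rewrite hw; lia.
case/andP=> hx ha hw.
have hs : size (drop x w) = sumn a by rewrite size_drop; lia.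
have hst : size (take x w) = x by rewrite size_takel //; lia.
have hcs z : (z \in cset (x :: a)) = (a != [::]) && ((z == x) || (x <= z)%N && (z - x \in cset a)%N).
  by rewrite in_cset_cons.
have n0 z : z \in cset a -> (0 < z)%N by move/(cset_bound ha)/andP => [].
apply: (iffP andP) => [[hb /(IH _ ha hs) h] i hi wi wi1|h].
  case: (ltnP i x) => hix.
    have /sortedP hb' := hb; have := hb' false (i.-2).
    rewrite size_behead hst !nth_behead !nth_take; try lia.
    have -> : i.-2.+2 = i by lia.
    have -> : i.-2.+1 = i.-1 by lia.
    by rewrite wi (negbTE wi1) /= => h'; have /h' : (i <= x.-1)%N by lia.
  have an : a != [::] by case: (a) hw => //=; lia.
  rewrite !hcs an /=; case: eqP => //= i1; case: eqP => [|i2]; first by rewrite orbT.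
  have := h (i - x)%N; rewrite hs !nth_drop.
  have -> : (x + (i - x) = i)%N by lia.
  have -> : (x + (i - x).-1 = i.-1)%N by lia.
  have -> : ((i - x).-1 = i.-1 - x)%N by lia.
  move=> /(_ _ wi wi1) h'; have /h' /orP[->|->] : (1 < i - x < sumn a)%N by lia.
    by rewrite hix.
  by rewrite andbT (_ : (x <= i.-1)%N) ?orbT //; lia.
split.
  apply/(sortedP false) => j; rewrite size_behead hst => hj.
  rewrite !nth_behead !nth_take; try lia.
  apply/implyP => w2; apply: contraT => w1; have := h j.+2; rewrite w2 w1 !hcs /=.
  have -> : (x <= j.+2)%N = false by lia.
  have -> : (x <= j.+1)%N = false by lia.
  have -> : (j.+2 == x) = false by lia.
  have -> : (j.+1 == x) = false by lia.
  by rewrite andbF /= => /(_ _ isT isT) h'; apply: h'; lia.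
apply/(IH _ ha hs) => i; rewrite hs !nth_drop => hi wi wi1.
have := h (x + i)%N; rewrite hw wi (_ : (x + i).-1 = x + i.-1)%N; last lia.
rewrite wi1 !hcs !addKn !leq_addr.
have -> : (x + i == x)%N = false by lia.
have -> : (x + i.-1 == x)%N = false by lia.
move=> /(_ _ isT isT) h'; have /h' : (1 < x + i < x + sumn a)%N by lia.
by case/orP => /andP[_ /= ->] //; rewrite orbT.
Qed.

Lemma in_descents w i : (i \in descents w) = ((0 < i < size w)%N && nth false w i).
Proof.
rewrite /descents !inE -[i \in _]/(i \in iota 1 (size w).-1) mem_iota.
by congr andb; case: (size w) => [|n]; lia.
Qed.

Lemma in_peak S s : (s \in peak S) = [&& s \in S, s != 1%N & s.-1 \notin S].
Proof. by rewrite /peak !inE. Qed.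

Lemma peak_descents w s : (s \in peak (descents w)) =
  [&& (1 < s < size w)%N, nth false w s & ~~ nth false w s.-1].
Proof.
rewrite in_peak !in_descents; case: (nth false w s); rewrite ?andbF //=.
by case: (nth false w s.-1); rewrite /= ?andbF ?andbT; lia.
Qed.

Lemma peak_valleys a w : all (leq 1) a -> size w = sumn a ->
  (peak (descents w) `<=` cset a `|` shift1 (cset a)) = valleys a w.
Proof.
move=> ha hw; apply/fsubsetP/(valleysP ha hw) => h s.
  move=> h1 h2 h3; have := h s; rewrite peak_descents h1 h2 h3 => /(_ isT).
  by rewrite inE => /orP[->//|/imfsetP[/= x hx ->]] /=; rewrite hx orbT.
rewrite peak_descents => /and3P[h1 h2 h3]; rewrite inE; have /orP[->//|hx] := h s h1 h2 h3.
by apply/orP; right; apply/imfsetP; exists s.-1 => //=; lia.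
Qed.

(** The form in which peak functions are used: only the valley condition on the word of
    descents of the object remains. *)
Lemma peakK_word n w m : size w = n ->
  peakK (peak (descents w)) n m =
  if sumn (expword m) == n
  then 2 ^+ (size (expword m)).-1.+1 * (valleys (expword m) w)%:R else 0.
Proof.
move=> hw; rewrite peakK_coef /is_comp ?expword_pos /=.
  case: eqP => //= e; rewrite peak_valleys ?expword_pos ?hw //.
  by case: valleys; rewrite ?mulr1 ?mulr0.
move=> s; rewrite !peak_descents hw => /and3P[-> h1 h2] /=; rewrite (negbTE h2).
by rewrite !andbF.
Qed.

(** * Transfer operators of generating trees *)

Fixpoint bit_words n : seq (seq bool) :=
  if n is n'.+1 then map (cons true) (bit_words n') ++ map (cons false) (bit_words n')
  else [:: [::]].

Lemma big_bit_words_cons n (H : seq bool -> int) :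
  \sum_(w <- bit_words n.+1) H w =
  \sum_(w <- bit_words n) H (true :: w) + \sum_(w <- bit_words n) H (false :: w).
Proof. by rewrite /= big_cat !big_map. Qed.

Lemma big_bit_words_rcons n (H : seq bool -> int) :
  \sum_(w <- bit_words n.+1) H w =
  \sum_(w <- bit_words n) H (rcons w true) + \sum_(w <- bit_words n) H (rcons w false).
Proof.
elim: n H => [|n IH] H; first by rewrite big_bit_words_cons !big_seq1.
rewrite [LHS]big_bit_words_cons [X in X + _]IH [X in _ + X = _]IH.
by rewrite [X in _ = X + _]big_bit_words_cons [X in _ = _ + X]big_bit_words_cons addrACA.
Qed.

Lemma big_bit_words_cat a b (H : seq bool -> seq bool -> int) :
  \sum_(w <- bit_words (a + b)) H (take a w) (drop a w) =
  \sum_(u <- bit_words a) \sum_(v <- bit_words b) H u v.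
Proof.
elim: a H => [|a IH] H.
  by rewrite big_seq1; apply: eq_bigr => w _; rewrite take0 drop0.
by rewrite addSn !big_bit_words_cons /= (IH (fun u v => H (true :: u) v)) (IH (fun u v => H (false :: u) v)).
Qed.

(** A function on the states is a weight of the possible futures of an object. The
    operator [op d] makes the future begin with a step of direction d, where true is a
    descent; [op_valley b] makes it begin with b steps, first descents and then ascents; in
    [op_blocks a] the first step of each block has any direction and the others form a
    valley. *)
Section Automaton.
Variables (St : Type) (step : bool -> St -> seq St).

Definition op (d : bool) (f : St -> int) : St -> int :=
  fun x => \sum_(y <- step d x) f y.
Definition op_any (f : St -> int) : St -> int := fun x => op true f x + op false f x.
Fixpoint op_valley (b : nat) (f : St -> int) : St -> int :=
  if b is b'.+1 then fun x => iter b (op false) f x + op true (op_valley b' f) x else f.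
Definition op_blocks (a : seq nat) (f : St -> int) : St -> int :=
  foldr (fun x g => op_any (op_valley x.-1 g)) f a.
Definition run_word (w : seq bool) (f : St -> int) : St -> int := foldr op f w.

Lemma op_sum I (r : seq I) d (F : I -> St -> int) :
  op d (fun x => \sum_(i <- r) F i x) = fun x => \sum_(i <- r) op d (F i) x.
Proof. by apply: functional_extensionality => x; rewrite /op exchange_big. Qed.

Lemma op_scale d c (f : St -> int) :
  op d (fun x => c * f x) = fun x => c * op d f x.
Proof. by apply: functional_extensionality => x; rewrite /op mulr_sumr. Qed.

Lemma run_word_sum I (r : seq I) w (F : I -> St -> int) :
  run_word w (fun x => \sum_(i <- r) F i x) = fun x => \sum_(i <- r) run_word w (F i) x.
Proof. by elim: w => //= d w ->; rewrite op_sum. Qed.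

Lemma run_word_scale w c (f : St -> int) :
  run_word w (fun x => c * f x) = fun x => c * run_word w f x.
Proof. by elim: w => //= d w ->; rewrite op_scale. Qed.

Lemma valley_cons d u :
  valley (d :: u) = if d then valley u else all negb u.
Proof.
case: d; first by case: u => [|[] u].
rewrite /valley /=; elim: u => [|[] u IH] //=.
Qed.

Lemma run_word_asc b (f : St -> int) x :
  \sum_(u <- bit_words b) (all negb u)%:R * run_word u f x = iter b (op false) f x.
Proof.
elim: b x => [|b IH] x; first by rewrite big_seq1 mul1r.
rewrite big_bit_words_cons big1 ?add0r /=; last by move=> w _; rewrite mul0r.
have -> : op false (iter b (op false) f) x =
  op false (fun x => \sum_(u <- bit_words b) (all negb u)%:R * run_word u f x) x.
  by congr op; apply: functional_extensionality => y; rewrite IH.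
by rewrite op_sum; apply: eq_bigr => u _; rewrite op_scale.
Qed.

(** A valley is either all ascents or begins with a descent followed by a valley; this is
    the recursion that defines [op_valley]. *)
Lemma run_word_valley b (f : St -> int) x :
  \sum_(u <- bit_words b) (valley u)%:R * run_word u f x = op_valley b f x.
Proof.
elim: b x => [|b IH] x; first by rewrite big_seq1 mul1r.
rewrite big_bit_words_cons /= addrC; congr (_ + _).
  rewrite -[RHS]/(iter b.+1 (op false) f x) -run_word_asc big_bit_words_cons [X in _ = X + _]big1 ?add0r.
    by apply: eq_bigr => w _; rewrite -[path _ false w]/(valley (false :: w)) valley_cons.
  by move=> w _; rewrite /= mul0r.
have -> : op_valley b f = fun x => \sum_(u <- bit_words b) (valley u)%:R * run_word u f x.
  by apply: functional_extensionality => y; rewrite IH.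
rewrite op_sum; apply: eq_bigr => w _.
by rewrite -[path _ true w]/(valley (true :: w)) valley_cons op_scale.
Qed.

Lemma run_word_cat u v (f : St -> int) : run_word (u ++ v) f = run_word u (run_word v f).
Proof. by rewrite /run_word foldr_cat. Qed.

Lemma run_word_valleys a (f : St -> int) x : all (leq 1) a ->
  \sum_(w <- bit_words (sumn a)) (valleys a w)%:R * run_word w f x = op_blocks a f x.
Proof.
elim: a x => [|b a IH] x /=; first by rewrite big_seq1 mul1r.
case/andP=> hb ha.
pose H u v : int := (valley (behead u) && valleys a v)%:R * run_word (u ++ v) f x.
transitivity (\sum_(w <- bit_words (b + sumn a)) H (take b w) (drop b w)).
  by apply: eq_bigr => w _; rewrite /H cat_take_drop.
rewrite big_bit_words_cat.
transitivity (\sum_(u <- bit_words b) (valley (behead u))%:R * run_word u (op_blocks a f) x).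
  apply: eq_bigr => u _.
  have -> : op_blocks a f = fun x => \sum_(w <- bit_words (sumn a)) (valleys a w)%:R * run_word w f x.
    by apply: functional_extensionality => y; rewrite IH.
  rewrite run_word_sum mulr_sumr; apply: eq_bigr => v _.
  by rewrite run_word_scale /H run_word_cat mulrA -natrM mulnb.
case: b hb => // b _; rewrite big_bit_words_cons /=.
have h d : \sum_(w <- bit_words b) (valley w)%:R * op d (run_word w (op_blocks a f)) x
    = op d (op_valley b (op_blocks a f)) x.
  have -> : op_valley b (op_blocks a f) = fun x => \sum_(u <- bit_words b) (valley u)%:R * run_word u (op_blocks a f) x.
    by apply: functional_extensionality => y; rewrite run_word_valley.
  by rewrite op_sum; apply: eq_bigr => w _; rewrite op_scale.
by rewrite !h.
Qed.

(** A generating tree with root t0. Each child extends the word of descents by one bit,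
    and a state function st intertwines the tree with the automaton. *)
Section Tree.
Variables (T : eqType) (ch : T -> seq T) (t0 : T) (des_bits : T -> seq bool) (st : T -> St).
Fixpoint level n : seq T :=
  if n is n'.+1 then flatten [seq ch t | t <- level n'] else [:: t0].
Hypothesis dw0 : des_bits t0 = [::].
Hypothesis des_bits_ch : forall t t', t' \in ch t -> exists d, des_bits t' = rcons (des_bits t) d.
Hypothesis st_ch : forall n t F d, t \in level n ->
  \sum_(t' <- ch t | des_bits t' == rcons (des_bits t) d) F (st t') = op d F (st t).

Lemma tree_words n (G : seq bool -> int) (F : St -> int) :
  \sum_(t <- level n) G (des_bits t) * F (st t) =
  \sum_(w <- bit_words n) G w * run_word w F (st t0).
Proof.
elim: n G F => [|n IH] G F; first by rewrite !big_seq1 dw0.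
rewrite /= big_flatten big_map big_bit_words_rcons.
have hr w d : run_word (rcons w d) F = run_word w (op d F) by rewrite -cats1 run_word_cat.
under [X in _ = X + _]eq_bigr => w _ do rewrite hr.
under [X in _ = _ + X]eq_bigr => w _ do rewrite hr.
rewrite -(IH (fun w => G (rcons w true))) -(IH (fun w => G (rcons w false))).
rewrite -big_split /= big_seq [RHS]big_seq; apply: eq_bigr => t ht.
rewrite -!(@st_ch n) // !mulr_sumr.
rewrite (bigID (fun t' => des_bits t' == rcons (des_bits t) true)) /=; congr (_ + _).
  by apply: eq_bigr => t' /eqP ->.
have hP t' : t' \in ch t -> (des_bits t' != rcons (des_bits t) true) = (des_bits t' == rcons (des_bits t) false).
  by move=> /des_bits_ch[d ->]; rewrite !eqseq_rcons !eqxx /=; case: d.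
rewrite big_seq_cond [RHS]big_seq_cond; under eq_bigl => t' do rewrite (andb_id2l (hP t')).
by apply: eq_bigr => t' /andP[_ /eqP->].
Qed.

(** The weighted count of the objects of a level with valley blocks is a value of a product
    of block operators, which is computed without the tree. *)
Lemma tree_valleys a (F : St -> int) : all (leq 1) a ->
  \sum_(t <- level (sumn a)) (valleys a (des_bits t))%:R * F (st t) = op_blocks a F (st t0).
Proof. by move=> ha; rewrite (tree_words _ (fun w => (valleys a w)%:R)) run_word_valleys. Qed.

End Tree.
End Automaton.

(** * One-line words of permutations *)

(** Appends an entry v and shifts the entries that are at least v, so that s keeps its
    relative order. Every permutation of size n + 1 arises once. *)
Definition append (s : seq nat) (v : nat) : seq nat := rcons (map (bump v) s) v.

(** One-line words here have the entries 0, ..., n - 1. *)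
Definition isperm n (s : seq nat) : bool := [&& size s == n, uniq s & all (ltn^~ n) s].

Definition same_order (t : seq nat) (x y z : nat) : bool :=
  [&& (x < y)%N == (nth 0 t 0 < nth 0 t 1)%N,
      (x < z)%N == (nth 0 t 0 < nth 0 t 2)%N &
      (y < z)%N == (nth 0 t 1 < nth 0 t 2)%N].

Definition pairs (e : nat -> nat -> bool) (s : seq nat) : bool :=
  has (fun j => has (fun i => e (nth 0%N s i) (nth 0%N s j)) (iota 0 j))
      (iota 0 (size s)).

(** v becomes the last letter of an occurrence of t. *)
Definition completes (t : seq nat) (s : seq nat) (v : nat) : bool :=
  pairs (fun x y => same_order t (bump v x) (bump v y) v) s.

Definition containsw (t : seq nat) (s : seq nat) : bool :=
  has (fun k => pairs (fun x y => same_order t x y (nth 0%N s k)) (take k s))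
      (iota 0 (size s)).

Definition safe (P : seq (seq nat)) s v := all (fun t => ~~ completes t s v) P.

Definition avoid (P : seq (seq nat)) s := all (fun t => ~~ containsw t s) P.

Definition perm_children (P : seq (seq nat)) (s : seq nat) : seq (seq nat) :=
  [seq append s v | v <- iota 0 (size s).+1 & safe P s v].

(** The bit at position 0 has no meaning and is set to false. *)
Definition des_bits (s : seq nat) : seq bool :=
  [seq (0 < i)%N && (nth 0 s i < nth 0 s i.-1)%N | i <- iota 0 (size s)].

Lemma pairsP (e : nat -> nat -> bool) s : reflect
  (exists i j, [/\ (i < j)%N, (j < size s)%N & e (nth 0%N s i) (nth 0%N s j)])
  (pairs e s).
Proof.
apply: (iffP hasP) => [[j]|[i [j [h1 h2 h3]]]].
  rewrite mem_iota => hj /hasP[i]; rewrite mem_iota => hi h.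
  by exists i, j; split=> //; lia.
by exists j; rewrite ?mem_iota //; apply/hasP; exists i; rewrite ?mem_iota.
Qed.

Lemma containswP t s : reflect
  (exists i j k, [/\ (i < j)%N, (j < k)%N, (k < size s)%N
     & same_order t (nth 0%N s i) (nth 0%N s j) (nth 0%N s k)]) (containsw t s).
Proof.
apply: (iffP hasP) => [[k]|[i [j [k [h1 h2 h3 h4]]]]].
  rewrite mem_iota => hk /pairsP[i [j [h1]]]; rewrite size_takel; last lia.
  by move=> h2; rewrite !nth_take //; [exists i, j, k|lia].
exists k; rewrite ?mem_iota //; apply/pairsP; exists i, j.
by rewrite size_takel ?nth_take; try lia.
Qed.

Lemma bump_lt v x y : (bump v x < bump v y)%N = (x < y)%N.
Proof. rewrite /bump; lia. Qed.

Lemma same_order_bump t v x y z : same_order t (bump v x) (bump v y) (bump v z) = same_order t x y z.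
Proof. by rewrite /same_order !bump_lt. Qed.

Lemma size_append s v : size (append s v) = (size s).+1.
Proof. by rewrite size_rcons size_map. Qed.

Lemma nth_append s v i : (i < size s)%N -> nth 0%N (append s v) i = bump v (nth 0%N s i).
Proof. by move=> hi; rewrite nth_rcons size_map hi (nth_map 0%N). Qed.

Lemma nth_append_last s v : nth 0%N (append s v) (size s) = v.
Proof. by rewrite nth_rcons size_map ltnn eqxx. Qed.

Lemma containsw_append t s v : containsw t (append s v) = containsw t s || completes t s v.
Proof.
apply/containswP/orP => [[i [j [k [h1 h2]]]]|].
  rewrite size_append ltnS leq_eqVlt => /orP[/eqP ek|hk].
    rewrite ek nth_append_last !nth_append; try lia.
    by right; apply/pairsP; exists i, j; split=> //; lia.
  rewrite !nth_append; try lia.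
  by rewrite same_order_bump; left; apply/containswP; exists i, j, k.
case=> [/containswP[i [j [k [h1 h2 h3 h4]]]]|/pairsP[i [j [h1 h2 h3]]]].
  exists i, j, k; rewrite size_append !nth_append ?same_order_bump; try lia.
  by split=> //; lia.
by exists i, j, (size s); rewrite size_append nth_append_last !nth_append //; lia.
Qed.

Lemma avoid_append P s v : avoid P (append s v) = avoid P s && safe P s v.
Proof.
rewrite /avoid /safe -all_predI; apply: eq_all => t /=.
by rewrite containsw_append negb_or.
Qed.

Lemma bump_inj v : injective (bump v).
Proof. by move=> x y; rewrite /bump; lia. Qed.

Lemma isperm_append n s v : isperm n.+1 (append s v) = (v <= n)%N && isperm n s.
Proof.
rewrite /isperm size_append eqSS /append rcons_uniq map_inj_uniq; last exact: bump_inj.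
rewrite all_rcons /= ltnS; case: (size s =P n) => hs; rewrite ?andbF //=.
have -> /= : v \notin map (bump v) s.
  by apply/mapP => -[x _]; rewrite /bump; lia.
case: (uniq s); rewrite ?andbF //=.
case hv: (v <= n)%N => //=; rewrite all_map; apply: eq_all => x /=.
by rewrite /bump; lia.
Qed.

Lemma append_surj n s : isperm n.+1 s -> exists s' v, s = append s' v.
Proof.
case/lastP: s => [/andP[]//|s v] /and3P[_ hu _].
exists (map (unbump v) s), v; rewrite /append -map_comp map_id_in // => x hx /=.
rewrite unbumpK // inE; apply/negP => /eqP e.
by move: hu; rewrite rcons_uniq -e hx.
Qed.

Lemma append_inj s s' v v' : append s v = append s' v' -> s = s' /\ v = v'.
Proof.
move/rcons_inj => [e ev]; subst v'; split=> //.
by apply: inj_map e; apply: bump_inj.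
Qed.

Lemma mem_level P n s : (s \in level (perm_children P) [::] n) = isperm n s && avoid P s.
Proof.
elim: n s => [|n IH] s /=.
  rewrite inE; apply/eqP/andP => [->|[]]; last by case: s.
  by split=> //; apply/allP.
apply/flatten_mapP/andP => [[s' hs' /mapP[v]]|[hp ha]].
  rewrite mem_filter mem_iota => /andP[hok hv] ->.
  move: hs'; rewrite IH => /andP[hp' ha']; rewrite isperm_append avoid_append hp' ha' hok.
  by case/and3P: hp' => /eqP hs _ _; rewrite andbT; split=> //; lia.
have [s' [v e]] := append_surj hp; move: hp ha; rewrite e isperm_append avoid_append.
move=> /andP[hv hp] /andP[ha hok]; exists s'; first by rewrite IH hp ha.
apply/mapP; exists v => //; rewrite mem_filter hok mem_iota.
by case/and3P: hp => /eqP -> _ _; lia.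
Qed.

Lemma level_uniq P n : uniq (level (perm_children P) [::] n).
Proof.
elim: n => //= n IH.
elim: (level (perm_children P) [::] n) IH => //= s r IHr /andP[hs /IHr hr].
rewrite cat_uniq hr andbT; apply/andP; split.
  rewrite map_inj_in_uniq ?filter_uniq ?iota_uniq // => v v' _ _ /append_inj[_] //.
apply/hasPn => x /flatten_mapP[s' hs' /mapP[v' _ ->]]; apply/negP => /mapP[v _ /append_inj[e _]].
by rewrite -e hs' in hs.
Qed.

Lemma size_des_bits s : size (des_bits s) = size s.
Proof. by rewrite size_map size_iota. Qed.

Lemma nth_des_bits s i : (i < size s)%N ->
  nth false (des_bits s) i = (0 < i)%N && (nth 0 s i < nth 0 s i.-1)%N.
Proof. by move=> hi; rewrite (nth_map 0%N) ?size_iota // nth_iota. Qed.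

Lemma des_bits_append s v : des_bits (append s v) = rcons (des_bits s) ((s != [::]) && (v <= last 0 s)%N).
Proof.
apply: (@eq_from_nth _ false) => [|i]; first by rewrite size_rcons !size_des_bits size_append.
rewrite size_des_bits size_append => hi.
rewrite nth_des_bits ?size_append // nth_rcons size_des_bits.
move: hi; rewrite ltnS leq_eqVlt => /orP[/eqP->|hi].
  rewrite ltnn eqxx nth_append_last; case: (lastP s) => [|s' x] //; rewrite last_rcons size_rcons /=.
  rewrite nth_append ?size_rcons // nth_rcons ltnn eqxx -size_eq0 size_rcons /=.
  by rewrite /bump; lia.
rewrite hi nth_des_bits // !nth_append ?bump_lt //; lia.
Qed.

Lemma des_bits_ch P s s' : s' \in perm_children P s -> exists d, des_bits s' = rcons (des_bits s) d.
Proof. by case/mapP => v _ ->; eexists; apply: des_bits_append. Qed.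
Definition word n (p : 'S_n) : seq nat := [seq val (p i) | i <- enum 'I_n].

Lemma size_word n (p : 'S_n) : size (word p) = n.
Proof. by rewrite size_map size_enum_ord. Qed.

Lemma nth_word n (p : 'S_n) (i : 'I_n) : nth 0%N (word p) i = p i.
Proof. by rewrite (nth_map i) ?size_enum_ord // nth_ord_enum. Qed.

Lemma oneline_word n (p : 'S_n) : oneline p = map S (word p).
Proof. by rewrite /word -map_comp. Qed.

Lemma nth_oneline n (p : 'S_n) (i : 'I_n) : nth 0%N (oneline p) i = (p i).+1.
Proof. by rewrite oneline_word (nth_map 0%N) ?size_word // nth_word. Qed.

Lemma word_inj n : injective (@word n).
Proof.
move=> p q e; apply/permP => i; apply: val_inj.
by move: (nth_word p i) (nth_word q i); rewrite e => -> /=.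
Qed.

Lemma isperm_word n (p : 'S_n) : isperm n (word p).
Proof.
rewrite /isperm size_word eqxx map_inj_uniq ?enum_uniq /=; last first.
  by move=> i j /val_inj/perm_inj.
by apply/allP => x /mapP[i _ ->]; apply: ltn_ord.
Qed.

Lemma word_surj n s : isperm n s -> exists p : 'S_n, word p = s.
Proof.
case/and3P => /eqP hs hu ha.
have hlt (i : 'I_n) : (nth 0%N s i < n)%N by apply: (allP ha); apply: mem_nth; rewrite hs.
pose f (i : 'I_n) := Ordinal (hlt i).
have fi : injective f.
  move=> i j [] /eqP; rewrite nth_uniq ?hs // => /eqP h; exact: val_inj.
exists (perm fi); apply: (@eq_from_nth _ 0%N); rewrite size_word // => i hi.
by rewrite -[i]/(val (Ordinal hi)) nth_word permE.
Qed.

Lemma perm_des_word n (p : 'S_n) : perm_des p = descents (des_bits (word p)).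
Proof.
apply/fsetP => i; rewrite in_descents size_des_bits size_word /perm_des !inE.
rewrite -[i \in mem_fin _]/(i \in iota 1 n.-1) mem_iota.
case: (posnP i) => [->//|i0] /=.
have -> : (i < 1 + n.-1)%N = (i < n)%N by case: (n) => [|k]; lia.
case hi: (i < n)%N => //=.
rewrite nth_des_bits ?size_word // i0 oneline_word !(nth_map 0%N) ?size_word //; lia.
Qed.

(** An occurrence is given by its three positions, and the order of the values of t by the
    three comparisons of [same_order]. *)
Lemma contains_word n (p : 'S_n) (t : 'S_3) : contains p t = containsw (oneline t) (word p).
Proof.
pose a0 : 'I_3 := ord0; pose a1 : 'I_3 := Ordinal (isT : 1 < 3)%N.
pose a2 : 'I_3 := ord_max.
have o0 : nth 0%N (oneline t) 0 = (t a0).+1 by rewrite -nth_oneline.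
have o1 : nth 0%N (oneline t) 1 = (t a1).+1 by rewrite -nth_oneline.
have o2 : nth 0%N (oneline t) 2 = (t a2).+1 by rewrite -nth_oneline.
apply/existsP/containswP => [[f /forallP h]|[i [j [k [h1 h2 h3]]]]].
  have hf (a b : 'I_3) : (a < b)%N -> (f a < f b)%N.
    by move=> hab; have /forallP/(_ b)/andP[] := h a; rewrite hab.
  have hp (a b : 'I_3) : (p (f a) < p (f b))%N = (t a < t b)%N.
    by have /forallP/(_ b)/andP[_ /eqP] := h a.
  exists (f a0), (f a1), (f a2); rewrite !hf // size_word ltn_ord !nth_word.
  by rewrite /same_order o0 o1 o2 !ltnS !hp !eqxx.
rewrite size_word in h3.
have hi : (i < n)%N by lia.
have hj : (j < n)%N by lia.
rewrite -[i]/(val (Ordinal hi)) -[j]/(val (Ordinal hj)) -[k]/(val (Ordinal h3)) !nth_word.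
rewrite /same_order o0 o1 o2 !ltnS => /and3P[/eqP e1 /eqP e2 /eqP e3].
pose g := [fun a : 'I_3 => Ordinal h3 with a0 |-> Ordinal hi, a1 |-> Ordinal hj].
have g0 : g a0 = Ordinal hi by [].
have g1 : g a1 = Ordinal hj by [].
have g2 : g a2 = Ordinal h3 by [].
have pn (x y : 'I_n) : val x != val y -> (p x < p y)%N = ~~ (p y < p x)%N.
  by move=> hxy; rewrite -leqNgt ltn_neqAle val_eqE (inj_eq perm_inj) -val_eqE hxy.
have tn (x y : 'I_3) : x != y -> (t x < t y)%N = ~~ (t y < t x)%N.
  by move=> hxy; rewrite -leqNgt ltn_neqAle val_eqE (inj_eq perm_inj) hxy.
have c3 (a : 'I_3) : [|| a == a0, a == a1 | a == a2] by case: a => [[|[|[|]]]].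
exists [ffun a => g a]; apply/forallP => a; apply/forallP => b; rewrite !ffunE.
case/or3P: (c3 a) => /eqP->; case/or3P: (c3 b) => /eqP->;
  rewrite ?g0 ?g1 ?g2 ?ltnn ?eqxx //= ?h1 ?h2 ?(ltn_trans h1 h2) //= ?e1 ?e2 ?e3 //.
- by rewrite pn ?e1 -?tn //=; lia.
- by rewrite pn ?e2 -?tn //=; lia.
- by rewrite pn ?e3 -?tn //=; lia.
Qed.

Definition words_of (Pi : {set 'S_3}) : seq (seq nat) := [seq oneline t | t <- enum Pi].

(** By [avoidR_coef] these numbers are the coefficients of the pattern-avoiding peak
    function, up to a power of 2. *)
Definition perm_count (P : seq (seq nat)) (a : seq nat) : int :=
  \sum_(s <- level (perm_children P) [::] (sumn a)) (valleys a (des_bits s))%:R.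

Lemma Av_level n (Pi : {set 'S_3}) (G : seq nat -> int) :
  \sum_(p in Av n Pi) G (word p) = \sum_(s <- level (perm_children (words_of Pi)) [::] n) G s.
Proof.
rewrite -big_enum -(big_map (@word n) predT) /=; apply: perm_big; apply: uniq_perm.
- by rewrite map_inj_uniq ?enum_uniq //; apply: word_inj.
- exact: level_uniq.
have hAv (p : 'S_n) : (p \in Av n Pi) = avoid (words_of Pi) (word p).
  rewrite inE; apply/forallP/allP => [h _ /mapP[t ht ->]|h t].
    have := h t; rewrite mem_enum in ht; rewrite ht /=.
    by rewrite contains_word.
  apply/implyP => ht; rewrite contains_word; apply: h; apply/mapP.
  by exists t; rewrite ?mem_enum.
move=> s; rewrite mem_level; apply/mapP/andP => [[p]|[hs ha]].
  by rewrite mem_enum hAv => h ->; rewrite isperm_word.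
have [p hp] := word_surj hs; exists p => //.
by rewrite mem_enum hAv hp.
Qed.

Lemma avoidR_coef Pi n m : avoidR Pi n m =
  if sumn (expword m) == n then
    2 ^+ (size (expword m)).-1.+1 * perm_count (words_of Pi) (expword m) else 0.
Proof.
rewrite /avoidR; under eq_bigr => p _ do rewrite perm_des_word.
rewrite (Av_level n Pi (fun s => peakK (peak (descents (des_bits s))) n m)).
have e s : s \in level (perm_children (words_of Pi)) [::] n -> peakK (peak (descents (des_bits s))) n m =
   if sumn (expword m) == n
  then 2 ^+ (size (expword m)).-1.+1 * (valleys (expword m) (des_bits s))%:R else 0.
  by rewrite mem_level => /andP[/and3P[/eqP hs _ _] _]; apply: peakK_word; rewrite size_des_bits.
rewrite big_seq; under eq_bigr => s hs do rewrite (e s hs).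
rewrite -big_seq; case: eqP => [en|_]; last by rewrite big1.
by rewrite /perm_count mulr_sumr en.
Qed.

Lemma level_eq (T : eqType) (c c' : T -> seq T) t n : c =1 c' -> level c t n = level c' t n.
Proof. by move=> e; elim: n => //= n ->; congr flatten; apply: eq_map. Qed.

Lemma perm_count_eqi P P' a : P =i P' -> perm_count P a = perm_count P' a.
Proof.
move=> e; rewrite /perm_count (@level_eq _ _ (perm_children P')) // => s.
congr map; apply: eq_filter => v; exact: eq_all_r.
Qed.

(** * Content words of shifted tableaux *)

(** A tableau is encoded by the word whose letters are the contents (column minus row) of
    the cells of 1, 2, ..., n; the cells of a given content form a diagonal of the
    shifted diagram. *)
Definition content (w : seq nat) (j : nat) : nat := count_mem j w.

(** The lengths of the diagonals of a shifted diagram decrease by at most one from each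
    diagonal to the next, and this characterizes shifted diagrams. *)
Definition profile_ok (N : nat) (k : nat -> nat) : bool :=
  all (fun j => (k j.+1 <= k j <= (k j.+1).+1)%N) (iota 0 N).

Definition word_children (N : nat) (w : seq nat) : seq (seq nat) :=
  [seq rcons w c | c <- iota 0 N & profile_ok N (content (rcons w c))].

(** The row of length l_i has the contents 0, ..., l_i - 1, so this is the length of the
    diagonal j of the diagram of l. *)
Definition profile (l : seq nat) (j : nat) : nat := count (ltn j) l.

Lemma profile_okP N k : reflect (forall j, (j < N)%N -> (k j.+1 <= k j <= (k j.+1).+1)%N) (profile_ok N k).
Proof.
apply: (iffP allP) => h j; last by rewrite mem_iota => hj; apply: h.
by move=> hj; apply: h; rewrite mem_iota.
Qed.

(** The words of the tree are those all of whose prefixes have the diagonal lengths of a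
    shifted diagram. *)
Lemma mem_word_level N n w : reflect
  [/\ size w = n, (forall x, x \in w -> x < N)%N
    & forall t, (t <= n)%N -> profile_ok N (content (take t w))] (w \in level (word_children N) [::] n).
Proof.
elim: n w => [|n IH] w /=.
  rewrite inE; apply: (iffP eqP) => [->|[]]; last by case: w.
  by split=> // t _; apply/profile_okP.
apply: (iffP flatten_mapP) => [[v /IH[hs hx hg] /mapP[c]]|[hs hx hg]].
  rewrite mem_filter mem_iota => /andP[hc hcN] ->; split.
  - by rewrite size_rcons hs.
  - by move=> x; rewrite mem_rcons inE => /orP[/eqP->|/hx].
  move=> t; rewrite leq_eqVlt => /orP[/eqP->|ht].
    by rewrite take_oversize // size_rcons hs.
  by rewrite -cats1 takel_cat ?hg // hs.
case/lastP: w hs hx hg => // v c; rewrite size_rcons => -[hs] hx hg.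
exists v.
  apply/IH; split=> // [x hxv|t ht]; first by apply: hx; rewrite mem_rcons inE hxv orbT.
  by have := hg t; rewrite -cats1 takel_cat ?hs //; apply; lia.
apply/mapP; exists c => //; rewrite mem_filter mem_iota.
have -> : (c < N)%N by apply: hx; rewrite mem_rcons inE eqxx.
by have := hg n.+1; rewrite take_oversize ?size_rcons ?hs // => ->.
Qed.

Lemma word_level_uniq N n : uniq (level (word_children N) [::] n).
Proof.
elim: n => //= n IH.
elim: (level (word_children N) [::] n) IH => //= s r IHr /andP[hs /IHr hr].
rewrite cat_uniq hr andbT; apply/andP; split.
  rewrite map_inj_in_uniq ?filter_uniq ?iota_uniq // => v v' _ _ /rcons_inj[] //.
apply/hasPn => x /flatten_mapP[s' hs' /mapP[v' _ ->]]; apply/negP => /mapP[v _ /rcons_inj[e _]].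
by rewrite -e hs' in hs.
Qed.

(** The cells of the diagonal j lie in the first rows, one in each. *)
Lemma profileP l i j : sorted gtn l -> (i < profile l j)%N = (j < nth 0 l i)%N.
Proof.
elim: l i => [|x l IH] i /=; first by rewrite nth_nil.
move=> hl; have hl' := path_sorted hl; rewrite /profile /= -/(profile l j).
case: (ltnP j x) => hx; first by case: i => [|i] //=; rewrite add1n ltnS IH.
have -> : profile l j = 0%N.
  apply/eqP; rewrite -leqn0 leqNgt -has_count; apply/hasPn => y hy.
  move: hl; rewrite path_sortedE; last by move=> a b c /=; lia.
  by case/andP => /allP /(_ y hy) /=; lia.
case: i => [|i] /=; first by lia.
have := hl; rewrite path_sortedE; last by move=> a b c /=; lia.
case/andP => /allP h _.
case: (ltnP i (size l)) => hi; last by rewrite nth_default.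
by have := h _ (mem_nth 0%N hi); rewrite /=; lia.
Qed.

Lemma count_take_lt (j : nat) (w : seq nat) s t : (s < t)%N -> (s < size w)%N ->
  nth 0%N w s = j -> (count_mem j (take s w) < count_mem j (take t w))%N.
Proof.
move=> hst hs hj; have -> : t = (s.+1 + (t - s.+1))%N by lia.
rewrite takeD (take_nth 0%N hs) hj count_cat -cats1 count_cat /= eqxx; lia.
Qed.

Lemma occurrence (j : nat) (w : seq nat) i : (i < count_mem j w)%N ->
  exists s, [/\ (s < size w)%N, nth 0%N w s = j & count_mem j (take s w) = i].
Proof.
elim/last_ind: w => // w x IH; rewrite -cats1 count_cat /= addn0.
case: (ltnP i (count_mem j w)) => [/IH[s [h1 h2 h3]] _|h1 h2].
  by exists s; rewrite size_cat /= nth_cat h1 takel_cat; [split=> //; lia|lia].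
have [e|ne] := eqVneq x j; last first.
  by rewrite (negbTE ne) addn0 in h2; have := leq_trans h2 h1; rewrite ltnn.
exists (size w); rewrite size_cat /= nth_cat ltnn subnn take_size_cat //=.
split=> //; first by rewrite addn1.
by apply/eqP; rewrite eqn_leq h1; move: h2; rewrite e eqxx addn1 ltnS => ->.
Qed.

Lemma nth_in (l : seq nat) i j : (j < nth 0 l i)%N -> (i < size l)%N.
Proof. by move=> h; rewrite ltnNge; apply: contraL h => h; rewrite nth_default. Qed.

Section Tableau.
Variables (l : seq nat).
Hypothesis l_sorted : sorted gtn l.
Local Notation n := (sumn l).
Local Notation cell := (shcell l).

Lemma cell_inj (c d : cell) : tag c = tag d :> nat -> tagged c = tagged d :> nat -> c = d.
Proof.
case: c d => [i x] [i' x'] /= /val_inj e; subst i' => /val_inj -> //.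
Qed.

Lemma cell_ex i j : (j < nth 0 l i)%N -> exists c : cell, tag c = i :> nat /\ tagged c = j :> nat.
Proof.
move=> h; have hi := nth_in h.
by exists (existT _ (Ordinal hi) (Ordinal (h : j < nth 0 l (Ordinal hi))%N)).
Qed.

Lemma cell_in (c : cell) : (tagged c < nth 0 l (tag c))%N.
Proof. exact: ltn_ord. Qed.

Lemma nth_decr i : (0 < nth 0 l i.+1)%N -> (nth 0 l i.+1 < nth 0 l i)%N.
Proof.
move=> h; have hi := nth_in h.
by have /sortedP := l_sorted; apply.
Qed.

Lemma nth_decr2 i i' : (i <= i')%N -> (0 < nth 0 l i')%N -> (nth 0 l i' + (i' - i) <= nth 0 l i)%N.
Proof.
move=> hi; have -> : i' = (i + (i' - i))%N by lia.
elim: (i' - i)%N => [|k IH]; first by rewrite addn0; lia.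
rewrite addnS => h; have := nth_decr h; have := IH; lia.
Qed.

Variable T : {ffun cell -> 'I_n}.
Hypothesis hT : T \in SShT l.

Lemma sst_inj : injective T.
Proof.
move: hT; rewrite inE => /and3P[/forallP h _ _] c d e.
have /cards1P[x hx] := h (T c).
have : c \in [set x] by rewrite -hx inE.
have : d \in [set x] by rewrite -hx inE e.
by rewrite !inE => /eqP-> /eqP->.
Qed.

Lemma sst_surj v : exists c, T c = v.
Proof.
move: hT; rewrite inE => /and3P[/forallP h _ _].
have /cards1P[x hx] := h v; exists x.
have : x \in [set x] by rewrite inE.
by rewrite -hx inE => /eqP.
Qed.

Lemma sst_row (c d : cell) : tag c = tag d :> nat -> (tagged c < tagged d)%N -> (T c < T d)%N.
Proof.
move: hT; rewrite inE => /and3P[_ /forallP h _] e hlt.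
have /forallP/(_ d)/implyP := h c; apply; apply/andP; split; [apply/eqP|]; rewrite /cell_row /cell_col; lia.
Qed.

Lemma sst_col (c d : cell) : (tag c + tagged c = tag d + tagged d)%N -> (tag c < tag d)%N ->
  (T c < T d)%N.
Proof.
move: hT; rewrite inE => /and3P[_ _ /forallP h] e hlt.
have /forallP/(_ d)/implyP := h c; apply; apply/andP; split; [apply/eqP|]; rewrite /cell_row /cell_col; lia.
Qed.

Lemma sst_colE (c d : cell) i j i' j' : tag c = i :> nat -> tagged c = j :> nat ->
  tag d = i' :> nat -> tagged d = j' :> nat -> (i + j = i' + j')%N -> (i < i')%N ->
  (T c < T d)%N.
Proof. by move=> <- <- <- <-; apply: sst_col. Qed.

(** On a diagonal, go up by way of the cell that is in the row of the lower cell and in the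
    column of the upper one. *)
Lemma sst_diag (c d : cell) : tagged c = tagged d :> nat -> (tag c < tag d)%N -> (T c < T d)%N.
Proof.
move=> e hlt.
have hd := cell_in d.
have [|x [x1 x2]] := @cell_ex (tag c) (tagged d + (tag d - tag c)).
  have := nth_decr2 (ltnW hlt); lia.
apply: (@ltn_trans (T x)); [apply: sst_row|apply: sst_col]; lia.
Qed.

(** The entry i + 1 lies strictly above the entry i exactly when its content is smaller:
    if i + 1 lay above i with a content at least as large, the cell in the row of i and the
    column of i + 1 would have an entry between them; if it lay weakly below with a smaller
    content, it would be smaller than i. So tableau and content word have the same descents. *)
Lemma sst_des (c d : cell) : T d = (T c).+1 :> nat ->
  (tag c < tag d)%N = (tagged d < tagged c)%N.
Proof.
move=> e; have hc := cell_in c; have hd := cell_in d.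
apply/idP/idP => h.
  rewrite ltnNge; apply/negP => h2.
  have [|x [x1 x2]] := @cell_ex (tag c) (tagged d + (tag d - tag c)).
    have := nth_decr2 (ltnW h); lia.
  have h3 : (T c < T x)%N by apply: sst_row; lia.
  have h4 : (T x < T d)%N by apply: sst_col; lia.
  by lia.
rewrite ltnNge leq_eqVlt; apply/negP => /orP[/eqP h2|h2].
  have h3 : (T d < T c)%N by apply: sst_row; lia.
  by lia.
have [|x [x1 x2]] := @cell_ex (tag d) (tagged c + (tag c - tag d)).
  have := nth_decr2 (ltnW h2); lia.
have h3 : (T d < T x)%N by apply: sst_row; lia.
have h4 : (T x < T c)%N by apply: sst_col; lia.
by lia.
Qed.

End Tableau.

Definition content_word (l : seq nat) (T : {ffun shcell l -> 'I_(sumn l)}) : seq nat :=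
  [seq (if [pick c | T c == t] is Some c then val (tagged c) else 0%N) | t <- enum 'I_(sumn l)].

Section TableauWord.
Variables (l : seq nat).
Hypothesis l_sorted : sorted gtn l.
Local Notation n := (sumn l).
Local Notation cell := (shcell l).

Lemma size_content_word T : size (@content_word l T) = n.
Proof. by rewrite size_map size_enum_ord. Qed.

Lemma nth_content_word (T : {ffun cell -> 'I_n}) c : T \in SShT l -> nth 0%N (content_word T) (T c) = tagged c.
Proof.
move=> hT; rewrite (nth_map (T c)) ?size_enum_ord // nth_ord_enum.
case: pickP => [d /eqP /(sst_inj hT) -> //|/(_ c)].
by rewrite eqxx.
Qed.

Lemma tab_des_content_word (T : {ffun cell -> 'I_n}) : T \in SShT l -> tab_des T = descents (des_bits (content_word T)).
Proof.
move=> hT; apply/fsetP => i; rewrite in_descents size_des_bits size_content_word /tab_des !inE.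
rewrite -[i \in mem_fin _]/(i \in iota 1 n.-1) mem_iota.
case: (posnP i) => [->//|i0] /=.
have -> : (i < 1 + n.-1)%N = (i < n)%N by case: (n) => [|k]; lia.
case hi: (i < n)%N => //=; rewrite nth_des_bits ?size_content_word // i0 /=.
have hi1 : (i.-1 < n)%N by lia.
have [c hc] := sst_surj hT (Ordinal hi1).
have [d hd] := sst_surj hT (Ordinal hi).
have ec : T c = i.-1 :> nat by rewrite hc.
have ed : T d = i :> nat by rewrite hd.
rewrite (_ : nth 0%N (content_word T) i = tagged d); last by rewrite -(nth_content_word _ hT) ed.
rewrite (_ : nth 0%N (content_word T) i.-1 = tagged c); last by rewrite -(nth_content_word _ hT) ec.
rewrite -(sst_des l_sorted hT); last by rewrite ec ed prednK.
apply/existsP/idP => [[c' /existsP[d' /and3P[/eqP h1 /eqP h2]]]|h].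
  have -> : c' = c by apply: (sst_inj hT); apply: val_inj; rewrite /= ec; lia.
  by have -> : d' = d by apply: (sst_inj hT); apply: val_inj; rewrite /= ed; lia.
by exists c; apply/existsP; exists d; rewrite ec ed prednK // !eqxx.
Qed.

Lemma count_content_word (T : {ffun cell -> 'I_n}) t j : T \in SShT l -> (t <= n)%N ->
  count_mem j (take t (content_word T)) = #|[set c : cell | (tagged c == j :> nat) && (T c < t)%N]|.
Proof.
move=> hT; elim: t => [|t IH] ht.
  by rewrite take0 /=; apply/esym/eqP; rewrite cards_eq0; apply/eqP/setP => c; rewrite !inE andbF.
rewrite (take_nth 0%N) ?size_content_word // -cats1 count_cat IH /= ?addn0; last lia.
have [c hc] := sst_surj hT (Ordinal ht).
have ec : T c = t :> nat by rewrite hc.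
rewrite -{2}ec nth_content_word //.
have -> : [set c : cell | (tagged c == j :> nat) && (T c < t.+1)%N] =
  if tagged c == j :> nat then c |: [set c : cell | (tagged c == j :> nat) && (T c < t)%N]
  else [set c : cell | (tagged c == j :> nat) && (T c < t)%N].
  apply/setP => d; have hd : (T d < t.+1)%N = (d == c) || (T d < t)%N.
    by rewrite ltnS leq_eqVlt -ec -(inj_eq (sst_inj hT)).
  case: (tagged c =P j :> nat) => hcj; rewrite !inE hd; case: (d =P c) => //= ->.
    by rewrite hcj eqxx.
  by case: eqP.
case: eqP => _; last by rewrite addn0.
by rewrite cardsU1 !inE ec ltnn andbF /= addnC.
Qed.

(** The cells of a diagonal are determined by their rows, so counting them is counting rows. *)
Lemma leq_card_tag (A B : {set cell}) (g : nat -> nat) :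
  (forall c, c \in A -> exists d, d \in B /\ tag d = g (tag c) :> nat) ->
  (forall c c', c \in A -> c' \in A -> g (tag c) = g (tag c') -> c = c') ->
  (#|A| <= #|B|)%N.
Proof.
move=> hg hi; pose f (c : cell) := odflt c [pick d in B | tag d == g (tag c) :> nat].
have hf c : c \in A -> f c \in B /\ tag (f c) = g (tag c) :> nat.
  move=> /hg[d [h1 h2]]; rewrite /f; case: pickP => [x /andP[hx /eqP]|/(_ d)] //.
  by rewrite h1 h2 eqxx.
rewrite -(card_in_imset (f := f)) => [|c c' hc hc' e].
  by apply/subset_leq_card/subsetP => _ /imsetP[c /hf[h _] ->].
by apply: hi => //; have [_ <-] := hf _ hc; have [_ <-] := hf _ hc'; rewrite e.
Qed.

(** The cells with entries at most t form a shifted diagram: with a cell it contains the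
    cell to its left, and, unless that would leave the diagram, the cell below. *)
Lemma content_word_valid (T : {ffun cell -> 'I_n}) : T \in SShT l -> content_word T \in level (word_children n) [::] n.
Proof.
move=> hT; apply/mem_word_level; split; first exact: size_content_word.
  move=> x /(nthP 0%N)[s]; rewrite size_content_word => hs <-.
  have [c hc] := sst_surj hT (Ordinal hs).
  rewrite -[s]/(val (Ordinal hs)) -hc nth_content_word //; apply: leq_trans (cell_in c) _.
  by case: (leqP (size l) (tag c)) => h; [rewrite nth_default|apply/mem_leq_sumn/mem_nth].
move=> t ht; apply/profile_okP => j _; rewrite /content !count_content_word //; apply/andP; split.
  apply: (@leq_card_tag _ _ id) => [c|c c'].
    rewrite inE => /andP[/eqP e h]; have [|d [d1 d2]] := @cell_ex l (tag c) j.
      by have := ltnW (cell_in c); rewrite e.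
    exists d; rewrite inE d2 eqxx d1; split=> //=; apply: ltn_trans h.
    by apply: (sst_row l_sorted hT); rewrite ?d2 ?e.
  by rewrite !inE => /andP[/eqP e _] /andP[/eqP e' _] /= h; apply: cell_inj; rewrite ?e ?e'.
set A := [set c | _]; set B := [set c | _ == j.+1 & _].
have hA : (#|A :&: [set c : cell | tag c == 0%N :> nat]| <= 1)%N.
  apply/card_le1_eqP => c d; rewrite !inE => /andP[/andP[/eqP e _] /eqP e0].
  by move=> /andP[/andP[/eqP e' _] /eqP e0']; apply: cell_inj; rewrite ?e ?e0 ?e0'.
rewrite -(cardsID [set c : cell | tag c == 0%N :> nat] A) -add1n leq_add //.
apply: (@leq_card_tag _ _ predn) => [c|c c'].
  rewrite !inE => /andP[c0 /andP[/eqP e h]].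
  have hc := cell_in c.
  have e1 : ((tag c).-1.+1 = tag c)%N by rewrite prednK // lt0n.
  have [|d [d1 d2]] := @cell_ex l (tag c).-1 j.+1.
    have h1 : (j < nth 0 l (tag c))%N by rewrite -e.
    have := @nth_decr _ l_sorted (tag c).-1; rewrite e1 => /(_ (leq_ltn_trans (leq0n _) h1)).
    exact: leq_ltn_trans h1.
  exists d; rewrite inE d2 eqxx d1; split=> //=; apply: ltn_trans h.
  by apply: (sst_colE l_sorted hT d1 d2 erefl e); rewrite -e1 ?addSn ?addnS.
rewrite !inE => /andP[c0 /andP[/eqP e h]] /andP[c0' /andP[/eqP e' h']] he.
apply: cell_inj; last by rewrite e e'.
by rewrite -(prednK (n := tag c)) ?lt0n // he prednK ?lt0n.
Qed.

Lemma card_col j m : (m <= profile l j)%N ->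
  #|[set c : cell | (tagged c == j :> nat) && (tag c < m)%N]| = m.
Proof.
elim: m => [|m IH] hm.
  by apply/eqP; rewrite cards_eq0; apply/eqP/setP => c; rewrite !inE andbF.
move: (hm); rewrite profileP // => /cell_ex[c [c1 c2]].
have -> : [set c : cell | (tagged c == j :> nat) && (tag c < m.+1)%N] =
   c |: [set c : cell | (tagged c == j :> nat) && (tag c < m)%N].
  apply/setP => d; rewrite !inE ltnS leq_eqVlt; case: (d =P c) => [->|dc] /=.
    by rewrite c2 c1 !eqxx.
  case: (tagged d =P j :> nat) => //= dj; case: (tag d =P m :> nat) => //= dm.
  by case: dc; apply: cell_inj; rewrite ?c1 ?c2.
rewrite cardsU1 IH ?inE; last exact: ltnW.
by rewrite c2 c1 ltnn andbF.
Qed.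

Lemma content_content_word (T : {ffun cell -> 'I_n}) j : T \in SShT l -> content (content_word T) j = profile l j.
Proof.
move=> hT; have := count_content_word j hT (leqnn n); rewrite take_oversize ?size_content_word // /content => ->.
rewrite -(card_col (leqnn (profile l j))); apply: eq_card => c; rewrite !inE ltn_ord andbT.
by case: eqP => //= <-; rewrite profileP // cell_in.
Qed.

(** Entries increase along a diagonal, so the row of a cell is the number of earlier letters
    with the same content. This recovers the tableau from its word. *)
Lemma content_word_rank (T : {ffun cell -> 'I_n}) (c : cell) : T \in SShT l ->
  count_mem (val (tagged c)) (take (T c) (content_word T)) = tag c.
Proof.
move=> hT; rewrite count_content_word //; last exact: ltnW.
have hc : (tag c <= profile l (tagged c))%N by apply: ltnW; rewrite profileP // cell_in.
rewrite -[RHS](card_col hc); apply: eq_card => d; rewrite !inE.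
case: eqP => //= e; case: (ltngtP (tag d) (tag c)) => h.
- exact: (sst_diag l_sorted hT e h).
- apply/negbTE; rewrite -leqNgt ltnW //; exact: (sst_diag l_sorted hT (esym e) h).
- by rewrite (cell_inj h e) ltnn.
Qed.

Lemma rank_inj w s t : (s < size w)%N -> (t < size w)%N -> nth 0%N w s = nth 0%N w t ->
  count_mem (nth 0%N w s) (take s w) = count_mem (nth 0%N w s) (take t w) -> s = t.
Proof.
move=> hs ht e; case: (ltngtP s t) => // h he.
  by have := count_take_lt h hs erefl; rewrite he ltnn.
by have := count_take_lt h ht erefl; rewrite -e he ltnn.
Qed.

Lemma content_word_inj : {in SShT l &, injective (@content_word l)}.
Proof.
move=> T T' hT hT' e; apply/ffunP => c; apply: val_inj => /=.
apply: (@rank_inj (content_word T)); rewrite ?size_content_word //; first by rewrite {2}e !nth_content_word.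
by rewrite nth_content_word // content_word_rank // e content_word_rank.
Qed.

Lemma profile_ok_desc N k j j' : profile_ok N k -> (forall i, (N <= i)%N -> k i = 0%N) -> (j <= j')%N ->
  (k j' <= k j <= k j' + (j' - j))%N.
Proof.
move=> /profile_okP hg h0 hj; have -> : j' = (j + (j' - j))%N by lia.
elim: (j' - j)%N => [|d IH]; first by rewrite addn0; lia.
rewrite addnS; have : (k (j + d).+1 <= k (j + d)%N <= (k (j + d).+1).+1)%N.
  by case: (ltnP (j + d) N) => h; [apply: hg|rewrite !h0 //; lia].
lia.
Qed.

Lemma rank_lt (j : nat) w s t : (s < size w)%N -> nth 0%N w s = j ->
  (s < t)%N = (count_mem j (take s w) < count_mem j (take t w))%N.
Proof.
move=> hs hj; apply/idP/idP => [h|]; first exact: count_take_lt.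
apply: contraTT; rewrite -!leqNgt => h.
by rewrite -(subnKC h) takeD count_cat leq_addr.
Qed.

Lemma content_word_surj w : w \in level (word_children n) [::] n ->
  (forall j, (j < n)%N -> content w j = profile l j) -> exists2 T, T \in SShT l & content_word T = w.
Proof.
move=> /mem_word_level[hs hx hg] hk.
have hocc (c : cell) : exists s : 'I_n, (nth 0%N w s == tagged c :> nat) &&
    (count_mem (val (tagged c)) (take s w) == tag c :> nat).
  have hc : (tag c < count_mem (val (tagged c)) w)%N.
    rewrite -/(content w (tagged c)) hk ?profileP ?cell_in //; apply: leq_trans (cell_in c) _.
    by case: (leqP (size l) (tag c)) => h; [rewrite nth_default|apply/mem_leq_sumn/mem_nth].
  have [s [h1 h2 h3]] := occurrence hc; rewrite hs in h1.
  by exists (Ordinal h1); rewrite /= h2 h3 !eqxx.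
(* A cell in row i and diagonal j gets the position of the letter j with exactly i letters j
   before it. *)
pose T := [ffun c : cell => xchoose (hocc c)].
have hT (c : cell) : nth 0%N w (T c) = tagged c :> nat /\ count_mem (val (tagged c)) (take (T c) w) = tag c :> nat.
  by rewrite ffunE; have /andP[/eqP h1 /eqP h2] := xchooseP (hocc c).
have h0 t i : (t <= n)%N -> (n <= i)%N -> content (take t w) i = 0%N.
  move=> _ hi; apply/count_memPn/negP => /mem_take /hx; lia.
have lt (c : cell) t : (T c < t)%N = (tag c < content (take t w) (tagged c))%N.
  have [h1 h2] := hT c; rewrite (rank_lt t _ h1) ?hs // /content.
  by rewrite -[nat_of_ord (tagged c)]/(val (tagged c)) h2.
have ne (c d : cell) : T c = T d -> c = d.
  move=> e; have [h1 h2] := hT c; have [h3 h4] := hT d.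
  have e2 : tagged c = tagged d :> nat by rewrite -h1 -h3 e.
  by apply: cell_inj; rewrite // -h2 -h4 e -[val (tagged c)]/(nat_of_ord _) e2.
have kapd (d : cell) : content (take (T d).+1 w) (tagged d) = (tag d).+1.
  have [h3 h4] := hT d; rewrite /content (take_nth 0%N) ?hs // h3 -cats1 count_cat h4 /= eqxx.
  by rewrite addn1.
have kd (c d : cell) : (tagged c <= tagged d)%N ->
   (content (take (T d).+1 w) (tagged d) <= content (take (T d).+1 w) (tagged c))%N.
  move=> hcd; have := @profile_ok_desc _ (content (take (T d).+1 w)) _ _ (hg _ (ltn_ord (T d))) _ hcd.
  by case/(_ _)/andP => // i; apply: h0; apply: ltn_ord.
have ku (c d : cell) : (tagged d <= tagged c)%N ->
   (content (take (T d).+1 w) (tagged d) <= content (take (T d).+1 w) (tagged c) + (tagged c - tagged d))%N.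
  move=> hcd; have := @profile_ok_desc _ (content (take (T d).+1 w)) _ _ (hg _ (ltn_ord (T d))) _ hcd.
  by case/(_ _)/andP => // i; apply: h0; apply: ltn_ord.
(* In a shifted diagram made of the first letters, the presence of the cell d forces
   the presence of its neighbours; this comes from the diagonal lengths of the prefix. *)
have lt2 (c d : cell) : c <> d -> (tag c < content (take (T d).+1 w) (tagged c))%N -> (T c < T d)%N.
  rewrite -lt ltnS leq_eqVlt => cd /orP[/eqP e|//].
  by case: cd; apply: ne; apply: val_inj.
have sT : T \in SShT l.
  rewrite inE; apply/and3P; split.
  - apply/forallP => v; apply/cards1P.
    have hv : (v < size w)%N by rewrite hs.
    have [|c [c1 c2]] := @cell_ex l (count_mem (nth 0%N w v) (take v w)) (nth 0%N w v).
      rewrite -profileP // -hk; last by apply/hx/mem_nth.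
      by have := count_take_lt hv hv erefl; rewrite take_size.
    exists c; apply/setP => d; rewrite !inE; apply/eqP/eqP => [e|->].
      have [h1 h2] := hT d; rewrite e in h1 h2; apply: cell_inj; rewrite ?c2 //.
      by rewrite c1 -h2 -[val (tagged d)]/(nat_of_ord _) -h1.
    apply: val_inj; have [h1 h2] := hT c; rewrite c2 in h1.
    apply: (@rank_inj w); rewrite ?hs ?ltn_ord // -[\val (T c)]/(nat_of_ord (T c)) h1 //.
    by rewrite -c1 -h2 -[val (tagged c)]/(nat_of_ord _) c2.
  - apply/forallP => c; apply/forallP => d; apply/implyP => /andP[/eqP e].
    rewrite /cell_row /cell_col in e * => h.
    have h' : (tagged c < tagged d)%N by rewrite -(ltn_add2l (tag d)) -{1}e.
    apply: lt2 => [cd|]; first by rewrite cd ltnn in h'.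
    by rewrite {1}e -ltnS -kapd ltnS; apply: kd; apply: ltnW.
  apply/forallP => c; apply/forallP => d; apply/implyP => /andP[/eqP].
  rewrite /cell_row /cell_col => e h.
  apply: lt2 => [cd|]; first by rewrite cd ltnn in h.
  have hdc : (tagged d <= tagged c)%N.
    by rewrite -(leq_add2l (tag c)) e leq_add2r ltnW.
  have := ku c d hdc; rewrite kapd => hh.
  rewrite -(ltn_add2r (tagged c - tagged d)); apply: leq_trans hh.
  have : (tag c + (tagged c - tagged d) = tag d)%N by rewrite addnBA // e addnK.
  by move=> ->.
exists T => //; apply: (@eq_from_nth _ 0%N); rewrite ?size_content_word ?hs // => s hsn.
have [c hc] := sst_surj sT (Ordinal hsn).
rewrite -[s]/(val (Ordinal hsn)) -hc nth_content_word //.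
by have [-> _] := hT c.
Qed.

(** By [content_word_inj], [content_word_valid] and [content_word_surj], the content word is a
    bijection onto the words of the tree that end in the shape l. *)
Lemma SShT_words (G : seq nat -> int) :
  \sum_(T in SShT l) G (content_word T) =
  \sum_(w <- level (word_children n) [::] n | all (fun j => content w j == profile l j) (iota 0 n)) G w.
Proof.
rewrite -big_enum -(big_map (@content_word l) predT) /= -[RHS]big_filter; apply: perm_big; apply: uniq_perm.
- rewrite map_inj_in_uniq ?enum_uniq // => T T'; rewrite !mem_enum; exact: content_word_inj.
- by rewrite filter_uniq ?word_level_uniq.
move=> w; rewrite mem_filter; apply/mapP/andP => [[T]|[/allP h1 h2]].
  rewrite mem_enum => hT ->; split; last exact: content_word_valid.
  by apply/allP => j _; rewrite content_content_word.
have [j hj|T hT <-] := content_word_surj h2; last by exists T; rewrite ?mem_enum.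
by apply/eqP/h1; rewrite mem_iota.
Qed.

End TableauWord.

(** By [schurQ_coef] these numbers are the coefficients of the Schur Q-function, up to a
    power of 2. *)
Definition tab_count (l a : seq nat) : int :=
  \sum_(w <- level (word_children (sumn l)) [::] (sumn l)
    | all (fun j => content w j == profile l j) (iota 0 (sumn l))) (valleys a (des_bits w))%:R.

Lemma schurQ_coef l m : sorted gtn l -> schurQ l m =
  if sumn (expword m) == sumn l then
    2 ^+ (size (expword m)).-1.+1 * tab_count l (expword m) else 0.
Proof.
move=> hl; rewrite /schurQ.
under eq_bigr => T hT do rewrite (tab_des_content_word hl hT) peakK_word ?size_des_bits ?size_content_word //.
case: eqP => [en|_]; last by rewrite big1.
rewrite (SShT_words hl (fun w => 2 ^+ (size (expword m)).-1.+1 * (valleys (expword m) (des_bits w))%:R)).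
by rewrite /tab_count mulr_sumr.
Qed.

Lemma card_SShT l : sorted gtn l -> (#|SShT l|)%:Z =
  \sum_(w <- level (word_children (sumn l)) [::] (sumn l)
    | all (fun j => content w j == profile l j) (iota 0 (sumn l))) 1.
Proof.
move=> hl; rewrite -(SShT_words hl (fun=> 1)) sumr_const.
by rewrite -natz.
Qed.

(** * Tableaux of at most two rows *)

Definition inc (k : nat -> nat) (c : nat) : nat -> nat := fun j => (k j + (j == c))%N.

(** A state is the sequence of diagonal lengths together with the last letter, which decides
    whether the next step is a descent. *)
Definition tab_step (N : nat) (d : bool) (s : (nat -> nat) * nat) : seq ((nat -> nat) * nat) :=
  [seq (inc s.1 c, c) | c <- iota 0 N & profile_ok N (inc s.1 c) && ((c < s.2)%N == d)].

Lemma content_rcons w c : content (rcons w c) = inc (content w) c.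
Proof.
apply: functional_extensionality => j.
by rewrite /content -cats1 count_cat /= addn0 /inc eq_sym.
Qed.

Lemma des_bits_rcons w c : des_bits (rcons w c) = rcons (des_bits w) (c < last 0 w)%N.
Proof.
apply: (@eq_from_nth _ false) => [|i]; first by rewrite size_rcons !size_des_bits size_rcons.
rewrite size_des_bits size_rcons => hi; rewrite nth_des_bits ?size_rcons // !nth_rcons size_des_bits.
move: hi; rewrite ltnS leq_eqVlt => /orP[/eqP->|hi].
  rewrite ltnn eqxx; case: (lastP w) => [|v x] //; rewrite last_rcons size_rcons /=.
  by rewrite ltnS leqnn nth_rcons ltnn eqxx.
by rewrite hi nth_des_bits //; case: i hi => //= i hi; rewrite (ltnW hi).
Qed.

Lemma tree_tab N a (F : (nat -> nat) * nat -> int) : all (leq 1) a ->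
  \sum_(w <- level (word_children N) [::] (sumn a)) (valleys a (des_bits w))%:R * F (content w, last 0%N w) =
  op_blocks (tab_step N) a F (fun=> 0%N, 0%N).
Proof.
move=> ha; rewrite (@tree_valleys _ (tab_step N) _ (word_children N) [::] des_bits (fun w => (content w, last 0%N w))) //.
  by move=> w w' /mapP[c _ ->]; eexists; apply: des_bits_rcons.
move=> n w G d _; rewrite /op big_map big_map !big_filter_cond.
apply: eq_big => [c|c _]; last by rewrite last_rcons content_rcons.
by rewrite des_bits_rcons eqseq_rcons eqxx /= content_rcons eq_sym [RHS]andbT; congr andb; rewrite eq_sym.
Qed.

(** For a shape with rows p > q >= 0 the argument x is p - q - 1. Adding a cell to the first
    row increases it and adding a cell to the second row decreases it; the latter needs
    p - q > 1. [gap_valley], [gap_blocks] and [gap_count] are the analogues of [op_valley],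
    [op_blocks] and of a whole walk; the walk starts with one cell, that is, with x = 0. *)
Definition gap_up (h : nat -> int) : nat -> int := fun x => h x.+1.
Definition gap_down (h : nat -> int) : nat -> int := fun x => if x is x'.+1 then h x' else 0.
Definition gap_move (h : nat -> int) : nat -> int := fun x => gap_up h x + gap_down h x.
Fixpoint gap_valley b h : nat -> int :=
  if b is b'.+1 then fun x => iter b gap_up h x + gap_down (gap_valley b' h) x else h.
Definition gap_blocks (a : seq nat) h : nat -> int := foldr (fun x g => gap_move (gap_valley x.-1 g)) h a.
Definition gap_count (a : seq nat) h : int :=
  if a is x :: a' then gap_valley x.-1 (gap_blocks a' h) 0%N else h 0%N.

Definition two_row_profile p q : nat -> nat := fun j => ((j < p) + (j < q))%N.

(** F is the function on states that has the values h1 or h2 on two-row shapes of size t,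
    according to the row of the last cell, and vanishes on shapes with a third row. The last
    letters p - 1 and q - 1 are the contents of the ends of the rows. *)
Definition two_row_fun (t : nat) (F : (nat -> nat) * nat -> int) (h1 h2 : nat -> int) : Prop :=
  [/\ forall p q, (p + q)%N = t -> (q < p)%N -> F (two_row_profile p q, p.-1) = h1 (p - q).-1,
      forall p q, (p + q)%N = t -> (q < p)%N -> (0 < q)%N -> F (two_row_profile p q, q.-1) = h2 (p - q).-1
    & forall k x, (3 <= k 0)%N -> F (k, x) = 0].

Lemma inc_two_row_l p q : inc (two_row_profile p q) p = two_row_profile p.+1 q.
Proof. by apply: functional_extensionality => j; rewrite /inc /two_row_profile; lia. Qed.

Lemma inc_two_row_r p q : inc (two_row_profile p q) q = two_row_profile p q.+1.
Proof. by apply: functional_extensionality => j; rewrite /inc /two_row_profile; lia. Qed.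

Lemma profile_ok_two_row N p q : (q < p)%N || ((p == 0%N) && (q == 0%N)) -> profile_ok N (two_row_profile p q).
Proof. by move=> h; apply/profile_okP => j _; rewrite /two_row_profile; lia. Qed.

(** After a cell in the first row, a cell in the second row is a descent and a cell in the
    first row is an ascent; after a cell in the second row, both are ascents. *)
Lemma op_two_row N p q x d (F : (nat -> nat) * nat -> int) h1 h2 :
  (p + q < N)%N -> (q < p)%N -> two_row_fun (p + q).+1 F h1 h2 ->
  op (tab_step N) d F (two_row_profile p q, x) =
  (if (p < x)%N == d then h1 (p - q)%N else 0) +
  (if ((q < x)%N == d) && (q.+1 < p)%N then h2 (p - q).-2 else 0).
Proof.
move=> hN hq [f1 f2 f0]; rewrite /op big_map big_filter big_mkcond /=.
rewrite (bigD1_seq p) ?iota_uniq ?mem_iota /=; last by lia.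
rewrite inc_two_row_l profile_ok_two_row ?f1 /=; [|lia|lia|lia].
congr (_ + _); first by congr (if _ then h1 _ else _); lia.
rewrite -big_filter (bigD1_seq q) ?filter_uniq ?iota_uniq ?mem_filter ?mem_iota /=; try lia.
rewrite big_seq_cond big1 ?addr0; last first.
  move=> c; rewrite mem_filter mem_iota => /andP[/andP[cp cN] cq].
  case: ifP => // /andP[/profile_okP hg _]; case: (c =P 0%N) => c0.
    by apply: f0; rewrite /inc /two_row_profile c0; lia.
  have := hg c.-1; rewrite /inc /two_row_profile.
  have -> : (c.-1.+1 = c) by lia.
  rewrite eqxx; have -> : (c.-1 == c) = false by lia.
  by move=> h; exfalso; have := h _; lia.
rewrite inc_two_row_r; case: (ltnP q.+1 p) => h.
  rewrite andbT profile_ok_two_row ?h //=; congr (if _ then _ else _).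
  by have := f2 p q.+1; rewrite /= => ->; rewrite ?subnS ?addnS.
rewrite andbF ifF //; apply/negP => /andP[/profile_okP hg _].
by have := hg q; rewrite /two_row_profile; lia.
by lia.
Qed.

Lemma op_three_row N t d F h1 h2 k x : two_row_fun t F h1 h2 -> (3 <= k 0)%N ->
  op (tab_step N) d F (k, x) = 0.
Proof.
move=> [_ _ f0] hk; rewrite /op big_map big1 // => c _; apply: f0.
by rewrite /inc /=; apply: leq_trans hk _; apply: leq_addr.
Qed.

(** After a cell in the second row every step is an ascent, and after one in the first row
    only the steps in the first row are. *)
Lemma two_row_asc N t F h1 h2 : (t < N)%N -> two_row_fun t.+1 F h1 h2 ->
  two_row_fun t (op (tab_step N) false F) (gap_up h1) (fun x => gap_up h1 x + gap_down h2 x).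
Proof.
move=> ht hF; split=> [p q e hq|p q e hq q0|k x hk]; last exact: op_three_row hF hk.
  subst t; rewrite (@op_two_row _ _ _ _ _ _ h1 h2) //.
  have -> : (p < p.-1)%N = false by lia.
  have -> : ((q < p.-1)%N == false) && (q.+1 < p)%N = false by lia.
  by rewrite addr0 /= /gap_up; congr h1; lia.
subst t; rewrite (@op_two_row _ _ _ _ _ _ h1 h2) //.
have -> : (p < q.-1)%N = false by lia.
have -> : (q < q.-1)%N = false by lia.
rewrite /= /gap_up; congr (_ + _); first by congr h1; lia.
rewrite /gap_down; move em: (p - q)%N => e'; case: e' em => [|[|m]] /= em; try lia.
  by have -> : (q.+1 < p)%N = false by lia.
by have -> : (q.+1 < p)%N = true by lia.
Qed.

Lemma two_row_desc N t F h1 h2 : (t < N)%N -> two_row_fun t.+1 F h1 h2 ->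
  two_row_fun t (op (tab_step N) true F) (gap_down h2) (fun=> 0).
Proof.
move=> ht hF; split=> [p q e hq|p q e hq q0|k x hk]; last exact: op_three_row hF hk.
  subst t; rewrite (@op_two_row _ _ _ _ _ _ h1 h2) //.
  have -> : (p < p.-1)%N = false by lia.
  rewrite add0r /gap_down; move em: (p - q)%N => e'; case: e' em => [|[|m]] /= em; try lia.
    by rewrite (_ : (q.+1 < p)%N = false) ?andbF //; lia.
  rewrite (_ : (q.+1 < p)%N = true) ?andbT; last lia.
  by rewrite (_ : (q < p.-1)%N = true) //; lia.
subst t; rewrite (@op_two_row _ _ _ _ _ _ h1 h2) //.
have -> : (p < q.-1)%N = false by lia.
by have -> : (q < q.-1)%N = false by lia.
Qed.

Lemma two_row_add t F h1 h2 F' h1' h2' : two_row_fun t F h1 h2 -> two_row_fun t F' h1' h2' ->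
  two_row_fun t (fun s => F s + F' s) (fun x => h1 x + h1' x) (fun x => h2 x + h2' x).
Proof.
move=> [f1 f2 f0] [f1' f2' f0']; split=> [p q e hq|p q e hq q0|k x hk].
- by rewrite f1 ?f1'.
- by rewrite f2 ?f2'.
- by rewrite f0 ?f0' ?addr0.
Qed.

Lemma two_row_iter N t b F h : (t + b <= N)%N -> two_row_fun (t + b) F h h ->
  two_row_fun t (iter b (op (tab_step N) false) F) (iter b gap_up h) (gap_valley b h).
Proof.
elim: b t => [|b IH] t; first by rewrite addn0.
rewrite addnS -addSn => hN hF; apply: (two_row_asc _ (IH _ _ hF)); lia.
Qed.

(** The pair of values (h1, h2) stays diagonal at the end of a block, although the steps
    inside of the block distinguish the row of the last cell. *)
Lemma two_row_S N t b F h : (t + b <= N)%N -> two_row_fun (t + b) F h h ->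
  two_row_fun t (op_valley (tab_step N) b F) (gap_valley b h) (gap_valley b h).
Proof.
elim: b t => [|b IH] t; first by rewrite addn0.
move=> hN hF; have h1 := two_row_iter hN hF.
rewrite addnS -addSn in hN hF; have h2 := two_row_desc (N := N) _ (IH _ hN hF).
have := two_row_add h1 (h2 _); rewrite /=; move=> /(_ _) h3.
have : (t < N)%N by lia.
move=> /h3; congr two_row_fun.
by apply: functional_extensionality => x; rewrite addr0.
Qed.

Lemma two_row_T N t F h : (t < N)%N -> two_row_fun t.+1 F h h ->
  two_row_fun t (op_any (tab_step N) F) (gap_move h) (gap_move h).
Proof.
move=> ht hF; have := two_row_add (two_row_desc ht hF) (two_row_asc ht hF).
congr two_row_fun; apply: functional_extensionality => x; rewrite ?add0r //.
by rewrite addrC.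
Qed.

Lemma two_row_B N t a F h : all (leq 1) a -> (t + sumn a <= N)%N ->
  two_row_fun (t + sumn a) F h h ->
  two_row_fun t (op_blocks (tab_step N) a F) (gap_blocks a h) (gap_blocks a h).
Proof.
elim: a t => [|x a IH] t /=; first by rewrite addn0.
move=> /andP[hx ha] hN hF; apply: two_row_T; first lia.
apply: two_row_S; first lia.
apply: IH => //; first by lia.
have -> // : (t.+1 + x.-1 + sumn a = t + (x + sumn a))%N by lia.
Qed.

(** The first cell is forced, and the first step of the first block is spent on it. *)
Lemma two_row_walk N a F h : a != [::] -> all (leq 1) a -> (sumn a <= N)%N ->
  two_row_fun (sumn a) F h h ->
  op_blocks (tab_step N) a F (fun=> 0%N, 0%N) = gap_count a h.
Proof.
case: a => // x a _ /= /andP[hx ha] hN hF.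
have [f1 _ _] : two_row_fun 1 (op_valley (tab_step N) x.-1 (op_blocks (tab_step N) a F))
    (gap_valley x.-1 (gap_blocks a h)) (gap_valley x.-1 (gap_blocks a h)).
  apply: two_row_S; first lia.
  apply: two_row_B => //; first lia.
  by have -> // : (1 + x.-1 + sumn a = x + sumn a)%N by lia.
have := f1 1%N 0%N erefl isT; rewrite /= => <-.
have k0 c : (c < N)%N -> profile_ok N (inc (fun=> 0%N) c) = (c == 0%N).
  move=> cN; apply/profile_okP/eqP => [hg|-> j _]; last by rewrite /inc; lia.
  have := hg c.-1; rewrite /inc; case: (c) cN => [|c'] //= cN; rewrite eqxx.
  have -> : (c' == c'.+1) = false by lia.
  by move=> h'; have := h' (ltnW cN).
have e (G : (nat -> nat) * nat -> int) d : (0 < N)%N -> op (tab_step N) d G (fun=> 0%N, 0%N) = if d then 0 else G (two_row_profile 1 0, 0%N).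
  move=> N0; rewrite /op big_map big_filter big_mkcond /=.
  case: N N0 k0 {hN f1 hF} => // N _ k0.
  rewrite big_cons k0 // big_seq big1 ?addr0 /=; last first.
    by move=> c; rewrite mem_iota => hc; rewrite k0 //; case: c hc.
  case: d => //; congr (G (_, _)); apply: functional_extensionality => j.
  by rewrite /inc /two_row_profile; lia.
rewrite /op_any !e ?add0r //; lia.
Qed.
Lemma gap_move_sub f g : gap_move (fun x => f x - g x) = fun x => gap_move f x - gap_move g x.
Proof.
apply: functional_extensionality => x; rewrite /gap_move /gap_up /gap_down.
by case: x => [|x]; rewrite ?subr0 ?addr0 // opprD addrACA.
Qed.

(** Raising the gap and then lowering it is the identity, which makes the valley operators
    Chebyshev polynomials in [gap_move]. *)
Lemma gap_valley_rec b h : gap_valley b.+2 h = fun x => gap_move (gap_valley b.+1 h) x - gap_valley b h x.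
Proof.
apply: functional_extensionality => x.
have hA : gap_up (gap_valley b.+1 h) x = iter b.+2 gap_up h x + gap_valley b h x by [].
have hJ : gap_move (gap_valley b.+1 h) x = gap_up (gap_valley b.+1 h) x + gap_down (gap_valley b.+1 h) x by [].
have hS : gap_valley b.+2 h x = iter b.+2 gap_up h x + gap_down (gap_valley b.+1 h) x by [].
by rewrite hJ hA hS addrAC addrK.
Qed.

Lemma gap_valley1 h : gap_valley 1 h = gap_move h. Proof. by []. Qed.

Section CommuteMove.
Variable Y : (nat -> int) -> nat -> int.
Hypothesis Y_sub : forall f g, Y (fun x => f x - g x) = fun x => Y f x - Y g x.
Hypothesis Y_J : forall f, Y (gap_move f) = gap_move (Y f).
(** A linear operator that commutes with [gap_move] commutes with the polynomials in it. *)
Lemma gap_valley_comm b f : Y (gap_valley b f) = gap_valley b (Y f).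
Proof.
suff [] : Y (gap_valley b f) = gap_valley b (Y f) /\ Y (gap_valley b.+1 f) = gap_valley b.+1 (Y f) by [].
elim: b => [|b [h1 h2]]; first by split=> //; rewrite !gap_valley1 Y_J.
by split=> //; rewrite !gap_valley_rec Y_sub Y_J h1 h2.
Qed.
End CommuteMove.

Lemma gap_valley_move b f : gap_valley b (gap_move f) = gap_move (gap_valley b f).
Proof. by rewrite -(gap_valley_comm gap_move_sub). Qed.

Lemma gap_valley_sub b f g : gap_valley b (fun x => f x - g x) = fun x => gap_valley b f x - gap_valley b g x.
Proof.
suff [] : gap_valley b (fun x => f x - g x) = (fun x => gap_valley b f x - gap_valley b g x) /\
  gap_valley b.+1 (fun x => f x - g x) = (fun x => gap_valley b.+1 f x - gap_valley b.+1 g x) by [].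
elim: b => [|b [h1 h2]]; first by split=> //; rewrite !gap_valley1 gap_move_sub.
split=> //; rewrite !gap_valley_rec h1 h2 gap_move_sub; apply: functional_extensionality => x.
by rewrite !opprD !opprK addrACA.
Qed.

Lemma gap_valleyC b c f : gap_valley b (gap_valley c f) = gap_valley c (gap_valley b f).
Proof. exact: (gap_valley_comm (gap_valley_sub b) (gap_valley_move b)). Qed.

Lemma gap_blocks_move a h : gap_blocks a (gap_move h) = gap_move (gap_blocks a h).
Proof. by elim: a => //= x a ->; rewrite gap_valley_move. Qed.

(** The blocks are polynomials in [gap_move], hence commute. This is the source of symmetry
    for all expansions into two-row shapes. *)
Lemma gap_blocks_perm a a' h : perm_eq a a' -> gap_blocks a h = gap_blocks a' h.
Proof.
have hcat u v : gap_blocks (u ++ v) h = gap_blocks u (gap_blocks v h) by rewrite /gap_blocks foldr_cat.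
have hc x u g : gap_blocks u (gap_blocks [:: x] g) = gap_blocks [:: x] (gap_blocks u g).
  elim: u => //= y u IH; rewrite /gap_blocks /= in IH *; rewrite IH !gap_valley_move.
  by rewrite gap_valleyC.
have hcc u v g : gap_blocks u (gap_blocks v g) = gap_blocks v (gap_blocks u g).
  elim: v => //= y v IH; rewrite -[gap_move _]/(gap_blocks [:: y] (gap_blocks v g)) hc IH //.
move=> hp; apply: (@catCA_perm_ind _ (fun b => gap_blocks a h = gap_blocks b h) _ a a' hp erefl) => u v w ->.
by rewrite !hcat [gap_blocks u (gap_blocks v _)]hcc.
Qed.

(** A weight in the image of [gap_move] supplies the factor that the first block lacks. *)
Lemma gap_count_move a h : a != [::] -> gap_count a (gap_move h) = gap_blocks a h 0%N.
Proof. by case: a => //= x a _; rewrite gap_blocks_move gap_valley_move. Qed.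

Lemma gap_valley_id c b : gap_valley b (fun x => c * x.+1%:R) = fun x => b.+1%:R * (c * x.+1%:R).
Proof.
have hJ : gap_move (fun x : nat => c * x.+1%:R) = fun x => 2 * (c * x.+1%:R).
  apply: functional_extensionality => -[|x]; rewrite /gap_move /gap_up /gap_down; lia.
suff [] : gap_valley b (fun x => c * x.+1%:R) = (fun x => b.+1%:R * (c * x.+1%:R)) /\
  gap_valley b.+1 (fun x => c * x.+1%:R) = (fun x => b.+2%:R * (c * x.+1%:R)) by [].
elim: b c hJ => [|b IH] c hJ.
  by split; [apply: functional_extensionality => x; rewrite mul1r|rewrite gap_valley1 hJ].
have [h1 h2] := IH c hJ; split=> //; rewrite gap_valley_rec h1 h2.
apply: functional_extensionality => -[|x]; rewrite /gap_move /gap_up /gap_down; nia.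
Qed.

(** p - q is an eigenvector of [gap_move] with eigenvalue 2. *)
Lemma gap_count_id a : all (leq 1) a -> a != [::] ->
  gap_count a (fun x => x.+1%:R) = 2 ^+ (size a).-1 * (\prod_(x <- a) x)%:R.
Proof.
have hP b : all (leq 1) b -> gap_blocks b (fun x => x.+1%:R) = fun x => (2 ^+ (size b) * (\prod_(x <- b) x)%:R) * x.+1%:R.
  elim: b => [|y b IH] /=; first by move=> _; apply: functional_extensionality => x; rewrite big_nil !mul1r.
  move=> /andP[hy /IH ->]; rewrite gap_valley_id big_cons prednK //.
  apply: functional_extensionality => -[|x]; rewrite /gap_move /gap_up /gap_down exprS natrM; lia.
case: a => //= x a /andP[hx ha] _; rewrite hP // gap_valley_id big_cons prednK //.
by rewrite natrM mulr1 mulrCA.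
Qed.

Lemma profile_two_row n k j : (k <= n)%N -> profile (two_row n k) j = two_row_profile (n - k) k j.
Proof.
rewrite /two_row /two_row_profile /profile; case: (k =P 0%N) => [->|k0] hk /=; rewrite ?subn0 ?addn0 ?ltn0 //.
Qed.

Lemma sumn_two_row n k : (k <= n)%N -> sumn (two_row n k) = n.
Proof. by rewrite /two_row; case: eqP => /= [->|_]; lia. Qed.

(** The shape (n - k, k) has the gap n - 2k, so a linear combination of the counts of these
    shapes is one walk that ends with the weight c; the shapes with p = q do not occur. *)
Lemma sum_two_row a (c h : nat -> int) : all (leq 1) a -> a != [::] ->
  (forall k, (2 * k < sumn a)%N -> c k = h (sumn a - 2 * k).-1) ->
  \sum_(0 <= k < (sumn a %/ 2).+1) c k * tab_count (two_row (sumn a) k) a = gap_count a h.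
Proof.
move=> ha an hc; set n := sumn a.
have n0 : (0 < n)%N by rewrite /n; case: a ha an {hc n} => //= x a; lia.
pose e k (f : nat -> nat) := all (fun j => f j == profile (two_row n k) j) (iota 0 n).
pose F (s : (nat -> nat) * nat) : int := \sum_(0 <= k < (n %/ 2).+1 | e k s.1) c k.
have he p q k : (p + q)%N = n -> (q < p)%N -> (k < (n %/ 2).+1)%N -> e k (two_row_profile p q) = (k == q).
  move=> hpq hq hk; apply/allP/eqP => [h'|-> j _]; last first.
    rewrite profile_two_row; last lia.
    by have -> : (n - q)%N = p by lia.
  have hj j : (j < n)%N -> two_row_profile p q j = two_row_profile (n - k) k j.
    by move=> hj; rewrite -profile_two_row; [apply/eqP/h'; rewrite mem_iota|lia].
  by case: (ltngtP k q) => // hkq; [have := hj k|have := hj q]; rewrite /two_row_profile; lia.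
have hF p q x : (p + q)%N = n -> (q < p)%N -> F (two_row_profile p q, x) = h (p - q).-1%N.
  move=> hpq hq; rewrite /F /= big_nat_cond (eq_bigl (fun k => k == q)); last first.
    move=> k; case hk: (k < (n %/ 2).+1)%N => /=; first by rewrite he.
    by apply/esym/negbTE; lia.
  rewrite -big_filter filter_pred1_uniq ?iota_uniq ?mem_index_iota ?big_seq1; try lia.
  by rewrite hc; [congr h; lia|lia].
rewrite -(@two_row_walk n a F h an ha (leqnn _)); last first.
  split=> [p q hpq hq|p q hpq hq q0|k x hk]; [exact: hF|exact: hF|].
  rewrite /F /= big_nat_cond big1 // => j /andP[/andP[_ hj] /allP /(_ 0%N)].
  rewrite mem_iota n0 profile_two_row; last lia.
  by move=> /(_ isT) /eqP; rewrite /two_row_profile; lia.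
rewrite -tree_tab // -/n /F.
under [RHS]eq_bigr => w _ do rewrite mulr_sumr big_mkcond /=.
rewrite [RHS]exchange_big /=; apply: eq_big_nat => k hk.
rewrite /tab_count sumn_two_row; last lia.
rewrite mulr_sumr [LHS]big_mkcond; apply: eq_bigr => w _ /=.
by rewrite -/(e k (content w)) mulrC.
Qed.

(** * Generating trees of pattern classes *)

Lemma completesE t s v : completes t s v =
  pairs (fun x y => [&& (x < y)%N == (nth 0 t 0 < nth 0 t 1)%N,
      (x < v)%N == (nth 0 t 0 < nth 0 t 2)%N &
      (y < v)%N == (nth 0 t 1 < nth 0 t 2)%N]) s.
Proof.
have hb x : (bump v x < v)%N = (x < v)%N by rewrite /bump; lia.
rewrite /completes /pairs; apply: eq_has => j; apply: eq_has => i.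
by rewrite /same_order bump_lt !hb.
Qed.

(** The entries that may be appended to s are described by a state of s. The simulation is only
    required for nonempty words, since the empty word has no last entry; it gets a state
    of its own, None, from which the single step counts as an ascent. *)
Section ClassAutomaton.
Variables (P : seq (seq nat)) (St : Type) (step : bool -> St -> seq St) (st : seq nat -> St).
Hypothesis sim : forall n s (F : St -> int) d, s \in level (perm_children P) [::] n.+1 ->
  \sum_(v <- iota 0 n.+2 | safe P s v && ((v <= last 0 s)%N == d)) F (st (append s v)) =
  op step d F (st s).

Let stepO (d : bool) (x : option St) : seq (option St) :=
  if x is Some y then map Some (step d y) else if d then [::] else [:: Some (st [:: 0%N])].
Let stO s := if s is [::] then None else Some (st s).

Lemma class_perm_count x a : all (leq 1) (x :: a) ->
  perm_count P (x :: a) = op_valley step x.-1 (op_blocks step a (fun=> 1)) (st [:: 0%N]).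
Proof.
move=> hxa; rewrite /perm_count.
have opO d (F : option St -> int) y : op stepO d F (Some y) = op step d (fun z => F (Some z)) y.
  by rewrite /op big_map.
have ext (F G : option St -> int) : (forall y, F (Some y) = G (Some y)) ->
    (fun z => F (Some z)) = fun z => G (Some z).
  by move=> e; apply: functional_extensionality.
have iterO b (F : option St -> int) y :
    iter b (op stepO false) F (Some y) = iter b (op step false) (fun z => F (Some z)) y.
  elim: b y => //= b IH y; rewrite opO; congr op.
  by apply: functional_extensionality => z; rewrite IH.
have SO b (F : option St -> int) y : op_valley stepO b F (Some y) = op_valley step b (fun z => F (Some z)) y.
  elim: b y => [|b IH] y //; rewrite -[LHS]/(iter b.+1 (op stepO false) F (Some y) + op stepO true (op_valley stepO b F) (Some y)).
  rewrite iterO opO -[RHS]/(iter b.+1 (op step false) (fun z => F (Some z)) y + op step true (op_valley step b (fun z => F (Some z))) y).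
  congr (_ + op step true _ y).
  by apply: functional_extensionality => z; rewrite IH.
have TO (F : option St -> int) y : op_any stepO F (Some y) = op_any step (fun z => F (Some z)) y.
  by rewrite /op_any !opO.
have BO b (F : option St -> int) y : op_blocks stepO b F (Some y) = op_blocks step b (fun z => F (Some z)) y.
  elim: b y => [|z b IH] y //=; rewrite TO; congr op_any.
  apply: functional_extensionality => w; rewrite SO; congr op_valley.
  by apply: functional_extensionality.
transitivity (op_blocks stepO (x :: a) (fun=> 1) None).
  rewrite -[None]/(stO [::]).
  rewrite -(@tree_valleys _ stepO _ (perm_children P) [::] des_bits stO) //.
  - by apply: eq_bigr => s _; rewrite mulr1.
  - by move=> s s'; apply: des_bits_ch.
  move=> n s F d hs; case: n hs => [|n] hs.
    move: hs; rewrite inE => /eqP->; rewrite /perm_children /=.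
    have -> /= : safe P [::] 0 = true by apply/allP.
    rewrite big_mkcond big_seq1 des_bits_append /= /op; case: d => /=; first by rewrite big_nil.
    by rewrite big_seq1.
  have hsz : size s = n.+1 by move: hs; rewrite mem_level => /andP[/and3P[/eqP ->]].
  have sn : s != [::] by case: (s) hsz.
  have -> : stO s = Some (st s) by case: (s) sn.
  rewrite opO -(sim (fun z => F (Some z)) d hs) /perm_children big_map big_filter_cond hsz.
  apply: eq_big => [v|v _]; last by have := size_append s v; case: (append s v).
  by rewrite des_bits_append eqseq_rcons eqxx sn.
rewrite [LHS]/= /op_any /op big_nil add0r big_seq1 SO; congr op_valley.
by apply: functional_extensionality => y; rewrite BO.
Qed.
End ClassAutomaton.
Definition all6 : seq (seq nat) := [:: w123; w132; w213; w231; w312; w321].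

(** Whether s has a (not necessarily consecutive) ascending or descending pair. *)
Definition hasA (s : seq nat) : bool := pairs (fun x y => x < y)%N s.
Definition hasD (s : seq nat) : bool := pairs (fun x y => ~~ (x < y)%N) s.

Lemma eq_pairs e e' s : (forall x y, e x y = e' x y) -> pairs e s = pairs e' s.
Proof. by move=> h; apply: eq_has => j; apply: eq_has => i; apply: h. Qed.

Lemma eq_pairs_in e e' (s : seq nat) : {in s &, forall x y, e x y = e' x y} -> pairs e s = pairs e' s.
Proof.
move=> h; apply: eq_in_has => j; rewrite mem_iota add0n /= => hj; apply: eq_in_has => i.
by rewrite mem_iota add0n /= => hi; apply: h; apply: mem_nth => //; apply: ltn_trans hj.
Qed.

Lemma pairs_false e s : (forall x y, e x y = false) -> pairs e s = false.
Proof. by move=> h; apply/negbTE/hasPn => j _; apply/hasPn => i _; rewrite h. Qed.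

Lemma pairs_append e s v : pairs e (append s v) =
  pairs (fun x y => e (bump v x) (bump v y)) s || has (fun x => e (bump v x) v) s.
Proof.
rewrite {1}/pairs size_append -addn1 iotaD has_cat /= orbF add0n; congr orb.
  apply: eq_in_has => j; rewrite mem_iota => hj; apply: eq_in_has => i.
  by rewrite mem_iota => hi; rewrite !nth_append //; lia.
rewrite nth_append_last; apply/hasP/hasP => [[i]|[x hx hv]].
  rewrite mem_iota add0n /= => hi; rewrite nth_append // => h.
  by exists (nth 0%N s i) => //; apply: mem_nth.
by exists (index x s); rewrite ?mem_iota ?index_mem // nth_append ?index_mem // nth_index.
Qed.

Lemma hasA_append s v : hasA (append s v) = hasA s || has (fun x => x < v)%N s.
Proof.
rewrite /hasA pairs_append; congr orb; first by apply: eq_pairs => x y; rewrite bump_lt.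
by apply: eq_has => x; rewrite /bump; lia.
Qed.

Lemma hasD_append s v : hasD (append s v) = hasD s || has (fun x => v <= x)%N s.
Proof.
rewrite /hasD pairs_append; congr orb; first by apply: eq_pairs => x y; rewrite bump_lt.
by apply: eq_has => x; rewrite /bump; lia.
Qed.

Lemma isperm_mem n s x : isperm n s -> (x \in s) = (x < n)%N.
Proof.
case/and3P => /eqP hs hu /allP ha.
have [|| _ e] := @uniq_min_size _ s (iota 0 n) hu.
- by move=> y /ha; rewrite mem_iota.
- by rewrite size_iota hs.
by rewrite e mem_iota.
Qed.

Lemma isperm_last n s : isperm n.+1 s -> (last 0 s < n.+1)%N.
Proof.
move=> hp; rewrite -(isperm_mem _ hp); case/and3P: hp => /eqP.
by case/lastP: s => // s x _ _ _; rewrite last_rcons mem_rcons inE eqxx.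
Qed.

Lemma level_isperm P n s : s \in level (perm_children P) [::] n -> isperm n s.
Proof. by rewrite mem_level => /andP[]. Qed.

Lemma sum_single (N v0 : nat) (Q : pred nat) (G : nat -> int) : (v0 < N)%N ->
  (forall v, (v < N)%N -> Q v -> v = v0) ->
  \sum_(v <- iota 0 N | Q v) G v = if Q v0 then G v0 else 0.
Proof.
move=> h0 h; rewrite big_mkcond (bigD1_seq v0) ?iota_uniq ?mem_iota //=.
rewrite big_seq_cond big1 ?addr0 // => v /andP[]; rewrite mem_iota => hv.
by case: ifP => // /(h _ hv) ->; rewrite eqxx.
Qed.

Lemma all_two (T : eqType) (P : seq T) u1 u2 a b :
  all (fun t => ~~ ((t == u1) && a || (t == u2) && b)) P =
  ~~ ((u1 \in P) && a) && ~~ ((u2 \in P) && b).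
Proof.
apply/allP/andP => [h|[h1 h2] t ht].
  split; apply/negP => /andP[hu hb]; have := h _ hu; rewrite eqxx hb //.
  by rewrite orbT.
apply/negP => /orP[/andP[/eqP e ha]|/andP[/eqP e hb]].
  by rewrite -e ht ha in h1.
by rewrite -e ht hb in h2.
Qed.

(** An entry below all others can only be the 1 of a pattern that ends with 1. *)
Lemma completes_min t s : t \in all6 ->
  completes t s 0 = (t == w231) && hasA s || (t == w321) && hasD s.
Proof.
rewrite completesE !inE; case/or4P => [/eqP->|/eqP->|/eqP->|/or3P[]/eqP->] /=;
  rewrite ?orbF; first [by apply: pairs_false => x y; rewrite ?andbF
                       |by apply: eq_pairs => x y; case: (x < y)%N].
Qed.

(** An entry above all others can only be the 3 of a pattern that ends with 3. *)
Lemma completes_max n t s : t \in all6 -> isperm n s ->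
  completes t s n = (t == w123) && hasA s || (t == w213) && hasD s.
Proof.
move=> ht hp; rewrite completesE.
rewrite (@eq_pairs_in _ (fun x y => [&& (x < y)%N == (nth 0 t 0 < nth 0 t 1)%N,
      (nth 0 t 0 < nth 0 t 2)%N & (nth 0 t 1 < nth 0 t 2)%N])); last first.
  by move=> x y; rewrite !(isperm_mem _ hp) => -> ->; rewrite ![true == _]eq_sym !eqb_id.
move: ht; rewrite !inE; case/or4P => [/eqP->|/eqP->|/eqP->|/or3P[]/eqP->] /=;
  rewrite ?orbF; first [by apply: pairs_false => x y; rewrite ?andbF
                       |by apply: eq_pairs => x y; case: (x < y)%N].
Qed.

(** The state records whether the word has an ascending and a descending pair. One ascent and
    one descent are available, unless they are banned by bA or bD. *)
Definition step_flags (bA bD : bool -> bool -> bool) (d : bool) (x : bool * bool) : seq (bool * bool) :=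
  if d then (if bD x.1 x.2 then [::] else [:: (x.1, true)])
  else (if bA x.1 x.2 then [::] else [:: (true, x.2)]).

Definition flags (s : seq nat) : bool * bool := (hasA s, hasD s).

(** The classes in question allow at most two entries at the end: the new minimum, which
    creates a descent, and one entry vA above the last one, which creates an ascent. *)
Lemma sim_step_flags bA bD P n s (vA : nat) (F : bool * bool -> int) d :
  isperm n.+1 s -> (last 0 s < vA <= n.+1)%N ->
  (forall v, (v <= n.+1)%N -> safe P s v =
     (v == 0%N) && ~~ bD (hasA s) (hasD s) || (v == vA) && ~~ bA (hasA s) (hasD s)) ->
  hasD (append s vA) = hasD s ->
  \sum_(v <- iota 0 n.+2 | safe P s v && ((v <= last 0 s)%N == d)) F (flags (append s v)) =
  op (step_flags bA bD) d F (flags s).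
Proof.
move=> hp hv hok hD; rewrite /op.
have -> : step_flags bA bD d (flags s) =
  if d then (if bD (hasA s) (hasD s) then [::] else [:: (hasA s, true)])
  else (if bA (hasA s) (hasD s) then [::] else [:: (true, hasD s)]) by [].
have h0 : 0%N \in s by rewrite (isperm_mem _ hp).
case: d.
  rewrite (@sum_single _ 0%N) //; last first.
    move=> v hvn /andP[]; rewrite hok // => /orP[/andP[/eqP -> //]|/andP[/eqP -> _]] /eqP.
    by move: hv; lia.
  rewrite hok // leq0n eqxx andbT.
  have -> : (0%N == vA) = false by apply/negbTE; lia.
  rewrite orbF; case: (bD _ _) => /=; first by rewrite big_nil.
  rewrite big_seq1 /flags hasA_append hasD_append; congr (F (_, _)).
    by rewrite (_ : has _ s = false) ?orbF //; apply/hasPn => x.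
  by apply/orP; right; apply/hasP; exists 0%N.
rewrite (@sum_single _ vA) //; last first.
- move=> v hvn /andP[]; rewrite hok // => /orP[/andP[/eqP ->]|/andP[/eqP -> //]].
  by rewrite leq0n.
- by lia.
rewrite hok; last by lia.
have -> : (vA == 0%N) = false by apply/negbTE; lia.
have -> : (vA <= last 0 s)%N = false by apply/negbTE; lia.
rewrite eqxx andbT /=; case: (bA _ _) => /=; first by rewrite big_nil.
rewrite big_seq1 /flags hD hasA_append; congr (F (_, _)).
apply/orP; right; apply/hasP; exists (last 0%N s).
  by rewrite (isperm_mem _ hp) isperm_last.
by case/andP: hv.
Qed.

(** If 132 and 312 are avoided, the last entry is the minimum or the maximum. The other
    patterns then only depend on whether there are ascending or descending pairs. *)
Lemma perm_count_minmax P x a : {subset P <= all6} -> w132 \in P -> w312 \in P ->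
  all (leq 1) (x :: a) ->
  let bA hA hD := (w123 \in P) && hA || (w213 \in P) && hD in
  let bD hA hD := (w231 \in P) && hA || (w321 \in P) && hD in
  perm_count P (x :: a) = op_valley (step_flags bA bD) x.-1 (op_blocks (step_flags bA bD) a (fun=> 1)) (false, false).
Proof.
move=> hP h132 h312 hxa bA bD.
apply: (@class_perm_count _ _ (step_flags bA bD) flags) hxa => n s F d hs.
have hp := level_isperm hs.
apply: (@sim_step_flags _ _ _ _ _ n.+1) => //.
- by rewrite isperm_last // leqnn.
- have hn : n \in s by rewrite (isperm_mem _ hp).
  have h0 : 0%N \in s by rewrite (isperm_mem _ hp).
  move=> v hv; case: (v =P 0%N) => [->|/eqP v0] /=.
    rewrite orbF /bD negb_or -all_two.
    by apply: eq_in_all => t /hP ht; rewrite completes_min.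
  case: (v =P n.+1) => [->|/eqP vn] /=.
    rewrite /bA negb_or -all_two.
    by apply: eq_in_all => t /hP ht; rewrite (completes_max ht hp).
  apply/negbTE/allPn.
  case: (ltngtP (index 0%N s) (index n s)) => h.
  + exists w132 => //; rewrite negbK completesE; apply/pairsP.
    exists (index 0%N s), (index n s); rewrite index_mem !nth_index //=.
    by split=> //; lia.
  + exists w312 => //; rewrite negbK completesE; apply/pairsP.
    exists (index n s), (index 0%N s); rewrite index_mem !nth_index //=.
    by split=> //; lia.
  exists w132 => //; have := congr1 (nth 0%N s) h; rewrite !nth_index //.
  by lia.
rewrite hasD_append (_ : has _ s = false) ?orbF //; apply/hasPn => y.
by rewrite (isperm_mem _ hp); lia.
Qed.

Lemma isperm_size n s : isperm n s -> size s = n.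
Proof. by case/and3P => /eqP. Qed.

Lemma isperm_uniq n s : isperm n s -> uniq s.
Proof. by case/and3P. Qed.

Lemma isperm_nth_last n s : isperm n.+1 s -> nth 0%N s n = last 0%N s.
Proof. by move=> hp; rewrite -nth_last (isperm_size hp). Qed.

Lemma containsw_last t n s i j : isperm n.+1 s -> (i < j < n)%N ->
  same_order t (nth 0%N s i) (nth 0%N s j) (last 0%N s) -> containsw t s.
Proof.
move=> hp hij h; apply/containswP; exists i, j, n.
by rewrite (isperm_size hp) (isperm_nth_last hp); case/andP: hij.
Qed.

Lemma nth_ne_last n s i : isperm n.+1 s -> (i < n)%N -> nth 0%N s i != last 0%N s.
Proof.
move=> hp hi; rewrite -(isperm_nth_last hp) nth_uniq ?(isperm_uniq hp) ?(isperm_size hp) //; lia.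
Qed.

Lemma index_lt_last n s x : isperm n.+1 s -> (x < n.+1)%N -> x != last 0%N s ->
  (index x s < n)%N.
Proof.
move=> hp hx hl; have hin : x \in s by rewrite (isperm_mem _ hp).
have : (index x s < n.+1)%N by rewrite -(isperm_size hp) index_mem.
rewrite ltnS leq_eqVlt => /orP[/eqP e|//]; move: hl.
by rewrite -(nth_index 0%N hin) e (isperm_nth_last hp) eqxx.
Qed.

Lemma pair_last (e : nat -> nat -> bool) n s x : isperm n.+1 s -> (x < n.+1)%N -> x != last 0%N s ->
  e x (last 0%N s) -> pairs e s.
Proof.
move=> hp hx hl h; apply/pairsP; exists (index x s), n.
rewrite (index_lt_last hp) // (isperm_size hp) nth_index ?(isperm_mem _ hp) //.
by rewrite (isperm_nth_last hp).
Qed.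

(** If 132 and 213 are avoided, an entry that creates an ascent is the successor of the last
    entry, and an entry that creates a descent is the minimum. *)
Lemma perm_count_layered P x a : {subset P <= [:: w132; w213; w321]} -> w132 \in P -> w213 \in P ->
  all (leq 1) (x :: a) ->
  let bD (hA hD : bool) := (w321 \in P) && hD in
  perm_count P (x :: a) = op_valley (step_flags (fun _ _ => false) bD) x.-1
    (op_blocks (step_flags (fun _ _ => false) bD) a (fun=> 1)) (false, false).
Proof.
move=> hP h132 h213 hxa bD.
apply: (@class_perm_count _ _ (step_flags (fun _ _ => false) bD) flags) hxa => n s F d hs.
have hp := level_isperm hs; have hl := isperm_last hp.
have hav t : t \in P -> ~~ containsw t s.
  by move: hs; rewrite mem_level => /andP[_ /allP h] /h.
have hPall : {subset P <= all6} by move=> t /hP; rewrite !inE => /or3P[]/eqP->.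
have h231 : w231 \notin P by apply/negP => /hP.
apply: (@sim_step_flags _ _ _ _ _ (last 0%N s).+1) => //.
- by rewrite ltnSn.
- move=> v hv; rewrite andbT; case: (v =P 0%N) => [->|/eqP v0] /=.
    rewrite orbF /bD.
    have -> : safe P s 0 = ~~ ((w231 \in P) && hasA s) && ~~ ((w321 \in P) && hasD s).
      by rewrite -all_two; apply: eq_in_all => t /hPall ht; rewrite completes_min.
    by rewrite (negbTE h231).
  case: (v =P (last 0%N s).+1) => [->|/eqP vl]; last first.
    apply/negbTE/allPn; case: (ltngtP v (last 0%N s).+1) vl => // h _.
      exists w132 => //; rewrite negbK completesE.
      apply: (@pair_last _ n _ 0%N hp) => //=; last by lia.
      by apply/negP => /eqP h'; lia.
    exists w213 => //; rewrite negbK completesE.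
    apply: (@pair_last _ n _ v.-1 hp) => //=; last 1 first.
    + by lia.
    + by lia.
    + by apply/negP => /eqP h'; lia.
  apply/allP => t ht; apply/negP; rewrite completesE => /pairsP[i [j [hij hj]]].
  rewrite (isperm_size hp) ltnS in hj.
  have hi := nth_ne_last hp (leq_trans hij hj).
  have := hav t ht; move: hj; rewrite leq_eqVlt => /orP[/eqP jn|hjn] hc.
    have -> : nth 0%N s j = last 0%N s by rewrite jn (isperm_nth_last hp).
    move: (hP _ ht); rewrite !inE => /or3P[]/eqP-> /=; lia.
  have hj' := nth_ne_last hp hjn.
  have hcl := @containsw_last t n s i j hp; rewrite hij hjn in hcl.
  have {hcl} : ~~ same_order t (nth 0%N s i) (nth 0%N s j) (last 0%N s).
    by apply: contra hc; apply: hcl.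
  move: (hP _ ht); rewrite /same_order !inE => /or3P[]/eqP-> /=; lia.
rewrite hasD_append; case: hasP => [[y hy hly]|_]; last by rewrite orbF.
rewrite orbT; apply/esym/(@pair_last _ n _ y hp); last by lia.
  by rewrite -(isperm_mem _ hp).
by apply/negP => /eqP h'; lia.
Qed.

Lemma sum_range (N b m : nat) (Q : pred nat) (G : nat -> int) : (b + m <= N)%N ->
  (forall v, (v < N)%N -> Q v = (b <= v < b + m)%N) ->
  \sum_(v <- iota 0 N | Q v) G v = \sum_(v <- iota b m) G v.
Proof.
move=> hm hQ; rewrite -[LHS]big_filter; congr bigop; apply: (@irr_sorted_eq _ ltn ltn_trans ltnn).
- by apply: sorted_filter; [exact: ltn_trans|exact: iota_ltn_sorted].
- exact: iota_ltn_sorted.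
move=> v; rewrite mem_filter !mem_iota add0n /=.
by case: (ltnP v N) => h; [rewrite hQ // andbT|rewrite andbF; apply/esym/negbTE; lia].
Qed.

Lemma last_append s v : last 0%N (append s v) = v.
Proof. by rewrite last_rcons. Qed.

Lemma has_lt n s v : isperm n.+1 s -> has (fun x => x < v)%N s = (0 < v)%N.
Proof.
move=> hp; apply/hasP/idP => [[x _]|hv]; first by lia.
by exists 0%N => //; rewrite (isperm_mem _ hp).
Qed.

(** If v exceeds the last entry by more than one, then v - 1 and the last entry form a 21 below
    v. Otherwise a 21 below v also lies below the last entry and forms a 213 with it. *)
Lemma completes213_threshold n s v : isperm n.+1 s -> ~~ containsw w213 s -> (v < n.+2)%N ->
  completes w213 s v = ((last 0 s).+1 < v)%N.
Proof.
move=> hp hc hv; have hl := isperm_last hp; rewrite completesE /=; apply/idP/idP; last first.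
  move=> h; apply: (@pair_last _ n _ v.-1 hp); [lia| |lia].
  by apply/negP => /eqP h'; lia.
case/pairsP => i [j [hij]]; rewrite (isperm_size hp) ltnS => hj h; rewrite ltnNge; apply/negP => hvl.
move: hj; rewrite leq_eqVlt => /orP[/eqP jn|hjn].
  by move: h; rewrite jn (isperm_nth_last hp); have := nth_ne_last hp (leq_trans hij (eq_leq jn)); lia.
move/negP: hc; apply; apply: (@containsw_last _ n _ i j hp); first by rewrite hij.
have := nth_ne_last hp (ltn_trans hij hjn); have := nth_ne_last hp hjn.
rewrite /same_order /=; lia.
Qed.

(** The state is the last value x: every lower position is allowed, and only one higher. *)
Definition step213 (d : bool) (x : nat) : seq nat := if d then iota 0 x.+1 else [:: x.+1].

Lemma perm_count_213 x a : all (leq 1) (x :: a) ->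
  perm_count [:: w213] (x :: a) = op_valley step213 x.-1 (op_blocks step213 a (fun=> 1)) 0%N.
Proof.
apply: (@class_perm_count _ _ step213 (last 0%N)) => n s F d hs.
have hp := level_isperm hs; have hl := isperm_last hp.
have hok v : (v < n.+2)%N -> safe [:: w213] s v = (v <= (last 0%N s).+1)%N.
  have hav : ~~ containsw w213 s by move: hs; rewrite mem_level => /andP[_ /andP[]].
  by move=> hv; rewrite /safe /= andbT (completes213_threshold hp hav hv) -leqNgt.
under eq_bigr => v _ do rewrite last_append.
case: d; rewrite /op /step213.
  by apply: sum_range => [|v hv]; [lia|rewrite hok //; lia].
by rewrite (@sum_range _ (last 0%N s).+1 1) // => [|v hv]; [lia|rewrite hok //; lia].
Qed.

Lemma find_threshold p K m : (m <= K)%N -> (forall u, (u < K)%N -> p u = (m <= u)%N) ->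
  find p (iota 0 K) = m.
Proof.
move=> hm hp; rewrite -{1}(subnKC hm) iotaD find_cat add0n.
have -> : has p (iota 0 m) = false.
  by apply/hasPn => u; rewrite mem_iota add0n => hu; rewrite hp; lia.
rewrite size_iota; case e: (K - m)%N => [|k]; first by rewrite addn0.
by rewrite /= hp ?leqnn ?addn0 //; lia.
Qed.

(** The state is the largest entry allowed at the end and whether the last entry is the
    minimum. If it is not, an ascent would complete 123. *)
Definition step123 (d : bool) (x : nat * bool) : seq (nat * bool) :=
  if x.2 then (if d then [:: (x.1.+1, true)] else [seq (v, false) | v <- iota 1 x.1])
  else (if d then (x.1.+1, true) :: [seq (v, false) | v <- iota 1 x.1] else [::]).

(** For a pattern whose last letter is bounded only from below by the others, the first value
    of the last entry that is not allowed. *)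
Definition threshold (e : nat -> nat -> nat -> bool) s :=
  find (fun u => pairs (fun x y => e x y u) s) (iota 0 (size s).+1).

Lemma threshold_append0 (e : nat -> nat -> nat -> bool) s : (forall x y, e x y 0%N = false) ->
  (forall x u, e x 0%N u = false) -> (forall x y u, e x.+1 y.+1 u.+1 = e x y u) ->
  threshold e (append s 0) = (threshold e s).+1.
Proof.
move=> h0 h1 hS; rewrite /threshold size_append; move: (size s).+1 => K.
have -> : iota 0 K.+1 = 0%N :: map S (iota 0 K) by rewrite -(iotaDl 1 0).
rewrite /=; have -> : pairs (fun x y => e x y 0%N) (append s 0) = false by apply: pairs_false.
congr _.+1; rewrite find_map; apply: eq_find => u /=.
rewrite pairs_append (_ : has _ s = false) ?orbF.
  by apply: eq_pairs => x y; rewrite /bump /= !add1n hS.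
by apply/hasPn => x _; rewrite h1.
Qed.

Lemma thresholdP (e : nat -> nat -> nat -> bool) s v : (forall x y u u', (u <= u')%N -> e x y u -> e x y u') ->
  (v <= size s)%N -> pairs (fun x y => e x y v) s = (threshold e s <= v)%N.
Proof.
move=> hm hv; set p := fun u => pairs (fun x y => e x y u) s.
rewrite -/(p v) /threshold -/p; apply/idP/idP => [h|h].
  rewrite leqNgt; apply/negP => /(before_find 0%N).
  by rewrite nth_iota ?add0n ?h.
have hf : has p (iota 0 (size s).+1) by rewrite has_find size_iota ltnS (leq_trans h).
have := nth_find 0%N hf; rewrite nth_iota ?add0n; last first.
  by rewrite -[X in (_ < X)%N](size_iota 0) -has_find.
case/pairsP => i [j [h1 h2 h3]]; apply/pairsP; exists i, j; split=> //.
exact: hm h3.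
Qed.

Definition e123 (x y u : nat) : bool := (x < y < u)%N.

Lemma completes123E s v : completes w123 s v = pairs (fun x y => e123 x y v) s.
Proof. by rewrite completesE; apply: eq_pairs => x y; rewrite /= /e123; lia. Qed.

Definition st123 (s : seq nat) : nat * bool := ((threshold e123 s).-1, last 0%N s == 0%N).

Lemma threshold_gt0 e s : (forall x y, e x y 0%N = false) -> (0 < threshold e s)%N.
Proof. by move=> h0; rewrite /threshold /= pairs_false. Qed.

Lemma perm_count_123 x a : all (leq 1) (x :: a) ->
  perm_count [:: w123] (x :: a) = op_valley step123 x.-1 (op_blocks step123 a (fun=> 1)) (1%N, true).
Proof.
have -> : (1%N, true) = st123 [:: 0%N] by [].
apply: (@class_perm_count _ _ step123 st123) => n s F d hs.
have hp := level_isperm hs; have hl := isperm_last hp; have hsz := isperm_size hp.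
have hav : ~~ containsw w123 s by move: hs; rewrite mem_level => /andP[_ /andP[]].
have e0 x' y : e123 x' y 0 = false by rewrite /e123; lia.
have e1 x' y : e123 x' 0 y = false by rewrite /e123; lia.
have eS x' y u : e123 x'.+1 y.+1 u.+1 = e123 x' y u by rewrite /e123; lia.
have em x' y u u' : (u <= u')%N -> e123 x' y u -> e123 x' y u' by rewrite /e123; lia.
have t0 := threshold_gt0 s e0.
have tn : (threshold e123 s <= n.+2)%N.
  by rewrite /threshold; have := find_size (fun u => pairs (fun x y => e123 x y u) s) (iota 0 (size s).+1); rewrite size_iota hsz.
have hok v : (v < n.+2)%N -> safe [:: w123] s v = (v < threshold e123 s)%N.
  by move=> hv; rewrite /safe /= andbT completes123E thresholdP ?hsz // ltnNge.
have st0 : st123 (append s 0) = ((threshold e123 s).-1.+1, true).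
  by rewrite /st123 threshold_append0 // last_append /= prednK.
have stv v : (0 < v < threshold e123 s)%N -> st123 (append s v) = (v, false).
  case/andP=> v0 hv; rewrite /st123 last_append; congr (_, _); last by lia.
  suff -> : threshold e123 (append s v) = v.+1 by [].
  rewrite /threshold size_append hsz; apply: find_threshold => [|u hu]; first by lia.
  rewrite pairs_append; apply/orP/idP => [[h|/hasP[y _]]|h].
  - rewrite ltnNge; apply/negP => huv.
    have : completes w123 s v.
      rewrite completes123E; case/pairsP: h => i [j [h1 h2 h3]]; apply/pairsP.
      by exists i, j; split=> //; move: h3; rewrite /e123 /bump; lia.
    by rewrite completes123E thresholdP ?hsz //; lia.
  - by rewrite /e123; lia.
  right; apply/hasP; exists 0%N; first by rewrite (isperm_mem _ hp).
  by rewrite /e123 /bump; lia.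
have hfl : last 0%N s != 0%N -> threshold e123 s = (last 0%N s).+1.
  move=> l0; rewrite /threshold hsz; apply: find_threshold => [|u hu]; first by lia.
  apply/idP/idP => [/pairsP[i [j [hij]]]|h]; last first.
    apply: (@pair_last _ n _ 0%N hp) => //; [by rewrite eq_sym|by rewrite /e123; lia].
  rewrite hsz ltnS => hj h; rewrite ltnNge; apply/negP => hul.
  move: hj; rewrite leq_eqVlt => /orP[/eqP jn|hjn].
    by move: h; rewrite jn (isperm_nth_last hp) /e123; lia.
  move/negP: hav; apply; apply: (@containsw_last _ n _ i j hp); first by rewrite hij.
  by move: h; rewrite /e123 /same_order /=; lia.
rewrite /op.
have -> : step123 d (st123 s) = if last 0%N s == 0%N
    then (if d then [:: ((threshold e123 s).-1.+1, true)]
          else [seq (v, false) | v <- iota 1 (threshold e123 s).-1])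
    else (if d then ((threshold e123 s).-1.+1, true) :: [seq (v, false) | v <- iota 1 (threshold e123 s).-1]
          else [::]) by [].
case: eqP => l0; last first.
  move/eqP: l0 => /hfl thl; rewrite thl in hok t0 stv st0 *.
  case: d.
    rewrite (@sum_range _ 0 (last 0%N s).+1); [|lia|by move=> v hv; rewrite hok //; lia].
    rewrite -[iota 0 _]/(0%N :: iota 1 (last 0%N s)) !big_cons st0; congr (_ + _).
    rewrite big_map big_seq [RHS]big_seq.
    by apply: eq_bigr => v; rewrite mem_iota => hv; rewrite stv //; lia.
  rewrite big_nil big_seq_cond big1 // => v /andP[]; rewrite mem_iota => hv.
  by rewrite hok //; lia.
rewrite l0; case: d.
  rewrite (@sum_range _ 0 1) //; last by move=> v hv; rewrite hok //; lia.
  by rewrite !big_seq1 st0.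
rewrite (@sum_range _ 1 (threshold e123 s).-1); [|lia|by move=> v hv; rewrite hok //; lia].
rewrite big_map big_seq [RHS]big_seq.
by apply: eq_bigr => v; rewrite mem_iota => hv; rewrite stv //; lia.
Qed.
(** An ascent after a last entry that is not the minimum completes a pattern; then the state
    is 0. Otherwise the state is the number of entries above the minimum that are allowed. *)
Definition step123_132 (d : bool) (x : nat) : seq nat := if d then [:: x.+1] else [seq 0%N | _ <- iota 1 x].

(** Under this condition u completes a 123 or a 132, whatever its position relative to y. *)
Definition e132 (x y u : nat) : bool := (x < y)%N && (x < u)%N.

Definition st123_132 (s : seq nat) : nat := if last 0%N s == 0%N then (threshold e132 s).-1 else 0%N.

Lemma completes123_132E s v : completes w123 s v || completes w132 s v = pairs (fun x y => e132 x y v) s.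
Proof.
rewrite !completesE; apply/orP/pairsP => [[]|] => [/pairsP[i [j [h1 h2 h3]]]|/pairsP[i [j [h1 h2 h3]]]|[i [j [h1 h2 h3]]]].
- by exists i, j; split=> //; move: h3; rewrite /e132 /=; lia.
- by exists i, j; split=> //; move: h3; rewrite /e132 /=; lia.
case: (ltnP (nth 0%N s j) v) => hv; [left|right]; apply/pairsP; exists i, j; split=> //.
  by move: h3; rewrite /e132 /=; lia.
by move: h3; rewrite /e132 /=; lia.
Qed.

Lemma perm_count_123_132 x a : all (leq 1) (x :: a) ->
  perm_count [:: w123; w132] (x :: a) = op_valley step123_132 x.-1 (op_blocks step123_132 a (fun=> 1)) 1%N.
Proof.
have -> : 1%N = st123_132 [:: 0%N] by [].
apply: (@class_perm_count _ _ step123_132 st123_132) => n s F d hs.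
have hp := level_isperm hs; have hl := isperm_last hp; have hsz := isperm_size hp.
have e0 x' y : e132 x' y 0 = false by rewrite /e132; lia.
have e1 x' y : e132 x' 0 y = false by rewrite /e132; lia.
have eS x' y u : e132 x'.+1 y.+1 u.+1 = e132 x' y u by rewrite /e132; lia.
have em x' y u u' : (u <= u')%N -> e132 x' y u -> e132 x' y u' by rewrite /e132; lia.
have t0 := threshold_gt0 s e0.
have tn : (threshold e132 s <= n.+2)%N.
  by rewrite /threshold; have := find_size (fun u => pairs (fun x y => e132 x y u) s) (iota 0 (size s).+1); rewrite size_iota hsz.
have hok v : (v < n.+2)%N -> safe [:: w123; w132] s v = (v < threshold e132 s)%N.
  by move=> hv; rewrite /safe /= andbT -negb_or completes123_132E thresholdP ?hsz // ltnNge.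
have st0 : st123_132 (append s 0) = (threshold e132 s).-1.+1.
  by rewrite /st123_132 threshold_append0 // last_append /= prednK.
have stv v : (0 < v)%N -> st123_132 (append s v) = 0%N.
  by move=> v0; rewrite /st123_132 last_append; have -> : (v == 0%N) = false by lia.
have hfl : last 0%N s != 0%N -> threshold e132 s = 1%N.
  move=> l0; rewrite /threshold hsz; apply: find_threshold => // u hu.
  apply/idP/idP => [/pairsP[i [j [_ _]]]|h]; first by rewrite /e132; lia.
  by apply: (@pair_last _ n _ 0%N hp); rewrite // 1?eq_sym // /e132; lia.
rewrite /op.
have -> : step123_132 d (st123_132 s) = if d then [:: (threshold e132 s).-1.+1] else if last 0%N s == 0%N
    then [seq 0%N | _ <- iota 1 (threshold e132 s).-1] else [::].
  by rewrite /step123_132 /st123_132; case: eqP => // /eqP/hfl ->; case: d.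
case: eqP => [->|/eqP l0]; last first.
  rewrite hfl // in hok st0 *; case: d.
    rewrite (@sum_range _ 0 1) //; last by move=> v hv; rewrite hok //; lia.
    by rewrite !big_seq1 st0.
  rewrite big_nil big_seq_cond big1 // => v /andP[]; rewrite mem_iota => hv.
  by rewrite hok //; lia.
case: d.
  rewrite (@sum_range _ 0 1) //; last by move=> v hv; rewrite hok //; lia.
  by rewrite !big_seq1 st0.
rewrite (@sum_range _ 1 (threshold e132 s).-1); [|lia|by move=> v hv; rewrite hok //; lia].
rewrite big_map big_seq [RHS]big_seq.
by apply: eq_bigr => v; rewrite mem_iota => hv; rewrite stv //; lia.
Qed.

(** These permutations go down and then up. The state says whether the ascending part has begun,
    and the number of positions above the last entry. *)
Definition step132_231 (d : bool) (x : bool * nat) : seq (bool * nat) :=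
  if d then (if x.1 then [::] else [:: (false, x.2.+1)])
  else [seq (true, x.2 - i)%N | i <- iota 0 x.2].

Definition st132_231 (s : seq nat) : bool * nat :=
  if hasA s then (true, size s - last 0 s)%N else (false, size s).

Lemma completes132_231E s v : completes w132 s v || completes w231 s v = pairs (fun x y => (x < y) && (v <= y))%N s.
Proof.
rewrite !completesE; apply/orP/pairsP => [[]|] => [/pairsP[i [j [h1 h2 h3]]]|/pairsP[i [j [h1 h2 h3]]]|[i [j [h1 h2 h3]]]].
- by exists i, j; split=> //; move: h3; rewrite /=; lia.
- by exists i, j; split=> //; move: h3; rewrite /=; lia.
case: (ltnP (nth 0%N s i) v) => hv; [left|right]; apply/pairsP; exists i, j; split=> //.
  by move: h3; rewrite /=; lia.
by move: h3; rewrite /=; lia.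
Qed.

Lemma noA_last n s : isperm n.+1 s -> ~~ hasA s -> last 0%N s = 0%N.
Proof.
move=> hp; apply: contraNeq => h; apply: (@pair_last _ n _ 0%N hp); rewrite 1?eq_sym //; lia.
Qed.

Lemma hasA_append0 s : hasA (append s 0) = hasA s.
Proof. by rewrite hasA_append (_ : has _ s = false) ?orbF //; apply/hasPn. Qed.

Lemma hasA_appendS n s v : isperm n.+1 s -> (0 < v)%N -> hasA (append s v).
Proof. by move=> hp hv; rewrite hasA_append (has_lt v hp) hv orbT. Qed.

Lemma sum_shift (N b : nat) (G : nat -> int) :
  \sum_(v <- iota b N) G v = \sum_(i <- iota 0 N) G (b + i)%N.
Proof. by rewrite -{1}[b]addn0 iotaDl big_map. Qed.

Lemma perm_count_132_231 x a : all (leq 1) (x :: a) ->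
  perm_count [:: w132; w231] (x :: a) = op_valley step132_231 x.-1 (op_blocks step132_231 a (fun=> 1)) (false, 1%N).
Proof.
have -> : (false, 1%N) = st132_231 [:: 0%N] by [].
apply: (@class_perm_count _ _ step132_231 st132_231) => n s F d hs.
have hp := level_isperm hs; have hl := isperm_last hp; have hsz := isperm_size hp.
have hok v : (v < n.+2)%N -> safe [:: w132; w231] s v = (hasA s ==> (last 0 s < v))%N.
  move=> hv; rewrite /safe /= andbT -negb_or completes132_231E.
  case hA: (hasA s); last first.
    apply/negP => /pairsP[i [j [h1 h2 /andP[h3 _]]]].
    by move/negP: hA; apply; apply/pairsP; exists i, j.
  rewrite implyTb ltnNge; congr negb; apply/pairsP/idP => [[i [j [hij]]]|h].
    rewrite hsz ltnS => hj h; move: hj; rewrite leq_eqVlt => /orP[/eqP jn|hjn].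
      by move: h; rewrite jn (isperm_nth_last hp); lia.
    rewrite leqNgt; apply/negP => hlv.
    have hin := nth_ne_last hp (ltn_trans hij hjn).
    move: hs; rewrite mem_level => /andP[_ /and3P[/negP c1 /negP c2 _]].
    case: (ltngtP (nth 0%N s i) (last 0%N s)) hin => // hil _.
      by apply: c1; apply: (@containsw_last _ n _ i j hp); rewrite ?hij // /same_order /=; lia.
    by apply: c2; apply: (@containsw_last _ n _ i j hp); rewrite ?hij // /same_order /=; lia.
  have l0 : last 0%N s != 0%N.
    apply/negP => /eqP l0; case/pairsP: hA => i [j [hij]].
    rewrite hsz ltnS => hj h'; move: hj; rewrite leq_eqVlt => /orP[/eqP jn|hjn].
      by move: h'; rewrite jn (isperm_nth_last hp) l0.
    have hin := nth_ne_last hp (ltn_trans hij hjn).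
    move: hs; rewrite mem_level => /andP[_ /and3P[_ /negP c2 _]].
    by apply: c2; apply: (@containsw_last _ n _ i j hp); rewrite ?hij // /same_order /=; lia.
  have /pairsP[i [j [h1 h2 h3]]] : pairs (fun x y => (x < y) && (v <= y))%N s.
    by apply: (@pair_last _ n _ 0%N hp); rewrite 1?eq_sym // h andbT; lia.
  by exists i, j.
have stp v : (0 < v)%N -> st132_231 (append s v) = (true, n.+2 - v)%N.
  by move=> hv; rewrite /st132_231 (hasA_appendS hp hv) last_append size_append hsz.
have sts : st132_231 s = if hasA s then (true, n.+1 - last 0 s)%N else (false, n.+1) by rewrite /st132_231 hsz.
rewrite /op sts; case hA: (hasA s) hok => hok.
  case: d; rewrite /step132_231 /fst /snd.
    rewrite big_nil big_seq_cond big1 // => v /andP[]; rewrite mem_iota => hv.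
    by rewrite hok //; lia.
  rewrite (@sum_range _ (last 0%N s).+1 (n.+1 - last 0%N s)); [|lia|by move=> v hv; rewrite hok //; lia].
  rewrite sum_shift big_map; apply: eq_bigr => i _.
  by rewrite stp //; congr (F (_, _)); lia.
have l0 : last 0%N s = 0%N by apply: (noA_last hp); rewrite hA.
have st0 : st132_231 (append s 0) = (false, n.+2) by rewrite /st132_231 hasA_append0 hA size_append hsz.
rewrite l0; case: d; rewrite /step132_231 /fst /snd.
  rewrite (@sum_range _ 0 1) //; last by move=> v hv; rewrite hok //; lia.
  by rewrite !big_seq1 st0.
rewrite (@sum_range _ 1 n.+1); [|lia|by move=> v hv; rewrite hok //; lia].
rewrite sum_shift big_map; apply: eq_bigr => i _.
by rewrite stp //; congr (F (_, _)); lia.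
Qed.

(** As soon as there is an ascending pair, no entry can be appended. *)
Definition step123_132_231 (d : bool) (x : bool * nat) : seq (bool * nat) :=
  if x.1 then [::] else if d then [:: (false, x.2.+1)] else [seq (true, 0%N) | _ <- iota 0 x.2].

Definition st123_132_231 (s : seq nat) : bool * nat := if hasA s then (true, 0%N) else (false, size s).

Lemma perm_count_123_132_231 x a : all (leq 1) (x :: a) ->
  perm_count [:: w123; w132; w231] (x :: a) = op_valley step123_132_231 x.-1 (op_blocks step123_132_231 a (fun=> 1)) (false, 1%N).
Proof.
have -> : (false, 1%N) = st123_132_231 [:: 0%N] by [].
apply: (@class_perm_count _ _ step123_132_231 st123_132_231) => n s F d hs.
have hp := level_isperm hs; have hsz := isperm_size hp.
have hok v : (v < n.+2)%N -> safe [:: w123; w132; w231] s v = ~~ hasA s.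
  move=> hv; rewrite /safe /= andbT -!negb_or; congr negb; rewrite !completesE.
  apply/idP/pairsP => [|[i [j [h1 h2 h3]]]].
    case/or3P => /pairsP[i [j [h1 h2 /and3P[/eqP h3 _ _]]]]; exists i, j; split=> //.
  case: (ltnP (nth 0%N s i) v) => hi; case: (ltnP (nth 0%N s j) v) => hj.
  - by apply/or3P/Or31/pairsP; exists i, j; rewrite h3 /=; split=> //; lia.
  - by apply/or3P/Or32/pairsP; exists i, j; rewrite h3 /=; split=> //; lia.
  - by apply/or3P/Or33/pairsP; exists i, j; rewrite h3 /=; split=> //; lia.
  by apply/or3P/Or33/pairsP; exists i, j; rewrite h3 /=; split=> //; lia.
have sts : st123_132_231 s = if hasA s then (true, 0)%N else (false, n.+1) by rewrite /st123_132_231 hsz.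
rewrite /op sts; case hA: (hasA s) hok => hok.
  rewrite big_nil big_seq_cond big1 // => v /andP[]; rewrite mem_iota => hv.
  by rewrite hok.
have l0 : last 0%N s = 0%N by apply: (noA_last hp); rewrite hA.
have st0 : st123_132_231 (append s 0) = (false, n.+2) by rewrite /st123_132_231 hasA_append0 hA size_append hsz.
rewrite l0; case: d; rewrite /step123_132_231 /fst /snd.
  rewrite (@sum_range _ 0 1) //; last by move=> v hv; rewrite hok //; lia.
  by rewrite !big_seq1 st0.
rewrite (@sum_range _ 1 n.+1); [|lia|by move=> v hv; rewrite hok //; lia].
rewrite sum_shift big_map; apply: eq_bigr => i _.
by rewrite /st123_132_231 (hasA_appendS hp).
Qed.

(** * Counting 213- and 123-avoiders *)

Local Notation T213 := (op_any step213).
Local Notation U213 := (op step213 false).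
Local Notation D213 := (op step213 true).

Lemma U213E f x : U213 f x = f x.+1.
Proof. by rewrite /op big_seq1. Qed.

Lemma D213S f x : D213 f x.+1 = D213 f x + f x.+1.
Proof.
rewrite /op /step213; have -> : iota 0 x.+2 = iota 0 x.+1 ++ [:: x.+1] by rewrite -[in LHS](addn1 x.+1) iotaD.
by rewrite big_cat big_seq1.
Qed.

Lemma D2130 f : D213 f 0%N = f 0%N.
Proof. by rewrite /op big_seq1. Qed.

Lemma T213E f x : T213 f x = D213 f x + f x.+1.
Proof. by rewrite /op_any U213E. Qed.

(** A step up followed by a step down can lead wherever a single step leads. This gives
    [op_valley] the recursion that it has for two-row shapes, up to a factor T213. *)
Lemma U213_D f : U213 (D213 f) = T213 f.
Proof. by apply: functional_extensionality => x; rewrite U213E D213S T213E. Qed.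

Lemma op_sub St (step : bool -> St -> seq St) d (f g : St -> int) :
  op step d (fun x => f x - g x) = fun x => op step d f x - op step d g x.
Proof. by apply: functional_extensionality => x; rewrite /op -sumrB. Qed.

Lemma op_add St (step : bool -> St -> seq St) d (f g : St -> int) :
  op step d (fun x => f x + g x) = fun x => op step d f x + op step d g x.
Proof. by apply: functional_extensionality => x; rewrite /op -big_split. Qed.

Lemma op_any_sub St (step : bool -> St -> seq St) (f g : St -> int) :
  op_any step (fun x => f x - g x) = fun x => op_any step f x - op_any step g x.
Proof.
apply: functional_extensionality => x; rewrite /op_any !op_sub.
by rewrite opprD addrACA.
Qed.

Lemma op_valley_recl St (step : bool -> St -> seq St) b f :
  op_valley step b.+1 f = fun x => iter b.+1 (op step false) f x + op step true (op_valley step b f) x.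
Proof. by []. Qed.

Lemma S213_rec b f : op_valley step213 b.+2 f =
  fun x => T213 (op_valley step213 b.+1 f) x - T213 (op_valley step213 b f) x.
Proof.
apply: functional_extensionality => x.
have hU : U213 (op_valley step213 b.+1 f) x = iter b.+2 U213 f x + T213 (op_valley step213 b f) x.
  by rewrite -U213_D op_valley_recl op_add.
have hT : T213 (op_valley step213 b.+1 f) x = D213 (op_valley step213 b.+1 f) x + U213 (op_valley step213 b.+1 f) x by [].
by rewrite hT hU op_valley_recl; ring.
Qed.

Lemma S213_1 f : op_valley step213 1 f = T213 f.
Proof. by apply: functional_extensionality => x; rewrite op_valley_recl /op_any addrC. Qed.

Lemma S213_T b f : T213 (op_valley step213 b f) = op_valley step213 b (T213 f).
Proof.
suff [] : T213 (op_valley step213 b f) = op_valley step213 b (T213 f) /\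
  T213 (op_valley step213 b.+1 f) = op_valley step213 b.+1 (T213 f) by [].
elim: b => [|b [h1 h2]]; first by split=> //; rewrite !S213_1.
by split=> //; rewrite !S213_rec op_any_sub h1 h2.
Qed.

(** The weight of the gap 1, that is, of a shape with rows p = q + 1. *)
Definition gap0 (x : nat) : int := (x == 0%N)%:R.

(** Ballot numbers: lattice paths that stay nonnegative, counted by reflection. *)
Lemma iter_gap_move N k : (2 * k <= N)%N ->
  iter N gap_move gap0 (N - 2 * k)%N = 'C(N, k)%:R - (binpred N k)%:R.
Proof.
elim: N k => [|N IH] k hk; first by have -> : k = 0%N by lia.
rewrite iterS /gap_move /gap_up /gap_down.
have hA : iter N gap_move gap0 (N.+1 - 2 * k).+1 = if k is k'.+1 then 'C(N, k')%:R - (binpred N k')%:R else 0.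
  case: k hk => [|k] hk.
    have hz M m : (M < m)%N -> iter M gap_move gap0 m = 0.
      elim: M m => [|M IHM] [|m] // hm; rewrite iterS /gap_move /gap_up /gap_down !IHM ?addr0 //; lia.
    by apply: hz; lia.
  by rewrite -IH; [congr (iter _ _ _ _); lia|lia].
rewrite hA; case e: (N.+1 - 2 * k)%N => [|m].
  case: k hk e {hA} => [|k] hk e; first by lia.
  have eN : N = k.*2.+1 by lia.
  rewrite addr0 /= binS.
  have -> : 'C(N, k.+1) = 'C(N, k) by rewrite -[RHS]bin_sub ?eN; [congr 'C(_, _); lia|lia].
  by case: k {hk e eN} => [|k] /=; rewrite ?binS ?bin0 ?natrD; ring.
have -> : m = (N - 2 * k)%N by lia.
rewrite IH; last by lia.
case: k {hk e hA} => [|k] /=; first by rewrite !bin0; ring.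
by case: k => [|k] /=; rewrite !binS ?bin0 ?natrD; ring.
Qed.

(** Ballot numbers again, now as numbers of 213-avoiding continuations of a given last value. *)
Lemma iter_T213_one m x : iter m T213 (fun=> 1) x =
  'C(2 * m + x + 1, m)%:R - (binpred (2 * m + x + 1) m)%:R.
Proof.
elim: m x => [|m IH] x; first by rewrite /= bin0 subr0.
elim: x => [|x IHx].
  rewrite iterS T213E D2130 !IH.
  have -> : (2 * m.+1 + 0 + 1 = m.*2.+3)%N by lia.
  have -> : (2 * m + 0 + 1 = m.*2.+1)%N by lia.
  have -> : (2 * m + 1 + 1 = m.*2.+2)%N by lia.
  have h : 'C(m.*2.+1, m.+1) = 'C(m.*2.+1, m) by rewrite -[RHS]bin_sub; [congr 'C(_, _); lia|lia].
  have h1 : binpred m.*2.+3 m.+1 = 'C(m.*2.+3, m) by [].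
  rewrite h1 ['C(m.*2.+3, m.+1)]binS ['C(m.*2.+2, m.+1)]binS h; case: m {IH h h1} => [|m]; first by [].
  by rewrite /= !binS ?natrD; ring.
rewrite iterS T213E D213S; move: IHx; rewrite iterS T213E => IHx.
rewrite IHx IH.
have -> : (2 * m.+1 + x.+1 + 1 = (2 * m + x).+4)%N by lia.
have -> : (2 * m.+1 + x + 1 = (2 * m + x).+3)%N by lia.
have -> : (2 * m + x.+2 + 1 = (2 * m + x).+3)%N by lia.
by case: m {IH IHx} => [|m] /=; rewrite !binS ?bin0 ?natrD; ring.
Qed.

(** Both sides are Catalan numbers. *)
Lemma iter_T213_gap m : iter m T213 (fun=> 1) 0%N = iter m.*2.+2 gap_move gap0 0%N.
Proof.
have -> : 0%N = (m.*2.+2 - 2 * m.+1)%N :> nat by lia.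
rewrite iter_gap_move; last by lia.
have -> : (m.*2.+2 - 2 * m.+1 = 0)%N by lia.
rewrite iter_T213_one; have -> : (2 * m + 0 + 1 = m.*2.+1)%N by lia.
have h : 'C(m.*2.+1, m.+1) = 'C(m.*2.+1, m) by rewrite -[RHS]bin_sub; [congr 'C(_, _); lia|lia].
have -> : binpred m.*2.+2 m.+1 = 'C(m.*2.+2, m) by [].
rewrite ['C(m.*2.+2, m.+1)]binS h; case: m {h} => [|m] //.
by rewrite ['C(m.+1.*2.+2, m.+1)]binS /= !natrD; ring.
Qed.

(** The vector space spanned by the powers of T213 at the constant 1, against the one
    spanned by the even powers of [gap_move] at [gap0], with T213 corresponding to the square.
    Differences are all that the recursions use. *)
Inductive paired : (nat -> int) -> (nat -> int) -> Prop :=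
| paired_pow m : paired (iter m T213 (fun=> 1)) (iter m.*2.+2 gap_move gap0)
| paired_sub f h f' h' : paired f h -> paired f' h' -> paired (fun x => f x - f' x) (fun x => h x - h' x).

Lemma paired_eval f h : paired f h -> f 0%N = h 0%N.
Proof. by elim=> [m|f1 h1 f2 h2 _ e1 _ e2]; rewrite ?iter_T213_gap ?e1 ?e2. Qed.

Lemma paired_step f h : paired f h -> paired (T213 f) (gap_move (gap_move h)).
Proof.
elim=> [m|f1 h1 f2 h2 _ e1 _ e2]; first exact: (paired_pow m.+1).
by rewrite op_any_sub !gap_move_sub; apply: paired_sub.
Qed.

(** The two recursions agree after the second is multiplied by a power of [gap_move]: the
    b-th polynomial in J^2 is J^b U_b(J). *)
Lemma paired_valley b f h : paired f h -> paired (op_valley step213 b f) (iter b gap_move (gap_valley b h)).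
Proof.
move=> e; suff [] : paired (op_valley step213 b f) (iter b gap_move (gap_valley b h)) /\
  paired (op_valley step213 b.+1 f) (iter b.+1 gap_move (gap_valley b.+1 h)) by [].
elim: b => [|b [h1 h2]]; first by split=> //; rewrite S213_1 gap_valley1; apply: paired_step.
split=> //; rewrite S213_rec gap_valley_rec.
have iter_sub N (g g' : nat -> int) : iter N gap_move (fun x => g x - g' x) = fun x => iter N gap_move g x - iter N gap_move g' x.
  by elim: N => //= N ->; rewrite gap_move_sub.
rewrite iter_sub; apply: paired_sub; last exact: paired_step.
by rewrite -iterSr; apply: (paired_step h2).
Qed.

(** By [paired_valley] a block of length y contributes y powers of [gap_move] beyond its two-row
    block, except that the first block, which has one step less, contributes one power less;
    [paired_pow] starts with two powers. This makes n + 1 in total. *)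
Lemma step213_gap x a : all (leq 1) (x :: a) ->
  op_valley step213 x.-1 (op_blocks step213 a (fun=> 1)) 0%N =
  gap_count (x :: a) (iter (sumn (x :: a)).+1 gap_move gap0).
Proof.
case/andP=> hx ha.
have hiter N b g : gap_valley b (iter N gap_move g) = iter N gap_move (gap_valley b g).
  by elim: N => //= N IH; rewrite gap_valley_move IH.
have hP : paired (op_blocks step213 a (fun=> 1)) (iter (sumn a) gap_move (gap_blocks a (gap_move (gap_move gap0)))).
  elim: a ha => [_|y a IH /= /andP[hy ha]]; first exact: (paired_pow 0).
  have := paired_step (paired_valley y.-1 (IH ha)).
  set g := gap_blocks a _; rewrite hiter.
  rewrite -[gap_move (gap_move _)]/(iter y.-1.+2 gap_move (iter (sumn a) gap_move (gap_valley y.-1 g))) -iterD.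
  have -> : (y.-1.+2 + sumn a = (y + sumn a).+1)%N by lia.
  by rewrite iterSr.
have := paired_eval (paired_valley x.-1 hP); rewrite hiter -iterD => ->.
rewrite /gap_count; have -> : (x.-1 + sumn a = (sumn (x :: a)).-1)%N by rewrite /=; lia.
rewrite -hiter; congr (gap_valley _ _ _).
have hPi N g : iter N gap_move (gap_blocks a g) = gap_blocks a (iter N gap_move g).
  by elim: N => //= N ->; rewrite gap_blocks_move.
have -> : (sumn (x :: a)).+1 = (sumn (x :: a)).-1.+2 by rewrite /=; lia.
by rewrite hPi !iterSr.
Qed.
(** Values at the states with last entry the minimum (ft) and with another last entry (ff). *)
Definition rep123 (F : nat * bool -> int) (ft ff : nat -> int) : Prop :=
  forall x, F (x.+1, true) = ft x /\ F (x.+1, false) = ff x.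

Lemma op123E d F c fl : op step123 d F (c, fl) =
  (if d then F (c.+1, true) else 0) +
  (if d != fl then \sum_(i <- iota 0 c) F (i.+1, false) else 0).
Proof.
have h : \sum_(y <- [seq (v, false) | v <- iota 1 c]) F y = \sum_(i <- iota 0 c) F (i.+1, false).
  by rewrite big_map [LHS]sum_shift; apply: eq_bigr => i _; rewrite add1n.
rewrite /op /step123; case: fl; case: d => /=; rewrite ?big_seq1 ?big_nil ?addr0 ?add0r //.
by rewrite big_cons h.
Qed.

Lemma rep123_D F ft ff : rep123 F ft ff ->
  rep123 (op step123 true F) (U213 ft) (fun x => U213 ft x + D213 ff x).
Proof.
move=> h x; rewrite !op123E U213E /= addr0; have [-> _] := h x.+1.
by split=> //; congr (_ + _); apply: eq_bigr => i _; case: (h i).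
Qed.

Lemma rep123_A F ft ff : rep123 F ft ff ->
  rep123 (op step123 false F) (D213 ff) (fun=> 0).
Proof.
move=> h x; rewrite !op123E /= !add0r; split=> //.
by apply: eq_bigr => i _; case: (h i).
Qed.

Lemma rep123_add F ft ff G gt gf : rep123 F ft ff -> rep123 G gt gf ->
  rep123 (fun s => F s + G s) (fun x => ft x + gt x) (fun x => ff x + gf x).
Proof. by move=> h h' x; have [-> ->] := h x; have [-> ->] := h' x. Qed.

Lemma op0 St (step : bool -> St -> seq St) d : op step d (fun=> 0) = fun=> 0.
Proof. by apply: functional_extensionality => x; rewrite /op big1. Qed.

(** Inside a block the two values differ, but the combination that enters the next block is
    the one of the 213-avoiders. *)
Lemma rep123_S b F f : rep123 F f f ->
  rep123 (op_valley step123 b.+1 F) (iter b U213 (T213 f)) (op_valley step213 b (T213 f)).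
Proof.
move=> h; elim: b => [|b IH].
  have := rep123_add (rep123_A h) (rep123_D h); congr rep123.
  by apply: functional_extensionality => x; rewrite add0r /op_any addrC.
have hA0 : rep123 (iter b.+2 (op step123 false) F) (fun=> 0) (fun=> 0).
  elim: b {IH} => [|b IH]; last by have := rep123_A IH; rewrite op0.
  by have := rep123_A (rep123_A h); rewrite op0.
have := rep123_add hA0 (rep123_D IH); congr rep123; apply: functional_extensionality => x;
by rewrite add0r.
Qed.

Lemma rep123_B a F f : rep123 F f f -> rep123 (op_blocks step123 a F) (op_blocks step213 a f) (op_blocks step213 a f).
Proof.
move=> h; elim: a => [|x a IH] //=.
have hT G gt gf : rep123 G gt gf -> rep123 (op_any step123 G) (fun x => D213 gf x + U213 gt x) (fun x => D213 gf x + U213 gt x).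
  move=> hG; have := rep123_add (rep123_D hG) (rep123_A hG); congr rep123; apply: functional_extensionality => y.
    by rewrite addrC.
  by rewrite addr0 addrC.
rewrite S213_T; case: x.-1 => [|b]; first exact: hT IH.
have := hT _ _ _ (rep123_S b IH); congr rep123;
by apply: functional_extensionality => y; rewrite op_valley_recl addrC.
Qed.

(** From the last value 0 there is a single descent at each moment, so the valley of length b
    is determined by the number of its ascents. *)
Lemma S213_at0 b f : op_valley step213 b f 0%N = D213 f b.
Proof.
have hU n g : iter n U213 g 0%N = g n.
  suff h m : iter n U213 g m = g (n + m)%N by rewrite h addn0.
  by elim: n m => //= n IH m; rewrite U213E IH addnS.
elim: b => [|b IH]; first by rewrite D2130.
by rewrite op_valley_recl hU D2130 IH D213S addrC.
Qed.

(** The automaton of 123 has the same transfer operators as that of 213, with the order of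
    the factors of a block reversed; the factors commute by [S213_T]. *)
Lemma perm_count_123_213 a : all (leq 1) a -> a != [::] -> perm_count [:: w123] a = perm_count [:: w213] a.
Proof.
case: a => // x a ha _; rewrite perm_count_123 // perm_count_213 //.
have := @rep123_B a (fun=> 1) (fun=> 1) (fun _ => conj erefl erefl).
set F := op_blocks step123 _ _; set f := op_blocks step213 _ _ => h.
case: x.-1 => [|b]; first by case: (h 0%N).
have [-> _] := rep123_S b h 0%N; rewrite S213_at0.
have hU n g : iter n U213 g 0%N = g n.
  suff h' m : iter n U213 g m = g (n + m)%N by rewrite h' addn0.
  by elim: n m => //= n IH m; rewrite U213E IH addnS.
by rewrite hU T213E D213S.
Qed.

Lemma perm_count_list2 a : all (leq 1) a -> a != [::] ->
  perm_count [:: w213] a = gap_count a (iter (sumn a).+1 gap_move gap0).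
Proof. by case: a => // x a ha _; rewrite perm_count_213 // step213_gap. Qed.

(** * Counting the classes with finite automata *)

Definition list3N (a : seq nat) : int := 2 ^+ (size a).-1 * (\prod_(x <- a) x)%:R.

Section ConstOps.
Variables (St : Type) (step : bool -> St -> seq St).
(** If both steps are always possible in one way, there are b + 1 valleys of b steps. *)
Lemma op_valley_const c b : (forall d, op step d (fun=> c) = fun=> c) ->
  op_valley step b (fun=> c) = fun=> b.+1%:R * c.
Proof.
move=> h; have hi k : iter k (op step false) (fun=> c) = fun=> c by elim: k => //= k ->; rewrite h.
elim: b => [|b IH]; first by apply: functional_extensionality => x; rewrite mul1r.
have hs : op step true (fun=> b.+1%:R * c) = fun=> b.+1%:R * c.
  by apply: functional_extensionality => x; have := op_scale step true b.+1%:R (fun=> c); rewrite h => ->.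
rewrite op_valley_recl hi IH hs; apply: functional_extensionality => x.
by rewrite -[b.+2]add1n natrD mulrDl mul1r.
Qed.
End ConstOps.

Lemma step_flags_free x a : all (leq 1) (x :: a) -> 
  op_valley (step_flags (fun _ _ => false) (fun _ _ => false)) x.-1
   (op_blocks (step_flags (fun _ _ => false) (fun _ _ => false)) a (fun=> 1)) (false, false) = list3N (x :: a).
Proof.
have hc d c : op (step_flags (fun _ _ => false) (fun _ _ => false)) d (fun=> c) = fun=> c.
  by apply: functional_extensionality => s; rewrite /op /step_flags; case: d; rewrite big_seq1.
case/andP=> hx ha.
have -> : op_blocks (step_flags (fun _ _ => false) (fun _ _ => false)) a (fun=> 1) =
    fun=> 2 ^+ (size a) * (\prod_(x <- a) x)%:R.
  elim: a ha => [_|y a IH /= /andP[hy ha]]; first by rewrite big_nil mulr1.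
  rewrite IH // op_valley_const // /op_any !hc prednK // big_cons natrM exprS.
  by apply: functional_extensionality => s; ring.
by rewrite op_valley_const // prednK // /list3N big_cons natrM /=; ring.
Qed.

Lemma perm_count_132_312 a : all (leq 1) a -> a != [::] -> perm_count [:: w132; w312] a = list3N a.
Proof.
case: a => // x a ha _; rewrite perm_count_minmax // -?step_flags_free //.
by move=> t; rewrite !inE => /orP[]/eqP->.
Qed.

Lemma perm_count_132_213 a : all (leq 1) a -> a != [::] -> perm_count [:: w132; w213] a = list3N a.
Proof.
case: a => // x a ha _; rewrite perm_count_layered // -?step_flags_free //.
by move=> t; rewrite !inE => /orP[]/eqP->.
Qed.

(** An ascent is possible only directly after descents, so a valley has at most one ascent. *)
Lemma perm_count_123_132_list3 a : all (leq 1) a -> a != [::] -> perm_count [:: w123; w132] a = list3N a.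
Proof.
case: a => // x a /andP[hx ha] _; rewrite perm_count_123_132 /= ?hx //.
have hA f y : op step123_132 false f y = y%:R * f 0%N.
  by rewrite /op /step123_132 big_map big_const_seq count_predT size_iota iter_addr_0 mulr_natl.
have hD f y : op step123_132 true f y = f y.+1 by rewrite /op big_seq1.
have hi b f y : iter b.+2 (op step123_132 false) f y = 0 by rewrite 2!iterS !hA mul0r mulr0.
have hS b f y : op_valley step123_132 b.+1 f y = f (y + b.+1)%N + (y + b)%:R * f 0%N.
  elim: b y => [|b IH] y; first by rewrite op_valley_recl /= hA hD addn0 addn1 addrC.
  by rewrite op_valley_recl hi add0r hD IH !addnS !addSn.
have hB c b : (0 < b)%N -> op_any step123_132 (op_valley step123_132 b.-1 (fun y => c * y.+1%:R)) = fun y => 2 * b%:R * c * y.+1%:R.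
  case: b => // -[|b] _; apply: functional_extensionality => y; rewrite /op_any hA hD ?hS /=.
    rewrite ?(=^~ natr1, natrD); ring.
  rewrite ?hS ?(=^~ natr1, natrD); ring.
case: a ha => [_|z a ha].
  rewrite /list3N big_seq1 /= expr0 mul1r; case: x hx => // -[|b] _; first by [].
  by rewrite (hS b) mulr1 ?(=^~ natr1, natrD); ring.
have -> : op_blocks step123_132 (z :: a) (fun=> 1) = fun y => 2 ^+ (size a) * (\prod_(x <- z :: a) x)%:R * y.+1%:R.
  elim: a z ha => [|w a IH] z /andP[hz ha].
    rewrite /= big_seq1; apply: functional_extensionality => y.
    case: z hz => // -[|b] _; rewrite /op_any hA hD ?hS /=.
      by rewrite ?(=^~ natr1, natrD); ring.
    by rewrite ?hS ?(=^~ natr1, natrD); ring.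
  rewrite -[op_blocks _ _ _]/(op_any step123_132 (op_valley step123_132 z.-1 (op_blocks step123_132 (w :: a) (fun=> 1)))) IH // hB //.
  have e : (\prod_(x0 <- [:: z, w & a]) x0 = z * \prod_(x0 <- w :: a) x0)%N by rewrite big_cons.
  by apply: functional_extensionality => y; rewrite e natrM [size _]/= exprS; ring.
set p := (\prod_(x0 <- z :: a) x0)%N.
have -> : list3N [:: x, z & a] = 2 * 2 ^+ size a * (x%:R * p%:R).
  by rewrite /list3N big_cons natrM -exprS.
case: x hx => // -[|b] _; first by rewrite /=; ring.
by rewrite (hS b) ?(=^~ natr1, natrD); ring.
Qed.
Definition list5N (a : seq nat) : int := \sum_(x <- a) (minn x 2)%:R.

Definition pair_add (p r : int * int) : int * int := (p.1 + r.1, p.2 + r.2).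

(** The effect of [op_valley] on a function with two values, p.1 where q is false and p.2
    where q is true. *)
Fixpoint pair_valley (pD pA : int * int -> int * int) b p : int * int :=
  if b is b'.+1 then pair_add (iter b pA p) (pD (pair_valley pD pA b' p)) else p.

(** The relevant functions take two values, according to a flag q that steps can switch on but not
    off. Steps may be banned in different ways, but a valley of at least one step always has
    the same effect, and so have the blocks. *)
Section TwoState.
Variables (St : Type) (step : bool -> St -> seq St) (q : St -> bool).
Variables (pD pA : int * int -> int * int).
Let rep (F : St -> int) (p : int * int) := forall s, F s = if q s then p.2 else p.1.
Hypothesis repD : forall F p, rep F p -> rep (op step true F) (pD p).
Hypothesis repA : forall F p, rep F p -> rep (op step false F) (pA p).
Hypothesis pSE : forall b p, pair_valley pD pA b.+1 p = (p.1 + p.2, p.2).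

Lemma two_state_add F p G r : rep F p -> rep G r -> rep (fun s => F s + G s) (pair_add p r).
Proof. by move=> h h' s; rewrite h h'; case: (q s). Qed.

Lemma two_state_S b F p : rep F p -> rep (op_valley step b F) (p.1 + (0 < b)%:R * p.2, p.2).
Proof.
move=> h; have hA n : rep (iter n (op step false) F) (iter n pA p) by elim: n => //= n /repA.
have : rep (op_valley step b F) (pair_valley pD pA b p).
  by elim: b => [|b IH] //; apply: two_state_add (hA b.+1) (repD IH).
case: b => [|b]; last by rewrite pSE mul1r.
by rewrite /= mul0r addr0; case: (p).
Qed.

Lemma two_state_T F p : rep F p -> rep (op_any step F) (p.1 + p.2, p.2).
Proof.
by move=> h; have := two_state_add (repA h) (repD h); rewrite -[pair_add _ _]/(pair_valley pD pA 1 p) pSE => h' s; rewrite /op_any addrC h'.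
Qed.

Lemma two_state_list5 x a s0 : all (leq 1) (x :: a) -> ~~ q s0 ->
  op_valley step x.-1 (op_blocks step a (fun=> 1)) s0 = list5N (x :: a).
Proof.
case/andP=> hx ha hq.
have hB : rep (op_blocks step a (fun=> 1)) (1 + list5N a, 1).
  elim: a ha => [_|y a IH /= /andP[hy ha]]; first by move=> s; rewrite /list5N big_nil addr0 if_same.
  have := two_state_T (two_state_S y.-1 (IH ha)); rewrite /fst /snd mulr1.
  have -> // : 1 + list5N a + (0 < y.-1)%:R + 1 = 1 + list5N (y :: a).
  rewrite /list5N big_cons; case: y hy => [//|[|y]] _ /=.
    by rewrite (_ : minn 1 2 = 1%N) //; ring.
  by rewrite (_ : minn y.+2 2 = 2%N) //; ring.
have := two_state_S x.-1 hB; move=> /(_ s0) ->; rewrite (negbTE hq) /fst /snd mulr1 /list5N big_cons.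
case: x hx => [//|[|x]] _ /=.
  by rewrite (_ : minn 1 2 = 1%N) //; ring.
by rewrite (_ : minn x.+2 2 = 2%N) //; ring.
Qed.
End TwoState.

Lemma op_step_flagsE bA bD d F s : op (step_flags bA bD) d F s =
  if d then (if bD s.1 s.2 then 0 else F (s.1, true)) else (if bA s.1 s.2 then 0 else F (true, s.2)).
Proof. by rewrite /op /step_flags; case: d; case: ifP => _; rewrite ?big_seq1 ?big_nil. Qed.

(** At most one ascent in all, after which only descents are possible. *)
Lemma step_flags_oneA x a : all (leq 1) (x :: a) ->
  op_valley (step_flags (fun hA _ => hA) (fun _ _ => false)) x.-1
   (op_blocks (step_flags (fun hA _ => hA) (fun _ _ => false)) a (fun=> 1)) (false, false) = list5N (x :: a).
Proof.
move=> hxa; apply: (@two_state_list5 _ _ fst id (fun p => (p.2, 0))) => //.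
- by move=> F p h s; rewrite op_step_flagsE /= h.
- by move=> F p h s; rewrite op_step_flagsE /=; case: (s.1) => //; rewrite h.
move=> b [f0 f1]; elim: b => [|b IH]; first by rewrite /= /pair_add /= add0r addrC.
rewrite -[pair_valley _ _ _ _]/(pair_add (iter b.+2 (fun p => (p.2, 0)) (f0, f1)) (pair_valley id (fun p : int * int => (p.2, 0)) b.+1 (f0, f1))).
rewrite IH.
have -> : iter b.+2 (fun p : int * int => (p.2, 0 : int)) (f0, f1) = (0, 0) by elim: b {IH} => //= b ->.
by rewrite /pair_add !add0r.
Qed.

(** At most one descent in all, after which only ascents are possible. *)
Lemma step_flags_oneD x a : all (leq 1) (x :: a) ->
  op_valley (step_flags (fun _ _ => false) (fun _ hD => hD)) x.-1
   (op_blocks (step_flags (fun _ _ => false) (fun _ hD => hD)) a (fun=> 1)) (false, false) = list5N (x :: a).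
Proof.
move=> hxa; apply: (@two_state_list5 _ _ snd (fun p => (p.2, 0)) id) => //.
- by move=> F p h s; rewrite op_step_flagsE /=; case: (s.2) => //; rewrite h.
- by move=> F p h s; rewrite op_step_flagsE /= h.
move=> b [f0 f1]; elim: b => [|b IH]; first by rewrite /= /pair_add /= addr0.
rewrite -[pair_valley _ _ _ _]/(pair_add (iter b.+2 id (f0, f1)) ((pair_valley (fun p : int * int => (p.2, 0)) id b.+1 (f0, f1)).2, 0)).
rewrite IH.
have -> : iter b.+2 id (f0, f1) = (f0, f1) by elim: b {IH} => //= b ->.
by rewrite /pair_add /= addr0.
Qed.

(** Ascents are possible only before the first descent. *)
Lemma step_flags_AD x a : all (leq 1) (x :: a) ->
  op_valley (step_flags (fun _ hD => hD) (fun _ _ => false)) x.-1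
   (op_blocks (step_flags (fun _ hD => hD) (fun _ _ => false)) a (fun=> 1)) (false, false) = list5N (x :: a).
Proof.
move=> hxa; apply: (@two_state_list5 _ _ snd (fun p => (p.2, p.2)) (fun p => (p.1, 0))) => //.
- by move=> F p h s; rewrite op_step_flagsE /= h /=; case: (s.2).
- by move=> F p h s; rewrite op_step_flagsE /=; case e: (s.2) => //; rewrite h /= e.
move=> b [f0 f1]; elim: b => [|b IH]; first by rewrite /= /pair_add /= add0r.
rewrite -[pair_valley _ _ _ _]/(pair_add (iter b.+2 (fun p => (p.1, 0)) (f0, f1)) ((pair_valley (fun p : int * int => (p.2, p.2)) (fun p : int * int => (p.1, 0)) b.+1 (f0, f1)).2, (pair_valley (fun p : int * int => (p.2, p.2)) (fun p : int * int => (p.1, 0)) b.+1 (f0, f1)).2)).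
rewrite IH.
have -> : iter b.+2 (fun p : int * int => (p.1, 0 : int)) (f0, f1) = (f0, 0) by elim: b {IH} => //= b ->.
by rewrite /pair_add /= add0r.
Qed.

Lemma perm_count_minmax_step P x a bA bD : {subset P <= all6} -> w132 \in P -> w312 \in P ->
  (forall hA hD, (w123 \in P) && hA || (w213 \in P) && hD = bA hA hD) ->
  (forall hA hD, (w231 \in P) && hA || (w321 \in P) && hD = bD hA hD) ->
  all (leq 1) (x :: a) ->
  perm_count P (x :: a) = op_valley (step_flags bA bD) x.-1 (op_blocks (step_flags bA bD) a (fun=> 1)) (false, false).
Proof.
move=> hP h1 h2 eA eD hxa; rewrite perm_count_minmax //.
have fe (f g : bool -> bool -> bool) : (forall x y, f x y = g x y) -> f = g.
  by move=> e; apply: functional_extensionality => u; apply: functional_extensionality => v; apply: e.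
by rewrite (fe _ bA eA) (fe _ bD eD).
Qed.

Lemma sub_all6 P : all (fun t => t \in all6) P -> {subset P <= all6}.
Proof. by move/allP. Qed.

Lemma perm_count_list5 a : all (leq 1) a -> a != [::] ->
  [/\ perm_count [:: w123; w132; w312] a = list5N a, perm_count [:: w132; w312; w321] a = list5N a,
      perm_count [:: w132; w213; w321] a = list5N a & perm_count [:: w132; w213; w312] a = list5N a].
Proof.
case: a => // x a hxa _; split.
- rewrite (@perm_count_minmax_step _ _ _ (fun hA _ => hA) (fun _ _ => false)) ?step_flags_oneA //.
  + exact: sub_all6.
  + by case; case.
- rewrite (@perm_count_minmax_step _ _ _ (fun _ _ => false) (fun _ hD => hD)) ?step_flags_oneD //.
  exact: sub_all6.
- by rewrite perm_count_layered // -?step_flags_oneD.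
- rewrite (@perm_count_minmax_step _ _ _ (fun _ hD => hD) (fun _ _ => false)) ?step_flags_AD //.
  exact: sub_all6.
Qed.

(** * Classes without peaks *)

(** A peak is an occurrence of 132 or of 231, so all blocks are valleys. *)
Lemma class_valleys (P : seq (seq nat)) n (s a : seq nat) : w132 \in P -> w231 \in P -> s \in level (perm_children P) [::] n ->
  all (leq 1) a -> n = sumn a -> valleys a (des_bits s).
Proof.
move=> h1 h2 hs ha hn; have hp := level_isperm hs; have hsz := isperm_size hp.
apply/valleysP => //; first by rewrite size_des_bits hsz.
move=> i; rewrite size_des_bits => hi; rewrite !nth_des_bits; try lia.
have -> : (0 < i)%N by lia.
have -> /= : (0 < i.-1)%N by lia.
move=> d1 d2; exfalso; rewrite hsz in hi.
have ne1 : nth 0%N s i.-2 != nth 0%N s i.-1 by rewrite nth_uniq ?(isperm_uniq hp) ?hsz //; lia.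
have hav t : t \in P -> same_order t (nth 0%N s i.-2) (nth 0%N s i.-1) (nth 0%N s i) -> False.
  move=> ht ho; move: hs; rewrite mem_level => /andP[_ /allP /(_ t ht) /negP]; apply.
  by apply/containswP; exists i.-2, i.-1, i; split=> //; lia.
have ne : nth 0%N s i.-2 != nth 0%N s i by rewrite nth_uniq ?(isperm_uniq hp) ?hsz //; lia.
case: (ltngtP (nth 0%N s i.-2) (nth 0%N s i)) ne => // h _.
  by apply: (hav _ h1); rewrite /same_order /=; lia.
by apply: (hav _ h2); rewrite /same_order /=; lia.
Qed.

(** The count only depends on the size, and blocks of length 1 compute it. *)
Lemma perm_count_valley P a : w132 \in P -> w231 \in P -> all (leq 1) a ->
  perm_count P a = perm_count P (nseq (sumn a) 1%N).
Proof.
move=> h1 h2 ha; have e : sumn (nseq (sumn a) 1%N) = sumn a by rewrite sumn_nseq mul1n.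
rewrite /perm_count e big_seq [RHS]big_seq; apply: eq_bigr => s hs.
rewrite !(class_valleys h1 h2 hs) ?e //.
by elim: (sumn a).
Qed.

Lemma op_blocks_nseq St (step : bool -> St -> seq St) n f : op_blocks step (nseq n 1%N) f = iter n (op_any step) f.
Proof. by elim: n => //= n ->. Qed.

Lemma step_flags_any bA bD f hA hD : op_any (step_flags bA bD) f (hA, hD) =
  (if bD hA hD then 0 else f (hA, true)) + (if bA hA hD then 0 else f (true, hD)).
Proof. by rewrite /op_any !op_step_flagsE. Qed.

Lemma perm_count_valley_step P a bA bD : {subset P <= all6} -> w132 \in P -> w312 \in P -> w231 \in P ->
  (forall hA hD, (w123 \in P) && hA || (w213 \in P) && hD = bA hA hD) ->
  (forall hA hD, (w231 \in P) && hA || (w321 \in P) && hD = bD hA hD) ->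
  all (leq 1) a -> a != [::] ->
  perm_count P a = iter (sumn a).-1 (op_any (step_flags bA bD)) (fun=> 1) (false, false).
Proof.
move=> hP h1 h2 h3 eA eD ha an; rewrite perm_count_valley //.
have : (0 < sumn a)%N by case: a ha an => //= x a /andP[]; lia.
case: (sumn a) => // n _; rewrite (@perm_count_minmax_step _ _ _ bA bD) //; last by rewrite /= all_nseq orbT.
by rewrite op_blocks_nseq.
Qed.

(** Powers of the transfer operator of a finite automaton that stabilizes after at most two
    steps, or grows linearly in the first case. *)
Lemma perm_count_constants a : all (leq 1) a -> (2 < sumn a)%N ->
  [/\ perm_count [:: w132; w231; w312] a = (sumn a)%:R,
      perm_count [:: w123; w132; w231; w312] a = 2,
      perm_count [:: w132; w231; w312; w321] a = 2,
      perm_count [:: w132; w213; w231; w312] a = 2 &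
      perm_count [:: w123; w132; w213; w231; w312] a = 1].
Proof.
move=> ha hn; have an : a != [::] by case: a hn {ha}.
have [m em] : exists m, (sumn a).-1 = m.+2 by exists (sumn a - 3)%N; lia.
split.
- rewrite (@perm_count_valley_step _ _ (fun _ _ => false) (fun hA _ => hA)) //; last 2 first.
  + exact: sub_all6.
  + by case; case.
  have h k : iter k (op_any (step_flags (fun _ _ => false) (fun hA _ => hA))) (fun=> 1) =
    fun s => if s.1 then 1 else k.+1%:R.
    elim: k => [|k IH]; first by apply: functional_extensionality => s; rewrite if_same.
    apply: functional_extensionality => -[hA hD]; rewrite iterS step_flags_any IH /=.
    by case: hA; rewrite ?add0r // natr1.
  by rewrite h /= prednK //; lia.
- rewrite (@perm_count_valley_step _ _ (fun hA _ => hA) (fun hA _ => hA)) //; last 3 first.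
  + exact: sub_all6.
  + by case; case.
  + by case; case.
  have h k : iter k.+1 (op_any (step_flags (fun hA _ => hA) (fun hA _ => hA))) (fun=> 1) =
    fun s => if s.1 then 0 else 2.
    elim: k => [|k IH]; apply: functional_extensionality => -[hA hD]; rewrite iterS step_flags_any ?IH /=; by case: hA.
  by rewrite em h.
- rewrite (@perm_count_valley_step _ _ (fun _ _ => false) (fun hA hD => hA || hD)) //; last first.
  + exact: sub_all6.
  have h k : iter k.+1 (op_any (step_flags (fun _ _ => false) (fun hA hD => hA || hD))) (fun=> 1) =
    fun s => if s.1 || s.2 then 1 else 2.
    elim: k => [|k IH]; apply: functional_extensionality => -[hA hD]; rewrite iterS step_flags_any ?IH /=; by case: hA; case: hD.
  by rewrite em h.
- rewrite (@perm_count_valley_step _ _ (fun _ hD => hD) (fun hA _ => hA)) //; last 2 first.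
  + exact: sub_all6.
  + by case; case.
  have h k : iter k.+1 (op_any (step_flags (fun _ hD => hD) (fun hA _ => hA))) (fun=> 1) =
    fun s => if s.1 then (if s.2 then 0 else 1) else (if s.2 then 1 else 2).
    elim: k => [|k IH]; apply: functional_extensionality => -[hA hD]; rewrite iterS step_flags_any ?IH /=; by case: hA; case: hD.
  by rewrite em h.
rewrite (@perm_count_valley_step _ _ (fun hA hD => hA || hD) (fun hA _ => hA)) //; last 2 first.
- exact: sub_all6.
- by case; case.
have h k : iter k.+2 (op_any (step_flags (fun hA hD => hA || hD) (fun hA _ => hA))) (fun=> 1) =
    fun s => if s.1 then 0 else 1.
  elim: k => [|k IH]; apply: functional_extensionality => -[hA hD]; last by rewrite iterS step_flags_any ?IH /=; case: hA; case: hD.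
  by rewrite !iterS; case: hA; case: hD; rewrite !step_flags_any /= ?step_flags_any.
by rewrite em h.
Qed.

Lemma op_any132_231 f x : op_any step132_231 f x =
  (if x.1 then 0 else f (false, x.2.+1)) + \sum_(i <- iota 0 x.2) f (true, x.2 - i)%N.
Proof.
rewrite /op_any /op /step132_231 big_map; congr (_ + _).
by case: (x.1); rewrite ?big_nil ?big_seq1.
Qed.

Lemma sum_down (f : nat -> int) e :
  \sum_(i <- iota 0 e.+1) f (e.+1 - i)%N = f e.+1 + \sum_(i <- iota 0 e) f (e - i)%N.
Proof.
rewrite -[iota 0 e.+1]/(0%N :: iota 1 e) big_cons subn0 [X in _ + X = _]sum_shift; congr (_ + _).
Qed.

(** Binomial numbers of weakly decreasing choices of the number of positions above the
    last entry. *)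
Lemma iter132_231_true m e : iter m (op_any step132_231) (fun=> 1) (true, e.+1) = 'C(e + m, m)%:R.
Proof.
elim: m e => [|m IH] e; first by rewrite bin0.
have h k : \sum_(i <- iota 0 k.+1) iter m (op_any step132_231) (fun=> 1) (true, k.+1 - i)%N = 'C(k + m.+1, m.+1)%:R.
  elim: k => [|k IHk]; first by rewrite big_seq1 subn0 IH add0n !add0n !binn.
  rewrite (sum_down (fun i => iter m (op_any step132_231) (fun=> 1) (true, i))) IHk IH.
  by rewrite addSnnS [(k.+1 + m.+1)%N]addSn binS natrD addrC.
by rewrite iterS op_any132_231 /= add0r h.
Qed.

Lemma iter132_231_false m k : iter m (op_any step132_231) (fun=> 1) (false, k.+1) = \sum_(0 <= i < m.+1) 'C(k + m, i)%:R.
Proof.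
elim: m k => [|m IH] k; first by rewrite big_nat1 bin0.
rewrite iterS op_any132_231 /= IH [RHS]big_nat_recr //= addSnnS; congr (_ + _).
have := iter132_231_true m.+1 k; rewrite iterS op_any132_231 /= add0r => ->.
by [].
Qed.

(** A permutation without peaks is determined by the set of entries before the minimum. *)
Lemma perm_count_list4 a : all (leq 1) a -> a != [::] -> perm_count [:: w132; w231] a = 2 ^+ (sumn a).-1.
Proof.
move=> ha an; rewrite perm_count_valley //.
have : (0 < sumn a)%N by case: a ha an => //= x a /andP[]; lia.
case: (sumn a) => // n _; rewrite perm_count_132_231; last by rewrite /= all_nseq orbT.
rewrite op_blocks_nseq [op_valley _ _ _]/= iter132_231_false add0n big_mkord -natr_sum.
have e : (2 ^ n = \sum_(i < n.+1) 'C(n, i))%N.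
  by rewrite (expnDn 1 1 n); apply: eq_bigr => i _; rewrite !exp1n !muln1.
by rewrite [n.+1.-1]/= -natrX e.
Qed.

Lemma perm_count_list6 a : all (leq 1) a -> (1 < sumn a)%N -> perm_count [:: w123; w132; w231] a = (sumn a)%:R.
Proof.
move=> ha hn; rewrite perm_count_valley //; case: (sumn a) hn => // -[|n] // _.
rewrite perm_count_123_132_231; last by rewrite /= all_nseq orbT.
rewrite -[_ :: _]/(nseq n.+1 1%N) op_blocks_nseq [op_valley _ _ _]/=.
have hT f x : op_any step123_132_231 f x = if x.1 then 0 else f (false, x.2.+1) + x.2%:R * f (true, 0%N).
  rewrite /op_any /op /step123_132_231; case: (x.1); rewrite ?big_nil ?addr0 // big_seq1 big_map.
  by rewrite big_const_seq count_predT size_iota iter_addr_0 mulr_natl.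
have h1 m k : iter m.+1 (op_any step123_132_231) (fun=> 1) (true, k) = 0 by rewrite iterS hT.
suff h m k : iter m.+1 (op_any step123_132_231) (fun=> 1) (false, k) = (k + m.+1)%:R by rewrite -[LHS]/(iter n.+1 (op_any step123_132_231) (fun=> 1) (false, 1%N)) h add1n.
elim: m k => [|m IH] k; first by rewrite iterS hT /= mulr1 addn1 -natr1 addrC.
rewrite iterS hT; rewrite -[(false, k).1]/false -[(false, k).2]/k.
by rewrite IH h1 mulr0 addr0 addSnnS.
Qed.

(** * Reversal *)

Lemma isperm_rev n (s : seq nat) : isperm n (rev s) = isperm n s.
Proof. by rewrite /isperm size_rev rev_uniq all_rev. Qed.

Lemma nth_neq (s : seq nat) i j : uniq s -> (i < j)%N -> (j < size s)%N -> nth 0%N s i != nth 0%N s j.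
Proof.
move=> hu hij hj; rewrite nth_uniq ?neq_ltn ?hij //; exact: ltn_trans hj.
Qed.

Lemma containsw_rev (t s : seq nat) : size t = 3 -> uniq t -> uniq s -> containsw (rev t) (rev s) = containsw t s.
Proof.
suff h (t' s' : seq nat) : size t' = 3 -> uniq t' -> uniq s' -> containsw t' s' -> containsw (rev t') (rev s').
  move=> ht hut hus; apply/idP/idP; last exact: h.
  by move/h; rewrite !revK size_rev !rev_uniq => /(_ ht hut hus).
move=> ht hut hus /containswP[i [j [k [h1 h2 h3 h4]]]]; apply/containswP.
exists (size s' - k.+1)%N, (size s' - j.+1)%N, (size s' - i.+1)%N; rewrite size_rev.
split; [lia|lia|lia|].
have e m : (m < size s')%N -> nth 0%N (rev s') (size s' - m.+1) = nth 0%N s' m.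
  by move=> hm; rewrite nth_rev; [congr nth; lia|lia].
rewrite !e; try lia.
have d (u v : nat) : u != v -> (u < v)%N = ~~ (v < u)%N by lia.
have n12 : nth 0%N s' i != nth 0%N s' j by apply: nth_neq => //; lia.
have n13 : nth 0%N s' i != nth 0%N s' k by apply: nth_neq => //; lia.
have n23 : nth 0%N s' j != nth 0%N s' k by apply: nth_neq => //; lia.
move: h4; case: t' ht hut => [|t0 [|t1 [|t2 []]]] // _; rewrite /= !inE negb_or => /and3P[/andP[m1 m2] m3 _].
by rewrite /same_order /rev /=; lia.
Qed.

Lemma des_bits_rev (s : seq nat) i : uniq s -> (0 < i < size s)%N ->
  nth false (des_bits (rev s)) i = ~~ nth false (des_bits s) (size s - i).
Proof.
move=> hu hi; rewrite !nth_des_bits ?size_rev; try lia.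
rewrite !nth_rev; try lia.
have -> : (0 < i)%N by lia.
have -> /= : (0 < size s - i)%N by lia.
have -> : (size s - i.-1.+1 = size s - i)%N by lia.
have -> : ((size s - i).-1 = size s - i.+1)%N by lia.
have : nth 0%N s (size s - i.+1) != nth 0%N s (size s - i) by apply: nth_neq => //; lia.
by lia.
Qed.

Lemma in_cset_rev (a : seq nat) x : all (leq 1) a -> (x < sumn a)%N -> (x \in cset (rev a)) = (sumn a - x \in cset a)%N.
Proof.
suff h (b : seq nat) y : all (leq 1) b -> (y < sumn b)%N -> y \in cset (rev b) -> (sumn b - y)%N \in cset b.
  move=> ha hx; apply/idP/idP; first exact: h.
  move=> hs; have := cset_bound ha hs => hb.
  have := h (rev a) (sumn a - x)%N; rewrite all_rev revK sumn_rev => /(_ ha _ hs).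
  by rewrite subKn; [apply; lia|lia].
move=> hb hy /csetP[j [h0]]; rewrite size_rev => h1 e; apply/csetP.
exists (size b - j)%N; split; [lia|lia|].
have e1 : (sumn (take (size b - j) b) + sumn (drop (size b - j) b) = sumn b)%N.
  by rewrite -sumn_cat cat_take_drop.
have e2 : y = sumn (drop (size b - j) b) by rewrite e take_rev sumn_rev.
by lia.
Qed.

(** The reverse of a word that goes down and then up does so as well. *)
Lemma valleys_rev (a s : seq nat) : all (leq 1) a -> uniq s -> size s = sumn a ->
  valleys (rev a) (des_bits (rev s)) = valleys a (des_bits s).
Proof.
suff h (b u : seq nat) : all (leq 1) b -> uniq u -> size u = sumn b -> valleys b (des_bits u) -> valleys (rev b) (des_bits (rev u)).
  move=> ha hu hs; apply/idP/idP; last exact: h.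
  by move/h; rewrite !revK all_rev rev_uniq size_rev sumn_rev => /(_ ha hu hs).
move=> ha hu hs /(valleysP ha) h; apply/valleysP; rewrite ?all_rev // ?size_des_bits ?size_rev ?sumn_rev //.
move=> i hi; rewrite !des_bits_rev //; try lia.
move=> h1 h2; rewrite size_des_bits in h.
rewrite !in_cset_rev //; try lia.
have := h hs (size u - i).+1; rewrite -hs.
have e1 : (size u - i.-1 = (size u - i).+1)%N by lia.
rewrite e1 in h2 *; rewrite negbK in h2; rewrite h2 h1 orbC.
by apply; lia.
Qed.

Lemma perm_count_rev (P : seq (seq nat)) (a : seq nat) : all (fun t => (size t == 3) && uniq t) P -> all (leq 1) a ->
  perm_count (map rev P) a = perm_count P (rev a).
Proof.
move=> /allP hP ha; rewrite /perm_count sumn_rev.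
rewrite (perm_big [seq rev s | s <- level (perm_children P) [::] (sumn a)]) /=; last first.
  apply: uniq_perm; rewrite ?level_uniq ?map_inj_uniq ?level_uniq //; first exact: can_inj revK.
  move=> s; rewrite mem_level; apply/andP/mapP => [[hp hav]|[s' hs' ->]].
    exists (rev s); rewrite ?revK // mem_level isperm_rev hp /=.
    apply/allP => t ht; have /andP[/eqP h1 h2] := hP _ ht.
    rewrite -containsw_rev ?revK ?rev_uniq ?(isperm_uniq hp) //.
    by apply: (allP hav); apply: map_f.
  move: hs'; rewrite mem_level => /andP[hp hav]; rewrite isperm_rev; split=> //.
  apply/allP => _ /mapP[t ht ->]; have /andP[/eqP h1 h2] := hP _ ht.
  by rewrite containsw_rev ?(isperm_uniq hp) //; apply: (allP hav).
rewrite big_map big_seq [RHS]big_seq; apply: eq_bigr => s /level_isperm hp.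
rewrite -(@valleys_rev (rev a) s) ?revK ?all_rev ?(isperm_uniq hp) ?sumn_rev //.
exact: isperm_size hp.
Qed.

(** * Valleys as pairs of runs *)

Section Runs.
Variables (St : Type) (step : bool -> St -> seq St).
Local Notation op := (op step). Local Notation op_any := (op_any step). Local Notation op_valley := (op_valley step).
(** The letters of a decreasing run; the direction of the step into it is arbitrary. *)
Definition desc_run (i : nat) (f : St -> int) : St -> int :=
  if i is i'.+1 then op_any (iter i' (op true) f) else f.
Definition asc_run (j : nat) (f : St -> int) : St -> int :=
  if j is j'.+1 then op_any (iter j' (op false) f) else f.

Lemma op_addf d (f g : St -> int) : op d (f \+ g) = op d f \+ op d g.
Proof. by apply: functional_extensionality => x; rewrite /op /= -big_split. Qed.

Lemma op_any_add (f g : St -> int) : op_any (f \+ g) = op_any f \+ op_any g.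
Proof. by apply: functional_extensionality => x; rewrite /op_any !op_addf /= addrACA. Qed.

Lemma op_any_sum I (r : seq I) (F : I -> St -> int) x :
  op_any (fun y => \sum_(i <- r) F i y) x = \sum_(i <- r) op_any (F i) x.
Proof. by rewrite /op_any !op_sum -big_split. Qed.

Lemma iter_op_add d i (f g : St -> int) : iter i (op d) (f \+ g) = iter i (op d) f \+ iter i (op d) g.
Proof. by elim: i => //= i ->; rewrite op_addf. Qed.

Lemma op_valley_sum b (f : St -> int) :
  op_valley b f = fun x => \sum_(0 <= i < b.+1) iter i (op true) (iter (b - i) (op false) f) x.
Proof.
elim: b => [|b IH]; apply: functional_extensionality => x; first by rewrite big_nat1.
by rewrite big_nat_recl // subn0 -[LHS]/(iter b.+1 (op false) f x + op true (op_valley b f) x) IH op_sum.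
Qed.

(** Every valley of length b + 1 splits in exactly two ways into a descending run followed by
    an ascending run, since its minimum can be put in either of them. *)
Lemma two_op_valley b (f : St -> int) x :
  2 * op_any (op_valley b f) x = \sum_(0 <= i < b.+2) desc_run i (asc_run (b.+1 - i) f) x.
Proof.
pose h i := op_any (iter i (op true) (iter (b - i) (op false) f)) x.
have -> : op_any (op_valley b f) x = \sum_(0 <= i < b.+1) h i by rewrite op_valley_sum op_any_sum.
have hm i : (i < b)%N -> desc_run i.+1 (asc_run (b.+1 - i.+1) f) x = h i.+1 + h i.
  move=> hi; rewrite /h; have -> : (b - i = (b - i.+1).+1)%N by lia.
  rewrite subSS; have -> : (b - i = (b - i.+1).+1)%N by lia.
  rewrite /desc_run /asc_run.
  set g := iter (b - i.+1) _ f.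
  have -> : op_any g = op true g \+ op false g by [].
  by rewrite iter_op_add op_any_add -iterSr.
have -> : \sum_(0 <= i < b.+2) desc_run i (asc_run (b.+1 - i) f) x =
    h 0%N + (\sum_(0 <= i < b) (h i.+1 + h i) + h b).
  rewrite big_nat_recl // big_nat_recr // subnn subn0; congr (_ + (_ + _)).
  - by rewrite /h subn0.
  - by rewrite big_nat [RHS]big_nat; apply: eq_bigr => i /andP[_ hi]; exact: hm.
  - by rewrite /h subnn.
move: h {hm} => h; rewrite big_split /= mulr_natl mulr2n [X in X + _]big_nat_recl // [X in _ + X]big_nat_recr //=.
by rewrite -!addrA.
Qed.

Lemma op_any_scale c (f : St -> int) : op_any (fun x => c * f x) = fun x => c * op_any f x.
Proof. by apply: functional_extensionality => x; rewrite /op_any !op_scale mulrDr. Qed.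

Lemma op_valley_scale b c (f : St -> int) : op_valley b (fun x => c * f x) = fun x => c * op_valley b f x.
Proof.
elim: b => [|b IH] //; apply: functional_extensionality => x.
have e i : iter i (op false) (fun x => c * f x) = fun x => c * iter i (op false) f x.
  by elim: i => //= i ->; rewrite op_scale.
by rewrite -[LHS]/(iter b.+1 (op false) (fun x => c * f x) x + op true (op_valley b (fun x => c * f x)) x) e IH op_scale -mulrDr.
Qed.

End Runs.

(** * Raising and lowering operators on shifted shapes *)

(** Functions on shifted shapes, given by their diagonal lengths k; only the diagonals c < N
    grow. The weights 1 and 2 in [down], and the operator [sgn M] with the convention that it is
    0 for M = 0, are chosen such that u_c d_c - d_c u_c = s_(c+1) - s_c for all c. *)
Section Shifted.
Variable N : nat.
Local Notation K := (nat -> nat).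
Local Notation profile_ok := (profile_ok N).
Implicit Types (f g : K -> int) (k : K).

Definition fun0 : K -> int := fun=> 0.
Definition oppf f : K -> int := fun k => - f k.
Definition dec k (c : nat) : K := fun j => (k j - (j == c))%N.

Definition up (c : nat) f : K -> int := fun k =>
  if profile_ok k && profile_ok (inc k c) then f (inc k c) else 0.
Definition down (c : nat) f : K -> int := fun k =>
  (if c == 0%N then 1 else 2) *
  (if [&& profile_ok k, (0 < k c)%N & profile_ok (dec k c)] then f (dec k c) else 0).
(** Multiplication by 1 or -1 according to whether the diagonals M - 1 and M have the same
    length. *)
Definition sgn (M : nat) f : K -> int := fun k =>
  if profile_ok k then (if M is M'.+1 then (if k M' == k M then 1 else -1) else 0) * f k else 0.
Fixpoint Down (M : nat) f : K -> int :=
  if M is M'.+1 then Down M' f \+ down M' f else fun0.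

(** A sequence of operators indexed by the number of letters is shifted by one; this plays the
    role of multiplication by a variable x. *)
Definition delay (F : nat -> K -> int) (a : nat) : K -> int := if a is a'.+1 then F a' else fun0.
(** The coefficient of x^a in the product of the factors 1 + x u_c, with c decreasing from
    M - 1 to 0 and then increasing again. *)
Fixpoint Valley (M a : nat) f : K -> int :=
  if M is M'.+1 then
    (Valley M' a f \+ up M' (delay (fun b => Valley M' b f) a)) \+
    delay (fun b => Valley M' b (up M' f) \+ up M' (delay (fun c => Valley M' c (up M' f)) b)) a
  else if a is 0 then f else fun0.

Definition lin (F : (K -> int) -> K -> int) : Prop :=
  (forall f g, F (f \+ g) = F f \+ F g) * (forall f, F (oppf f) = oppf (F f)) * (F fun0 = fun0).

Lemma lin_up c : lin (up c).
Proof.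
by split=> [|]; [split=> [f g|f]|]; apply: functional_extensionality => k;
  rewrite /up /oppf /fun0 /=; case: ifP => // _; rewrite ?addr0 ?oppr0.
Qed.

Lemma lin_down c : lin (down c).
Proof.
by split=> [|]; [split=> [f g|f]|]; apply: functional_extensionality => k;
  rewrite /down /oppf /fun0 /=; case: [&& _, _ & _];
  rewrite /= ?mulr0 ?addr0 ?oppr0 ?mulrDr ?mulrN.
Qed.

Lemma lin_id : lin id. Proof. by []. Qed.

Lemma lin_fun0 : lin (fun=> fun0).
Proof. by split=> [|]; [split=> [f g|f]|] => //; apply: functional_extensionality => k; rewrite /oppf /fun0 /= ?addr0 ?oppr0. Qed.

Lemma lin_Down M : lin (Down M).
Proof.
elim: M => [|M IH].
  exact: lin_fun0.
split=> [|]; [split=> [f g|f]|]; apply: functional_extensionality => k; rewrite /= IH lin_down /oppf /fun0 /= ?addr0 //.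
  by rewrite addrACA.
by rewrite opprD.
Qed.

Lemma lin_delay F a : (forall b, lin (F b)) -> lin (fun f => delay (fun b => F b f) a).
Proof.
by move=> hF; case: a => [|a]; [exact: lin_fun0|exact: hF].
Qed.

Lemma lin_comp F G : lin F -> lin G -> lin (fun f => F (G f)).
Proof. by move=> hF hG; split=> [|]; [split=> [f g|f]|]; rewrite hG hF. Qed.

Lemma lin_add F G : lin F -> lin G -> lin (fun f => F f \+ G f).
Proof.
move=> hF hG; split=> [|]; [split=> [f g|f]|]; rewrite hG hF; apply: functional_extensionality => k; rewrite /oppf /fun0 /= ?addr0 //.
  by rewrite addrACA.
by rewrite opprD.
Qed.

Lemma lin_Valley M a : lin (Valley M a).
Proof.
elim: M a => [|M IH] a.
  by case: a => [|a]; [apply: lin_id|apply: lin_fun0].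
have h1 b : lin (fun f => Valley M b f \+ up M (delay (fun c => Valley M c f) b)).
  apply: lin_add => //; apply: (@lin_comp (up M) (fun f => delay (fun c => Valley M c f) b)); first exact: lin_up.
  by apply: lin_delay.
rewrite /=; apply: lin_add => //.
exact: (@lin_delay (fun b f => Valley M b (up M f) \+ up M (delay (fun c => Valley M c (up M f)) b)) a
  (fun b => @lin_comp _ (up M) (h1 b) (lin_up M))).
Qed.

Lemma inc_dec k i j : i != j -> inc (dec k j) i = dec (inc k i) j.
Proof. by move=> hij; apply: functional_extensionality => x; rewrite /inc /dec; lia. Qed.

(** For different diagonals, the four shapes involved form a lattice square, and the shifted
    shapes are closed under meet and join. *)
Lemma up_down i j f : i != j -> up i (down j f) = down j (up i f).
Proof.
move=> hij; apply: functional_extensionality => k; rewrite /up /down.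
case hk: (profile_ok k) => /=; last by rewrite mulr0.
have -> : inc k i j = k j by rewrite /inc; lia.
have e := inc_dec k hij.
case hk1: (profile_ok (inc k i)); case hk2: (0 < k j)%N; case hk3: (profile_ok (dec k j)) => /=;
  rewrite -?e ?mulr0 //; case hk4: (profile_ok (inc (dec k j) i)); rewrite /= ?mulr0 //.
- suff : profile_ok (dec k j) by rewrite hk3.
  apply/profile_okP => x hx; move/profile_okP: hk => /(_ x hx); move/profile_okP: hk4 => /(_ x hx).
  by move/profile_okP: hk1 => /(_ x hx); rewrite /inc /dec; move: hij hk2; lia.
- suff : profile_ok (inc k i) by rewrite hk1.
  apply/profile_okP => x hx; move/profile_okP: hk => /(_ x hx); move/profile_okP: hk4 => /(_ x hx).
  by move/profile_okP: hk3 => /(_ x hx); rewrite /inc /dec; move: hij hk2; lia.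
Qed.

(** A diagonal cannot grow twice in a row. *)
Lemma up_up c f : (c < N)%N -> up c (up c f) = fun0.
Proof.
move=> hc; apply: functional_extensionality => k; rewrite /up /fun0.
case: ifP => // /andP[/profile_okP/(_ c hc) h1 /profile_okP/(_ c hc) h2]; case: ifP => // /andP[_ /profile_okP/(_ c hc)].
by rewrite /inc in h2 *; lia.
Qed.

(** The diagonal M can grow only if it is shorter than the diagonal M - 1 and as long as the
    diagonal M + 1; afterwards it is the other way round. So both sides are the operator
    [up M] up to the same sign. *)
Lemma up_sgn M f : (0 < M < N)%N -> up M (sgn M f) = sgn M.+1 (up M f).
Proof.
case: M => // M /= hM; apply: functional_extensionality => k; rewrite /up /sgn.
case hk: (profile_ok k) => //=; case hk1: (profile_ok (inc k M.+1)); last by rewrite mulr0.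
move/profile_okP: (hk) => /(_ M (ltnW hM)); move/profile_okP: (hk) => /(_ M.+1 hM).
move/profile_okP: (hk1) => /(_ M (ltnW hM)); move/profile_okP: (hk1) => /(_ M.+1 hM).
rewrite /inc; have -> : (M == M.+1) = false by lia.
have -> : (M.+2 == M.+1) = false by lia.
rewrite eqxx => h1 h2 h3 h4; rewrite /inc.
have -> : (k M + 0 == k M.+1 + 1)%N by lia.
by have -> : (k M.+1 == k M.+2)%N by lia.
Qed.

Lemma sgn_up M f : (0 < M < N)%N -> sgn M (up M f) = up M (sgn M.+1 f).
Proof.
case: M => // M /= hM; apply: functional_extensionality => k; rewrite /up /sgn.
case hk: (profile_ok k) => //=; case hk1: (profile_ok (inc k M.+1)); last by rewrite mulr0.
move/profile_okP: (hk) => /(_ M (ltnW hM)); move/profile_okP: (hk) => /(_ M.+1 hM).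
move/profile_okP: (hk1) => /(_ M (ltnW hM)); move/profile_okP: (hk1) => /(_ M.+1 hM).
rewrite /inc; have -> : (M == M.+1) = false by lia.
have -> : (M.+2 == M.+1) = false by lia.
rewrite eqxx => h1 h2 h3 h4; rewrite /inc.
have -> : (k M == k M.+1)%N = false by lia.
by have -> : (k M.+1 + 1 == k M.+2 + 0)%N = false by lia.
Qed.

Lemma sgn1_up f : (0 < N)%N -> sgn 1 (up 0 f) = oppf (up 0 (sgn 1 f)).
Proof.
move=> hN; apply: functional_extensionality => k; rewrite /up /sgn /oppf.
case hk: (profile_ok k) => //=.
case hk1: (profile_ok (inc k 0)); last by rewrite mulr0 ?oppr0.
move/profile_okP: (hk) => /(_ 0%N hN); move/profile_okP: (hk1) => /(_ 0%N hN).
rewrite /inc /= => h1 h2.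
have -> : (k 0 == k 1)%N by lia.
have -> : (k 0 + 1 == k 1 + 0)%N = false by lia.
by rewrite mul1r mulN1r opprK.
Qed.

Lemma dec_inc k i : dec (inc k i) i = k.
Proof. by apply: functional_extensionality => x; rewrite /inc /dec; lia. Qed.

Lemma inc_decK k i : (0 < k i)%N -> inc (dec k i) i = k.
Proof.
move=> h; apply: functional_extensionality => x; rewrite /inc /dec.
by case: eqP => [->|_]; lia.
Qed.

(** At a given shape, diagonal M can grow, can shrink, or can do neither; each of the cases is
    read off from the comparison with its two neighbours. *)
Lemma up_down_same M f : (M < N)%N -> up M (down M f) = (down M (up M f) \+ sgn M.+1 f) \+ oppf (sgn M f).
Proof.
move=> hM; apply: functional_extensionality => k; rewrite /up /down /sgn /oppf /=.
case hk: (profile_ok k) => /=; last by rewrite mulr0.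
rewrite dec_inc hk.
have h0 : (0 < inc k M M)%N by rewrite /inc eqxx; lia.
rewrite h0 /=.
have e1 : profile_ok (inc k M) = (k M == k M.+1) && (if M is M'.+1 then k M' != k M else true).
  apply/profile_okP/andP => [h|[h1 h2] j hj].
    split; first by have := h M hM; have /profile_okP/(_ M hM) := hk; rewrite /inc; lia.
    case: M hM {h0} h => // M hM h; have := h M (ltnW hM); have /profile_okP/(_ M (ltnW hM)) := hk.
    by rewrite /inc; lia.
  have /profile_okP/(_ j hj) := hk; rewrite /inc; case: (j =P M) => [->|]; first by lia.
  by case: M hM h1 h2 {h0} => [|M] hM h1 h2; [lia|case: (j =P M) => [->|]; lia].
have e2 : (0 < k M)%N && profile_ok (dec k M) = (k M != k M.+1) && (if M is M'.+1 then k M' == k M else true).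
  apply/andP/andP => [[h1 /profile_okP h]|[h1 h2]].
    split; first by have := h M hM; have /profile_okP/(_ M hM) := hk; rewrite /dec; lia.
    case: M hM {h0 e1} h h1 => // M hM h h1; have := h M (ltnW hM); have /profile_okP/(_ M (ltnW hM)) := hk.
    by rewrite /dec; lia.
  split; first by have /profile_okP/(_ M hM) := hk; lia.
  apply/profile_okP => j hj; have /profile_okP/(_ j hj) := hk; have /profile_okP/(_ M hM) := hk.
  rewrite /dec; case: (j =P M) => [->|]; first by lia.
  by case: M hM h1 h2 {h0 e1} => [|M] hM h1 h2; [lia|case: (j =P M) => [->|]; lia].
have e3 : (if (0 < k M)%N && profile_ok (dec k M) then
     if profile_ok (dec k M) && profile_ok (inc (dec k M) M) then f (inc (dec k M) M) else 0 else 0) =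
   if (0 < k M)%N && profile_ok (dec k M) then f k else 0.
  by case: ifP => // /andP[h1 ->]; rewrite inc_decK // hk.
rewrite e3 andbT e1 e2; case: (M) => [|M'] /=; first by case: (k 0%N == _) => /=; ring.
by case: (k M' == _); case: (k M'.+1 == _) => /=; ring.
Qed.

Lemma Valley0 M f : Valley M 0 f = f.
Proof.
elim: M f => [|M IH] f //=; rewrite IH (lin_up M).2.
by apply: functional_extensionality => k; rewrite /= /fun0 !addr0.
Qed.

Lemma Valley1 M f : Valley M.+1 1 f = (Valley M 1 f \+ up M f) \+ up M f.
Proof.
rewrite /= !Valley0 (lin_up M).2.
by apply: functional_extensionality => k; rewrite /= /fun0 addr0.
Qed.

Lemma Valley2 M a f : Valley M.+1 a.+2 f =
  ((Valley M a.+2 f \+ up M (Valley M a.+1 f)) \+ Valley M a.+1 (up M f)) \+ up M (Valley M a (up M f)).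
Proof. by apply: functional_extensionality => k; rewrite /= !addrA. Qed.

Lemma Valley_down M a j f : (M <= j)%N -> Valley M a (down j f) = down j (Valley M a f).
Proof.
elim: M a f => [|M IH] a f hj; first by case: a => //= a; rewrite (lin_down j).2.
have hu g : up M (down j g) = down j (up M g) by apply: up_down; lia.
case: a => [|[|a]]; first by rewrite !Valley0.
  by rewrite !Valley1 !lin_down IH ?hu //; lia.
by rewrite !Valley2 !lin_down ?hu !IH ?hu //; lia.
Qed.

Lemma up_Down M j f : (M <= j)%N -> up j (Down M f) = Down M (up j f).
Proof.
elim: M => [|M IH] hj /=; first by rewrite (lin_up j).2.
by rewrite (lin_up j) IH ?up_down //; lia.
Qed.

Lemma lin_sgn M : lin (sgn M).
Proof.
by split=> [|]; [split=> [f g|f]|]; apply: functional_extensionality => k;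
  rewrite /sgn /oppf /fun0 /=; case: (profile_ok k); rewrite /= ?mulr0 ?addr0 ?oppr0 ?mulrDr ?mulrN.
Qed.

Lemma addf0 f : f \+ fun0 = f.
Proof. by apply: functional_extensionality => k; rewrite /= /fun0 addr0. Qed.
Lemma add0f f : fun0 \+ f = f.
Proof. by apply: functional_extensionality => k; rewrite /= /fun0 add0r. Qed.

Lemma Valley_base0 a f : Valley 0 a.+1 f = fun0. Proof. by []. Qed.

Lemma Valley_base a f : (0 < N)%N -> Valley 1 a.+2 f = fun0.
Proof.
move=> hN; rewrite Valley2 !Valley_base0 (lin_up 0).2 !addf0; case: a => [|a]; last by rewrite Valley_base0 (lin_up 0).2.
by rewrite Valley0 up_up.
Qed.

Lemma Valley_Down1 a f : (0 < N)%N ->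
  Valley 1 a.+1 (Down 1 f) = (Down 1 (Valley 1 a.+1 f) \+ sgn 1 (Valley 1 a f)) \+ Valley 1 a (sgn 1 f).
Proof.
move=> hN; rewrite -[Down 1 f]/(fun0 \+ down 0 f) add0f.
have hD g : Down 1 g = down 0 g by rewrite -[Down 1 g]/(fun0 \+ down 0 g) add0f.
have s0 g : sgn 0 g = fun0 by apply: functional_extensionality => k; rewrite /sgn mul0r; case: ifP.
case: a => [|[|a]]; rewrite !hD.
- rewrite !Valley1 !Valley_base0 !add0f !Valley0 (lin_down 0) up_down_same // s0.
  by apply: functional_extensionality => k; rewrite /= /fun0 /oppf; ring.
- rewrite !Valley_base // (lin_down 0) !Valley1 !Valley_base0 !add0f (lin_sgn 1) sgn1_up //.
  by apply: functional_extensionality => k; rewrite /= /fun0 /oppf; ring.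
- by rewrite !Valley_base // (lin_down 0) (lin_sgn 1) !addf0.
Qed.

(** With A = 1 + x u_M, Q the operator for the letters below M, s = s_M and t = s_(M+1), the
    commutator of A Q A with D + d is A [Q, D] A + x ((t - s) Q A + A Q (t - s)). Inserting
    [Q, D] = x (s Q + Q s), the relations u s = t u and s u = u t turn it into
    x (t A Q A + A Q A t). *)
Lemma Valley_Down_step M a f : (0 < M < N)%N ->
  (forall a f, Valley M a.+1 (Down M f) = (Down M (Valley M a.+1 f) \+ sgn M (Valley M a f)) \+ Valley M a (sgn M f)) ->
  Valley M.+1 a.+1 (Down M.+1 f) =
   (Down M.+1 (Valley M.+1 a.+1 f) \+ sgn M.+1 (Valley M.+1 a f)) \+ Valley M.+1 a (sgn M.+1 f).
Proof.
move=> hM IH.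
have hu g := up_Down g (leqnn M); have hq a' g := @Valley_down M a' M g (leqnn M).
have us g := up_sgn g hM; have su g := sgn_up g hM.
have lu := lin_up M; have lD := lin_Down M; have ld := lin_down M.
have ls := lin_sgn M; have ls' := lin_sgn M.+1; have lq a' := lin_Valley M a'.
have hD g : Down M.+1 g = Down M g \+ down M g by [].
have ud g : up M (down M g) = _ := up_down_same g (proj2 (andP hM)).
have qN a' g : Valley M a' (oppf g) = oppf (Valley M a' g) by rewrite lq.
have qA a' g g' : Valley M a' (g \+ g') = Valley M a' g \+ Valley M a' g' by rewrite lq.
case: a => [|[|a]].
- rewrite !Valley1 !Valley0 !hD.
  do 3![rewrite ?(lu, lD, ld, ls, ls', hu, hq, ud, qA, qN)].
  rewrite !IH !Valley0.
  by apply: functional_extensionality => k; rewrite /= /fun0 /oppf; ring.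
- rewrite !Valley2 !Valley1 !Valley0 !hD.
  do 3![rewrite ?(lu, lD, ld, ls, ls', hu, hq, ud, qA, qN, IH, us, su, Valley0)].
  by apply: functional_extensionality => k; rewrite /= /fun0 /oppf; ring.
- rewrite !Valley2 !hD.
  do 3![rewrite ?(lu, lD, ld, ls, ls', hu, hq, ud, qA, qN, IH, us, su)].
  by apply: functional_extensionality => k; rewrite /= /fun0 /oppf; ring.
Qed.

(** A Weyl relation up to a sign operator, which is the identity on small shapes
    ([sgn_down_paths]). *)
Lemma Valley_Down M a f : (0 < M <= N)%N ->
  Valley M a.+1 (Down M f) = (Down M (Valley M a.+1 f) \+ sgn M (Valley M a f)) \+ Valley M a (sgn M f).
Proof.
case: M => // M hM; elim: M hM a f => [|M IH] hM a f; first exact: Valley_Down1.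
by apply: Valley_Down_step => // b g; apply: IH; lia.
Qed.

Definition empty_shape : K -> int := fun k => (all (fun j => k j == 0%N) (iota 0 N.+1))%:R.
(** The weighted number of ways of removing the cells one by one, as a function of the shape. *)
Definition down_paths (m : nat) : K -> int := iter m (Down N) empty_shape.

Lemma Down_sum M f k : Down M f k = \sum_(0 <= c < M) down c f k.
Proof. by elim: M => [|M IH]; [rewrite big_geq|rewrite big_nat_recr //= IH]. Qed.

Lemma down_paths_support m k : down_paths m k != 0 -> [/\ profile_ok k, k N = 0%N & (\sum_(0 <= j < N) k j = m)%N].
Proof.
elim: m k => [|m IH] k.
  rewrite /down_paths /= /empty_shape; case h: all => // _; move/allP: h => h.
  have h0 j : (j <= N)%N -> k j = 0%N by move=> hj; apply/eqP/h; rewrite mem_iota add0n ltnS hj.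
  split; [by apply/profile_okP => j hj; rewrite !h0 //; lia|exact: h0|].
  by rewrite big_nat big1 // => j /andP[_ hj]; rewrite h0 //; lia.
rewrite /down_paths /= -/(down_paths m) Down_sum => h.
have [c hc hd] : exists2 c, (c < N)%N & down c (down_paths m) k != 0.
  case e : (has (fun c => down c (down_paths m) k != 0) (iota 0 N)).
    by move/hasP: e => [c]; rewrite mem_iota add0n => /= hc hd; exists c.
  move: h; rewrite big_nat big1 ?eqxx // => c /andP[_ hc]; apply/eqP; rewrite -[_ == _]negbK.
  by move/negbT/hasPn: e => /(_ c) -> //; rewrite mem_iota.
move: hd; rewrite /down; case h3: [&& _, _ & _]; last by rewrite mulr0 eqxx.
have /and3P[hg hk hg'] := h3.
rewrite mulf_eq0 negb_or => /andP[_ /IH[_ h1 h2]]; split=> //.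
  by move: h1; rewrite /dec (_ : (N == c) = false) ?subn0 //; lia.
rewrite -h2 (bigD1_seq c) ?iota_uniq ?mem_index_iota //= [in RHS](bigD1_seq c) ?iota_uniq ?mem_index_iota //=.
rewrite /dec eqxx -addSn; congr (_ + _)%N; first lia.
by apply: eq_bigr => j hj; rewrite (negbTE hj) subn0.
Qed.

(** A shape whose diagonal N - 1 is not empty has at least N cells. *)
Lemma sgn_down_paths m : (0 < N)%N -> (m < N)%N -> sgn N (down_paths m) = down_paths m.
Proof.
move=> hN hm; apply: functional_extensionality => k; rewrite /sgn.
case: (down_paths m k =P 0) => [->|/eqP /down_paths_support[hg h0 hs]]; first by rewrite mulr0; case: ifP.
rewrite hg; case: (N) hg hN h0 hs hm => // M hg _ h0 hs hm.
case: eqP => e; first by rewrite mul1r.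
exfalso; have h j : (j <= M)%N -> (0 < k (M - j)%N)%N.
  elim: j => [|j IH] hj; first by rewrite subn0; lia.
  have := IH (ltnW hj); move/profile_okP: hg => /(_ (M - j.+1)%N).
  have -> : ((M - j.+1).+1 = M - j)%N by lia.
  by move=> h1 h2; have := h1 _; lia.
have : (\sum_(0 <= j < M.+1) 1 <= \sum_(0 <= j < M.+1) k j)%N.
  rewrite !big_nat; apply: leq_sum => j /andP[_ hj]; have := h (M - j)%N; rewrite subKn; lia.
by rewrite sum_nat_const_nat hs; lia.
Qed.

Lemma Valley_empty_shape M a : (M <= N)%N -> Valley M a.+1 empty_shape = fun0.
Proof.
move=> hM; elim: M hM a => [|M IH] hM a //.
have hu : up M empty_shape = fun0.
  apply: functional_extensionality => k; rewrite /up /empty_shape /fun0; case: ifP => // _.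
  case h: all => //; move/allP: h => /(_ M); rewrite mem_iota add0n ltnS (ltnW hM) => /(_ isT).
  by rewrite /inc eqxx addn1.
have hq b : Valley M b fun0 = fun0 by rewrite lin_Valley.
case: a => [|a]; first by rewrite Valley1 hu IH ?(ltnW hM) ?addf0.
by rewrite Valley2 hu !hq (lin_up M) !IH ?(ltnW hM) // (lin_up M) !addf0.
Qed.

(** On these functions [Down N] and the valley operators behave like a variable and the
    derivatives with respect to it: induction on m by Pascal rule. *)
Lemma Valley_down_paths m a : (m <= N)%N -> Valley N a (down_paths m) = fun k => ('C(m, a) * 2 ^ a)%:R * (if (a <= m)%N then down_paths (m - a) k else 0).
Proof.
elim: m a => [|m IH] a hm.
  case: a => [|a]; first by rewrite Valley0; apply: functional_extensionality => k; rewrite mul1r.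
  by rewrite Valley_empty_shape //; apply: functional_extensionality => k; rewrite mulr0.
case: a => [|a]; first by rewrite Valley0; apply: functional_extensionality => k; rewrite bin0 mul1r.
have hN : (0 < N)%N by lia.
rewrite -[down_paths m.+1]/(Down N (down_paths m)) Valley_Down ?hN ?leqnn // sgn_down_paths // !IH ?(ltnW hm) //.
have hDs c f : Down N (fun k => c%:R * f k) = fun k => c%:R * Down N f k.
  apply: functional_extensionality => k; rewrite !Down_sum mulr_sumr; apply: eq_bigr => j _.
  by rewrite /down; case: [&& _, _ & _]; rewrite ?mulr0 // mulrCA.
rewrite hDs; apply: functional_extensionality => k; rewrite /= ltnS subSS.
have hs : sgn N (fun k => ('C(m, a) * 2 ^ a)%:R * (if (a <= m)%N then down_paths (m - a) k else 0)) k =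
  ('C(m, a) * 2 ^ a)%:R * (if (a <= m)%N then down_paths (m - a) k else 0).
  have e : sgn N (down_paths (m - a)) k = down_paths (m - a) k by rewrite sgn_down_paths //; lia.
  case: (leqP a m) => h; last by rewrite /sgn !mulr0; case: ifP.
  by rewrite /sgn mulrCA -[in RHS]e /sgn; case: ifP; rewrite // !mulr0.
rewrite hs; case: (ltngtP a m) => h.
- have -> : Down N (fun k => down_paths (m - a.+1) k) k = down_paths (m - a) k.
    by have -> : (m - a = (m - a.+1).+1)%N by lia.
  by rewrite binS expnS !natrM natrD; ring.
- rewrite !bin_small ?mul0n //; [by rewrite !mul0r !addr0|lia..].
- rewrite h subnn -h -[Down N _]/(Down N fun0) (lin_Down N) /fun0 mulr0 add0r.
  by rewrite !binn expnS; ring.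
Qed.

(** Sums over decreasing words with letters below M; [Inc x d] sums over increasing words with
    letters from x on, below x + d. *)
Fixpoint Dec (M i : nat) f : K -> int :=
  if M is M'.+1 then Dec M' i f \+ up M' (delay (fun b => Dec M' b f) i)
  else if i is 0 then f else fun0.
Fixpoint Inc (x d j : nat) f : K -> int :=
  if d is d'.+1 then Inc x d' j f \+ delay (fun b => Inc x d' b (up (x + d')%N f)) j
  else if j is 0 then f else fun0.

Lemma lin_Dec M i : lin (Dec M i).
Proof.
elim: M i => [|M IH] i; first by case: i => [|i]; [apply: lin_id|apply: lin_fun0].
apply: lin_add => //; apply: (@lin_comp (up M) (fun f => delay (fun b => Dec M b f) i)); first exact: lin_up.
exact: lin_delay.
Qed.

Lemma Dec0 M f : Dec M 0 f = f.
Proof. by elim: M => [|M IH] //=; rewrite IH (lin_up M) addf0. Qed.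

Lemma Inc0 x d f : Inc x d 0 f = f.
Proof. by elim: d => [|d IH] //=; rewrite IH addf0. Qed.

Lemma Dec_sum M i f k : Dec M i.+1 f k = \sum_(0 <= c < M) up c (Dec c i f) k.
Proof. by elim: M => [|M IH]; [rewrite big_geq|rewrite big_nat_recr //= IH]. Qed.

(** By definition the largest letter is split off; this splits off the smallest one. *)
Lemma Inc_recl x d j f : Inc x d.+1 j.+1 f = Inc x.+1 d j.+1 f \+ up x (Inc x.+1 d j f).
Proof.
elim: d j f => [|d IH] j f.
  by rewrite /= addn0; case: j => [|j] //; rewrite (lin_up x).
rewrite -[LHS]/(Inc x d.+1 j.+1 f \+ Inc x d.+1 j (up (x + d.+1) f)) IH.
rewrite -[Inc x.+1 d.+1 j.+1 f]/(Inc x.+1 d j.+1 f \+ Inc x.+1 d j (up (x.+1 + d) f)) addSnnS.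
case: j => [|j].
  by rewrite !Inc0; apply: functional_extensionality => k; rewrite /=; ring.
rewrite IH -[Inc x.+1 d.+1 j.+1 f]/(Inc x.+1 d j.+1 f \+ Inc x.+1 d j (up (x.+1 + d) f)) addSnnS (lin_up x).
by apply: functional_extensionality => k; rewrite /=; ring.
Qed.

(** A repeated letter contributes nothing ([up_up]), so weakly increasing words may be
    counted instead of strictly increasing ones. *)
Lemma Inc_sum x d j f k : (x + d <= N)%N ->
  Inc x d j.+1 f k = \sum_(0 <= c < d) up (x + c) (Inc (x + c) (d - c) j f) k.
Proof.
elim: d x => [|d IH] x h; first by rewrite big_geq.
rewrite Inc_recl /= IH; last lia.
rewrite big_nat_recl // addrC addn0 subn0; congr (_ + _).
  move: j {IH} => [|j]; first by rewrite !Inc0.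
  by rewrite Inc_recl (lin_up x) up_up ?addf0 //; lia.
by apply: eq_bigr => c _; rewrite addSnnS.
Qed.

(** The product of the generating functions of decreasing words and of G. *)
Definition conv M (G : nat -> K -> int) (a : nat) : K -> int :=
  fun k => \sum_(0 <= i < a.+1) Dec M i (G (a - i)%N) k.

Lemma conv_recl M G a : conv M.+1 G a = conv M G a \+ up M (delay (conv M G) a).
Proof.
have hup c (r : seq nat) (F : nat -> K -> int) k : up c (fun k => \sum_(i <- r) F i k) k = \sum_(i <- r) up c (F i) k.
  by rewrite /up; case: ifP => // _; rewrite big1.
apply: functional_extensionality => k; rewrite /conv /= big_split /=; congr (_ + _).
case: a => [|a]; first by rewrite big_nat1.
rewrite big_nat_recl //= (lin_up M) [fun0 k]/0 add0r hup.
by apply: eq_bigr => i _.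
Qed.

Lemma conv_delay M G a : conv M (delay G) a = delay (conv M G) a.
Proof.
apply: functional_extensionality => k; rewrite /conv; case: a => [|a].
  by rewrite big_nat1 subnn Dec0.
rewrite big_nat_recr //= subnn (lin_Dec M) [fun0 k]/0 addr0.
rewrite big_nat [RHS]big_nat; apply: eq_bigr => i /andP[_ hi].
by rewrite subSn.
Qed.

Lemma conv_add M G G' a : conv M (fun j => G j \+ G' j) a = conv M G a \+ conv M G' a.
Proof.
apply: functional_extensionality => k; rewrite /conv /= -big_split.
by apply: eq_bigr => i _; rewrite (lin_Dec M).
Qed.

Lemma Valley_conv M a f : Valley M a f = conv M (fun j => Inc 0 M j f) a.
Proof.
elim: M a f => [|M IH] a f.
  apply: functional_extensionality => k; rewrite /conv; case: a => [|a]; first by rewrite big_nat1.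
  rewrite big_nat_recl //= [fun0 k]/0 add0r big1 //.
have e : (fun j => Inc 0 M.+1 j f) = (fun j => Inc 0 M j f \+ delay (fun b => Inc 0 M b (up M f)) j) by [].
rewrite e conv_add conv_delay !conv_recl.
have e1 g : conv M (fun j => Inc 0 M j g) = fun b => Valley M b g.
  by apply: functional_extensionality => b; rewrite IH.
rewrite /= -IH e1; congr (_ \+ _); congr delay; apply: functional_extensionality => b.
by rewrite conv_recl -IH e1.
Qed.

(** Only shapes that are reached by a walk matter, hence the restriction to shifted shapes. *)
Definition agrees (F : K * nat -> int) g : Prop := forall k x, profile_ok k -> F (k, x) = g k.

Lemma op_tab_step d F k x : profile_ok k -> op (tab_step N) d F (k, x) =
  \sum_(0 <= c < N) (if (c < x)%N == d then up c (fun k' => F (k', c)) k else 0).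
Proof.
move=> hk; rewrite /op /tab_step big_map big_filter big_mkcond /index_iota subn0; apply: eq_bigr => c _.
by rewrite /up hk /=; case: (profile_ok _); case: (_ == d).
Qed.

Lemma up_eq c f g k : (forall k, profile_ok k -> f k = g k) -> up c f k = up c g k.
Proof. by move=> h; rewrite /up; case: ifP => // /andP[_ /h]. Qed.

Lemma iter_desc F g i k x : agrees F g -> profile_ok k -> (x <= N)%N ->
  iter i (op (tab_step N) true) F (k, x) = Dec x i g k.
Proof.
move=> hF; elim: i k x => [|i IH] k x hk hx; first by rewrite Dec0 /= hF.
rewrite iterS op_tab_step // Dec_sum (big_cat_nat (n := x)) //= [X in _ + X]big_nat.
rewrite [X in _ + X]big1 ?addr0; last by move=> c /andP[h1 h2]; rewrite ltnNge h1.
rewrite big_nat [RHS]big_nat; apply: eq_bigr => c /andP[_ hc]; rewrite hc.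
by apply: up_eq => k' hk'; apply: IH => //; lia.
Qed.

(** The steps that are not descents repeat or raise the letter, and repetitions vanish. *)
Lemma iter_asc F g j k x : agrees F g -> profile_ok k -> (x <= N)%N ->
  iter j (op (tab_step N) false) F (k, x) = Inc x (N - x) j g k.
Proof.
move=> hF; elim: j k x => [|j IH] k x hk hx; first by rewrite Inc0 /= hF.
rewrite iterS op_tab_step // Inc_sum; last lia.
rewrite (big_cat_nat (n := x)) //= big_nat big1 ?add0r; last by move=> c /andP[h1 h2]; rewrite h2.
rewrite -{1}[x]add0n big_addn; rewrite big_nat [RHS]big_nat; apply: eq_bigr => c /andP[_ hc].
rewrite ltnNge leq_addl addnC; apply: up_eq => k' hk'; rewrite IH //; last lia.
by congr Inc; lia.
Qed.

Lemma op_any_runs F k x : profile_ok k -> op_any (tab_step N) F (k, x) = \sum_(0 <= c < N) up c (fun k' => F (k', c)) k.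
Proof.
move=> hk; rewrite /op_any !op_tab_step // -big_split; apply: eq_bigr => c _ /=.
by case: (c < x)%N; rewrite ?addr0 ?add0r.
Qed.

Lemma desc_run_agrees F g i : agrees F g -> agrees (desc_run (tab_step N) i F) (Dec N i g).
Proof.
move=> hF k x hk; case: i => [|i]; first by rewrite Dec0 /= hF.
rewrite /desc_run op_any_runs // Dec_sum big_nat [RHS]big_nat; apply: eq_bigr => c /andP[_ hc].
by apply: up_eq => k' hk'; rewrite (iter_desc _ hF) //; lia.
Qed.

Lemma asc_run_agrees F g j : agrees F g -> agrees (asc_run (tab_step N) j F) (Inc 0 N j g).
Proof.
move=> hF k x hk; case: j => [|j]; first by rewrite Inc0 /= hF.
rewrite /asc_run op_any_runs // Inc_sum // big_nat [RHS]big_nat; apply: eq_bigr => c /andP[_ hc].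
by apply: up_eq => k' hk'; rewrite (iter_asc _ hF) //; lia.
Qed.

(** Twice the operator of a block is the valley operator, by [two_op_valley]. *)
Lemma block_agrees F g b : agrees F g ->
  agrees (fun s => 2 * op_any (tab_step N) (op_valley (tab_step N) b F) s) (Valley N b.+1 g).
Proof.
move=> hF k x hk; rewrite two_op_valley Valley_conv; apply: eq_bigr => i _.
by apply: desc_run_agrees => //; apply: asc_run_agrees.
Qed.

Lemma lin_natmul F n f : lin F -> F (fun k => n%:R * f k) = fun k => n%:R * F f k.
Proof.
move=> hF; elim: n => [|n IH].
  have e g : (fun k => 0%:R * g k) = fun0 by apply: functional_extensionality => k; rewrite mul0r.
  by rewrite !e hF.
have e g : (fun k => n.+1%:R * g k) = (fun k => n%:R * g k) \+ g.
  by apply: functional_extensionality => k; rewrite /= -natr1 mulrDl mul1r.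
by rewrite !e hF IH.
Qed.

(** With n = sumn a this is the multinomial coefficient of a ([multinom_fact]). *)
Fixpoint multinom (n : nat) (a : seq nat) : nat :=
  if a is x :: a' then ('C(n - sumn a', x) * multinom n a')%N else 1%N.

Lemma profile_ok0 : profile_ok (fun=> 0%N). Proof. by apply/profile_okP. Qed.

Lemma tab_blocks a : all (leq 1) a -> (sumn a <= N)%N ->
  agrees (fun s => 2 ^+ size a * op_blocks (tab_step N) a (fun s' => down_paths N s'.1) s)
    (fun k => (2 ^ sumn a * multinom N a)%:R * down_paths (N - sumn a) k).
Proof.
elim: a => [|x a IH] /= => [_ _ k y hk|/andP[hx ha] hs]; first by rewrite subn0.
have hs' : (sumn a <= N)%N by lia.
have h1 := block_agrees (x.-1) (IH ha hs').
move=> k y hk; have := h1 k y hk.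
have -> : op_valley (tab_step N) x.-1 (fun s => 2 ^+ size a * op_blocks (tab_step N) a (fun s' => down_paths N s'.1) s) =
    fun s => 2 ^+ size a * op_valley (tab_step N) x.-1 (op_blocks (tab_step N) a (fun s' => down_paths N s'.1)) s.
  exact: op_valley_scale.
rewrite op_any_scale mulrA -exprS prednK // => ->.
rewrite lin_natmul; last exact: lin_Valley.
rewrite Valley_down_paths ?leq_subr // (_ : (x <= N - sumn a)%N); last lia.
rewrite mulrA -natrM; congr (_%:R * down_paths _ _); last lia.
by rewrite expnD; ring.
Qed.

End Shifted.

(** * All permutations *)

(** The state is the size of the permutation and its last value. *)
Definition perm_step (d : bool) (s : nat * nat) : seq (nat * nat) :=
  [seq (s.1.+1, v) | v <- iota 0 s.1.+1 & ((v <= s.2)%N == d)].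

(** The last value does not matter at the end of a block. *)
Definition agreesF (F : nat * nat -> int) (f : nat -> int) : Prop :=
  forall n l, (l <= n)%N -> F (n, l) = f n.

Lemma op_perm_step d F n l : op perm_step d F (n, l) =
  \sum_(0 <= v < n.+1) (if (v <= l)%N == d then F (n.+1, v) else 0).
Proof. by rewrite /op /perm_step big_map big_filter big_mkcond /index_iota subn0. Qed.

Lemma hockey_stick i n : (\sum_(0 <= v < n.+1) 'C(v + i, i) = 'C(n + i.+1, i.+1))%N.
Proof.
elim: n => [|n IH]; first by rewrite big_nat1 !add0n !binn.
by rewrite big_nat_recr //= IH [in RHS]addSn binS addSnnS.
Qed.

(** Multisets of size i in {0, ..., l}: the successive last values weakly decrease, because
    the entry appended below a value takes its place. *)
Lemma iter_descF F f i n l : agreesF F f -> (l <= n)%N ->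
  iter i (op perm_step true) F (n, l) = 'C(l + i, i)%:R * f (n + i)%N.
Proof.
move=> hF; elim: i n l => [|i IH] n l hl; first by rewrite bin0 mul1r addn0 /= hF.
rewrite iterS op_perm_step (big_cat_nat (n := l.+1)) //= [X in _ + X]big_nat.
rewrite [X in _ + X]big1 ?addr0; last by move=> v /andP[h1 h2]; rewrite leqNgt h1.
rewrite -hockey_stick natr_sum mulr_suml big_nat [RHS]big_nat; apply: eq_bigr => v /andP[_ hv].
by rewrite ltnS in hv; rewrite hv IH ?addSnnS //; lia.
Qed.

Lemma iter_ascF F f j n l : agreesF F f -> (l <= n)%N ->
  iter j (op perm_step false) F (n, l) = 'C((n - l + j).-1, j)%:R * f (n + j)%N.
Proof.
move=> hF; elim: j n l => [|j IH] n l hl; first by rewrite bin0 mul1r addn0 /= hF.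
rewrite iterS op_perm_step (big_cat_nat (n := l.+1)) //= big_nat.
rewrite big1 ?add0r; last by move=> v /andP[h1 h2]; rewrite -ltnS h2.
have e : \sum_(l.+1 <= v < n.+1) (if (v <= l)%N == false then iter j (op perm_step false) F (n.+1, v) else 0) =
   \sum_(l.+1 <= v < n.+1) 'C(n - v + j, j)%:R * f (n + j.+1)%N.
  rewrite big_nat [RHS]big_nat; apply: eq_bigr => v /andP[h1 h2]; rewrite leqNgt h1 /= IH ?addSnnS //; last lia.
  by congr ('C(_, _)%:R * _); lia.
rewrite e -mulr_suml; congr (_ * _); case: (ltnP l n) => h; last by rewrite big_geq // bin_small //; lia.
rewrite -[l.+1]add0n big_addn subSS big_nat_rev /= add0n.
have -> : (n - l + j.+1).-1 = ((n - l).-1 + j.+1)%N by lia.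
rewrite -hockey_stick natr_sum (_ : (n - l).-1.+1 = n - l)%N; last lia.
by rewrite big_nat [RHS]big_nat; apply: eq_bigr => v /andP[_ hv]; congr ('C(_, _)%:R); lia.
Qed.

Lemma op_any_perm_step F n l : op_any perm_step F (n, l) = \sum_(0 <= v < n.+1) F (n.+1, v).
Proof.
rewrite /op_any !op_perm_step -big_split; apply: eq_bigr => v _ /=.
by case: (v <= l)%N; rewrite ?addr0 ?add0r.
Qed.

Lemma desc_runF F f i : agreesF F f -> agreesF (desc_run perm_step i F) (fun n => 'C(n + i, i)%:R * f (n + i)%N).
Proof.
move=> hF n l hl; case: i => [|i]; first by rewrite bin0 mul1r addn0 /= hF.
rewrite /desc_run op_any_perm_step -hockey_stick natr_sum mulr_suml big_nat [RHS]big_nat; apply: eq_bigr => v /andP[_ hv].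
by rewrite (iter_descF _ hF) ?addSnnS //; lia.
Qed.

Lemma asc_runF F f i : agreesF F f -> agreesF (asc_run perm_step i F) (fun n => 'C(n + i, i)%:R * f (n + i)%N).
Proof.
move=> hF n l hl; case: i => [|i]; first by rewrite bin0 mul1r addn0 /= hF.
rewrite /asc_run op_any_perm_step -hockey_stick natr_sum mulr_suml big_nat_rev /= add0n big_nat [RHS]big_nat.
apply: eq_bigr => v /andP[_ hv].
rewrite (iter_ascF _ hF) ?addSnnS //; last lia.
by congr ('C(_, _)%:R * _); lia.
Qed.

(** Both sides count the chains of subsets of sizes n, n + i in a set of size n + a. *)
Lemma bin_split n i a : (i <= a)%N -> ('C(n + i, i) * 'C(n + a, a - i) = 'C(n + a, a) * 'C(a, i))%N.
Proof.
move=> hi; have h1 : (i <= n + i)%N by lia. have h2 : (a - i <= n + a)%N by lia.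
have h3 : (a <= n + a)%N by lia.
have := bin_fact h1; have := bin_fact h2; have := bin_fact h3; have := bin_fact hi.
have -> : (n + i - i = n)%N by lia. have -> : (n + a - (a - i) = n + i)%N by lia. rewrite addnK.
move=> e4 e3 e2 e1.
apply/eqP; rewrite -(@eqn_pmul2r (i`! * n`! * (a - i)`!)) ?muln_gt0 ?fact_gt0 //; apply/eqP.
transitivity (n + a)`!; first by rewrite -e2 -e1; ring.
by rewrite -e3 -e4; ring.
Qed.

(** A valley appended to a permutation of size n is a choice of b + 1 values among n + b + 1
    and of the values before its minimum, up to the factor 2 of [two_op_valley]. *)
Lemma block_F F f b : agreesF F f ->
  agreesF (fun s => 2 * op_any perm_step (op_valley perm_step b F) s)
    (fun n => (2 ^ b.+1 * 'C(n + b.+1, b.+1))%:R * f (n + b.+1)%N).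
Proof.
move=> hF n l hl; rewrite two_op_valley.
under eq_bigr => i _ do rewrite (desc_runF i (asc_runF (b.+1 - i) hF)) //.
have e : (2 ^ b.+1 = \sum_(0 <= i < b.+2) 'C(b.+1, i))%N.
  by rewrite (expnDn 1 1 b.+1) big_mkord; apply: eq_bigr => i _; rewrite !exp1n !muln1.
rewrite e big_distrl /= natr_sum mulr_suml big_nat [RHS]big_nat; apply: eq_bigr => i /andP[_ hi].
rewrite mulrA -natrM.
have -> : (n + i + (b.+1 - i) = n + b.+1)%N by lia.
by rewrite bin_split 1?mulnC; last lia.
Qed.

Lemma perm_blocks a : all (leq 1) a ->
  agreesF (fun s => 2 ^+ size a * op_blocks perm_step a (fun=> 1) s)
    (fun m => (2 ^ sumn a * multinom (m + sumn a) a)%:R).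
Proof.
elim: a => [|x a IH] /= => [_ m l _|/andP[hx ha] m l hl]; first by rewrite muln1.
have := block_F x.-1 (IH ha) hl.
have -> : op_valley perm_step x.-1 (fun s => 2 ^+ size a * op_blocks perm_step a (fun=> 1) s) =
    fun s => 2 ^+ size a * op_valley perm_step x.-1 (op_blocks perm_step a (fun=> 1)) s by exact: op_valley_scale.
rewrite op_any_scale mulrA -exprS prednK // => ->.
rewrite -natrM; congr _%:R; rewrite expnD addnA addnK; ring.
Qed.

Lemma perm_count_all a : all (leq 1) a -> 2 ^+ size a * perm_count [::] a = (2 ^ sumn a * multinom (sumn a) a)%:R.
Proof.
move=> ha; have <- := perm_blocks ha (leqnn 0); congr (_ * _).
case: a ha => [|x a] ha; first by rewrite /perm_count /= big_seq1.
rewrite (@class_perm_count _ _ perm_step (fun s => (size s, last 0%N s))) //.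
  by rewrite [RHS]/= op_any_perm_step big_nat1.
move=> n s F d hs; have hp := level_isperm hs.
rewrite op_perm_step (isperm_size hp) big_mkcond /index_iota subn0; apply: eq_bigr => v _.
by rewrite /= /append size_rcons size_map (isperm_size hp) last_rcons.
Qed.

Lemma multinom_fact n a : (sumn a <= n)%N ->
  (multinom n a * (\prod_(x <- a) x`!) * (n - sumn a)`! = n`!)%N.
Proof.
elim: a => [|x a IH] /= h; first by rewrite big_nil subn0 !mul1n.
rewrite big_cons -IH; last lia.
have h1 : (x <= n - sumn a)%N by lia.
rewrite -(bin_fact h1) (_ : (n - (x + sumn a) = n - sumn a - x)%N); [ring|lia].
Qed.

(** * Lowering paths count tableaux *)

Definition matches N w (k : nat -> nat) := all (fun j => content w j == k j) (iota 0 N.+1).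

Lemma matchesP N w k : reflect (forall j, (j <= N)%N -> content w j = k j) (matches N w k).
Proof.
apply: (iffP allP) => h j; last by rewrite mem_iota add0n ltnS => /= hj; apply/eqP/h.
by move=> hj; apply/eqP/h; rewrite mem_iota add0n ltnS.
Qed.

Lemma eq_profile_ok N k k' : (forall j, (j <= N)%N -> k j = k' j) -> profile_ok N k = profile_ok N k'.
Proof.
move=> h; apply/profile_okP/profile_okP => hg j hj; have := hg j hj; rewrite !h //; lia.
Qed.

Lemma matches_rcons N w c k : (c < N)%N ->
  matches N (rcons w c) k = (0 < k c)%N && matches N w (dec k c).
Proof.
move=> hc; apply/matchesP/andP => [h|[h0 /matchesP h] j hj].
  split; first by rewrite -h ?(ltnW hc) // content_rcons /inc eqxx addn1.
  by apply/matchesP => j hj; rewrite /dec -h // content_rcons /inc addnK.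
by rewrite content_rcons /inc h // /dec; case: (j =P c) => [->|_]; [lia|rewrite subn0 addn0].
Qed.

Lemma word_level_content N m w j : w \in level (word_children N) [::] m -> (N <= j)%N -> content w j = 0%N.
Proof.
case/mem_word_level => _ h _ hj; apply/count_memPn; apply/negP => /h; lia.
Qed.

Lemma word_level_profile N m w : w \in level (word_children N) [::] m -> profile_ok N (content w).
Proof. by case/mem_word_level => hs _ /(_ m (leqnn m)); rewrite take_oversize // hs. Qed.

(** Removing cells in the reverse order of a content word. Each letter other than 0
    contributes a factor 2. *)
Lemma down_paths_count N m k : profile_ok N k ->
  down_paths N m k = \sum_(w <- level (word_children N) [::] m | matches N w k) 2 ^+ (m - content w 0).
Proof.
elim: m k => [|m IH] k hk.
  rewrite /down_paths /= big_mkcond big_seq1; case: ifP => h.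
    rewrite /empty_shape (_ : all _ _ = true) //; apply/allP => j hj.
    by have := allP h j hj; rewrite eq_sym.
  rewrite /empty_shape (_ : all _ _ = false) //; apply: contraFF h => /allP h.
  by apply/allP => j hj; have := h j hj; rewrite eq_sym.
rewrite /down_paths iterS -/(down_paths N m) Down_sum /= big_flatten big_map.
transitivity (\sum_(0 <= c < N) \sum_(w <- level (word_children N) [::] m)
   (if matches N (rcons w c) k then 2 ^+ (m.+1 - content (rcons w c) 0) else 0 : int)); last first.
  rewrite exchange_big /=; apply: eq_bigr => w _.
  rewrite /word_children big_map big_filter_cond /index_iota subn0 [RHS]big_mkcond; apply: eq_bigr => c _.
  case hm: (matches _ _ _); rewrite ?andbF // andbT.
  by rewrite (@eq_profile_ok _ _ k) ?hk //; apply/matchesP.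
rewrite big_nat [RHS]big_nat; apply: eq_bigr => c /andP[_ hc]; rewrite /down hk /=.
case: (posnP (k c)) => hkc; first by rewrite mulr0 big1 // => w _; rewrite matches_rcons // hkc.
case hg: (profile_ok N (dec k c)); last first.
  rewrite mulr0 big_seq big1 // => w hw; rewrite matches_rcons // hkc /=; case: ifP => // hm.
  by rewrite -(@eq_profile_ok _ (content w)) ?(word_level_profile hw) in hg => //; apply/matchesP.
rewrite IH // mulr_sumr [RHS]big_seq [LHS]big_seq_cond big_mkcondr /=; apply: eq_bigr => w hw.
rewrite matches_rcons // hkc /=; case: ifP => // _.
rewrite content_rcons /inc; have hs : (content w 0 <= m)%N by case/mem_word_level: hw => <- _ _; apply: count_size.
case: c {hc hkc hg} => [|c] /=; first by rewrite addn1 subSS mul1r.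
by rewrite addn0 subSn // exprS.
Qed.

Lemma profile_ge l j : (sumn l <= j)%N -> profile l j = 0%N.
Proof.
move=> hj; apply/eqP; rewrite -leqn0 leqNgt -has_count; apply/hasPn => x /mem_leq_sumn hx.
by rewrite -leqNgt; lia.
Qed.

(** The diagonal 0 has one cell in each row, so there are n - l(l) letters other than 0. *)
Lemma down_paths_SShT n l : sorted gtn l -> all (leq 1) l -> sumn l = n ->
  down_paths n n (profile l) = 2 ^+ (n - size l) * (#|SShT l|)%:Z.
Proof.
move=> hl hp <- {n}; set n := sumn l.
have hm w : w \in level (word_children n) [::] n ->
    matches n w (profile l) = all (fun j => content w j == profile l j) (iota 0 n).
  move=> hw; rewrite /matches -addn1 iotaD all_cat add0n /= andbT andbC.
  by rewrite (word_level_content hw) ?profile_ge.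
case hg : (profile_ok n (profile l)).
  rewrite down_paths_count // card_SShT // mulr_sumr big_seq_cond [RHS]big_seq_cond; apply: eq_big => w.
    by case hw: (w \in _); rewrite //= hm.
  case/andP=> hw /matchesP h; rewrite h // mulr1; congr (_ ^+ (_ - _)).
  by rewrite /profile; apply/eqP; rewrite -all_count; apply: sub_all hp.
case: (down_paths n n (profile l) =P 0) => [->|/eqP/down_paths_support[]]; last by rewrite hg.
rewrite card_SShT // -/n big_seq_cond big1 ?mulr0 // => w /andP[hw]; rewrite -hm // => /matchesP h.
by rewrite -(@eq_profile_ok _ (content w)) ?(word_level_profile hw) in hg.
Qed.

Lemma profile_inj l l' : sorted gtn l -> all (leq 1) l -> sorted gtn l' -> all (leq 1) l' ->
  profile l =1 profile l' -> l = l'.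
Proof.
move=> hl hp hl' hp' e.
have h0 s : all (leq 1) s -> profile s 0 = size s.
  by move=> h; rewrite /profile; apply/eqP; rewrite -all_count.
apply: (@eq_from_nth _ 0%N) => [|i _]; first by rewrite -!h0 ?e.
apply/eqP; rewrite eqn_leq; apply/andP; split; rewrite leqNgt; apply/negP => h.
  by rewrite -profileP // e profileP // ltnn in h.
by rewrite -profileP // -e profileP // ltnn in h.
Qed.

Lemma sumn_profile l M : all (geq M) l -> (sumn l = \sum_(0 <= j < M) profile l j)%N.
Proof.
elim: l => [_|x l IH /= /andP[hx hl]]; first by rewrite big1.
rewrite /profile /= big_split /= -IH //; congr (_ + _)%N.
rewrite (big_cat_nat (n := x)) //= [X in (_ + X)%N]big_nat [X in (_ + X)%N]big1 ?addn0; last by move=> j /andP[h _]; rewrite ltnNge h.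
rewrite big_nat (eq_bigr (fun=> 1%N)) -?big_nat ?sum_nat_const_nat ?subn0 ?muln1 //.
by move=> j /andP[_ ->].
Qed.

Lemma size_content w M : (forall x, x \in w -> x < M)%N -> (size w = \sum_(0 <= j < M) content w j)%N.
Proof.
elim: w => [_|x w IH h]; first by rewrite big1.
rewrite /content /= big_split /= -IH; last by move=> y hy; apply: h; rewrite inE hy orbT.
rewrite (bigD1_seq x) ?iota_uniq ?mem_index_iota ?h ?mem_head //= eqxx big1 ?add1n //.
by move=> j hj; rewrite eq_sym (negbTE hj).
Qed.

(** The row lengths are the positions j + 1 at which the diagonal lengths drop. *)
Definition shape_of n (k : nat -> nat) : seq nat :=
  [seq j.+1 | j <- rev (iota 0 n) & k j != k j.+1].

Lemma count_jumps n (k : nat -> nat) j : profile_ok n k -> (j <= n)%N ->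
  (k j = k n + count (fun i => (j <= i)%N && (k i != k i.+1)) (iota 0 n))%N.
Proof.
move/profile_okP; elim: n => [|n IH] hg hj; first by rewrite addn0; congr k; lia.
rewrite -addn1 iotaD count_cat add0n /= addn0 addn1; have := hg n (leqnn _).
case: (ltngtP j n.+1) hj => // [hj _|-> _ _]; last first.
  rewrite ltnn addn0 [count _ _](_ : _ = 0%N) ?addn0 //; apply/eqP; rewrite -leqn0 leqNgt -has_count.
  by apply/hasPn => i; rewrite mem_iota add0n => /= hi; rewrite negb_and; apply/orP; left; lia.
by move=> h; rewrite IH //; [move: (count _ _) => x; case: (k n =P k n.+1); rewrite -ltnS hj; lia|move=> i hi; apply: hg; lia].
Qed.

Lemma shape_ofP n w : w \in level (word_children n) [::] n ->
  is_strict n (shape_of n (content w)) /\ content w = profile (shape_of n (content w)).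
Proof.
move=> hw; have hg := word_level_profile hw; set k := content w.
have hc j : profile (shape_of n k) j = count (fun i => (j <= i)%N && (k i != k i.+1)) (iota 0 n).
  by rewrite /profile /shape_of count_map count_filter -count_rev revK.
have hk : k = profile (shape_of n k).
  apply: functional_extensionality => j; rewrite hc; case: (leqP j n) => hj.
    by rewrite {1}/k (count_jumps hg hj) (word_level_content hw).
  rewrite /k (word_level_content hw); last exact: ltnW.
  apply/esym/eqP; rewrite -leqn0 leqNgt -has_count; apply/hasPn => i.
  by rewrite mem_iota add0n => /= hi; rewrite negb_and; apply/orP; left; lia.
have hs : all (leq 1) (shape_of n k) by apply/allP => x /mapP[j _ ->].
have hso : sorted gtn (shape_of n k).
  rewrite /shape_of sorted_map; apply: sorted_filter; first by move=> x y z; rewrite /=; lia.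
  by rewrite rev_sorted; apply: sub_sorted (iota_ltn_sorted 0 n) => x y /=; lia.
split=> //; rewrite /is_strict /is_comp hs hso andbT /=.
have hle : all (geq n) (shape_of n k).
  apply/allP => x /mapP[j]; rewrite mem_filter mem_rev mem_iota add0n => /andP[_ /= hj] ->; exact: hj.
rewrite (sumn_profile hle) -hk; case/mem_word_level: hw => hsz h _.
by rewrite -(size_content h) hsz.
Qed.

(** Each word in the tree has the diagonal lengths of exactly one strict partition. *)
Lemma sum_shapes n w (X : int) : w \in level (word_children n) [::] n ->
  \sum_(b : bword n | is_strict n (parts b) && all (fun j => content w j == profile (parts b) j) (iota 0 n)) X = X.
Proof.
move=> hw; have [h1 h2] := shape_ofP hw.
have hcomp : is_comp n (shape_of n (content w)) by case/andP: h1.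
have [b0 hb0] := parts_surj hcomp.
rewrite (big_pred1 b0) // => b /=; apply/andP/eqP => [[hb hm]|->]; last first.
  by rewrite hb0 h1 {1}h2; split=> //; apply/allP => j _.
apply: parts_inj; rewrite hb0; move: hb h1 => /andP[/andP[p1 /eqP s1] o1] /andP[/andP[p2 _] o2].
apply: profile_inj => // j; rewrite -h2; case: (ltnP j n) => hj.
  by apply/esym/eqP/(allP hm); rewrite mem_iota.
by rewrite (word_level_content hw hj) profile_ge // s1.
Qed.

(** Both sides, multiplied by 2^(length of a), equal 2^n times the multinomial coefficient. *)
Lemma sum_all_shapes a : all (leq 1) a ->
  \sum_(b : bword (sumn a) | is_strict (sumn a) (parts b))
     2 ^+ (sumn a - size (parts b)) * (#|SShT (parts b)|)%:Z * tab_count (parts b) a = perm_count [::] a.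
Proof.
move=> ha; set n := sumn a.
transitivity (\sum_(b : bword n | is_strict n (parts b))
  \sum_(w <- level (word_children n) [::] n | all (fun j => content w j == profile (parts b) j) (iota 0 n))
     down_paths n n (content w) * (valleys a (des_bits w))%:R).
  apply: eq_bigr => b /andP[/andP[hp /eqP hs] ho].
  rewrite -(down_paths_SShT ho hp hs) /tab_count hs mulr_sumr big_seq_cond [RHS]big_seq_cond.
  apply: eq_bigr => w /andP[hw hm]; congr (down_paths _ _ _ * _).
  apply: functional_extensionality => j; case: (ltnP j n) => hj.
    by apply/esym/eqP/(allP hm); rewrite mem_iota.
  by rewrite (word_level_content hw hj) profile_ge // hs.
transitivity (\sum_(w <- level (word_children n) [::] n) (valleys a (des_bits w))%:R * down_paths n n (content w)).
  rewrite (exchange_big_dep predT) //= [LHS]big_seq [RHS]big_seq; apply: eq_bigr => w hw.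
  by rewrite sum_shapes // mulrC.
rewrite (tree_tab n (fun s => down_paths n n s.1) ha).
apply: (@mulfI _ (2 ^+ size a)); first by rewrite expf_neq0.
rewrite perm_count_all //; have := tab_blocks ha (leqnn n) 0%N (profile_ok0 n); rewrite subnn => ->.
by rewrite /down_paths /= /empty_shape (_ : all _ _ = true) ?mulr1 //; apply/allP.
Qed.

(** * Tableaux of one row and of nearly one row *)

(** h is p at the one-row shape of size t, q at the shape (t - 1, 1) and 0 at the other two-row
    shapes. These are the gaps t and t - 2, hence the arguments t - 1 and t - 3. *)
Definition nearly (t : nat) (p q : int) (h : nat -> int) : Prop :=
  forall x, (x < t)%N -> h x = if (x.+1 == t)%N then p else if (x + 3 == t)%N then q else 0.

Lemma nearly_A t p q h : nearly t.+1 p q h -> nearly t p q (gap_up h).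
Proof. by move=> hh x hx; rewrite /gap_up hh ?ltnS // eqSS addSn eqSS. Qed.

(** The shape (t, 1) arises from the row of size t by a cell in the second row, which is
    possible only for t > 1. *)
Lemma nearly_Bk t p q h : (0 < t)%N -> nearly t.+1 p q h -> nearly t ((1 < t)%N%:R * q) 0 (gap_down h).
Proof.
move=> ht hh [|x] hx /=; first by case: t ht {hh hx} => [|[|t]] //= _; rewrite ?mul0r //; case: ifP.
rewrite hh; last lia.
have -> : (x.+1 == t.+1)%N = false by lia.
have -> : (x + 3 == t.+1)%N = (x.+2 == t)%N by lia.
have -> : (1 < t)%N by lia.
by rewrite mul1r if_same.
Qed.

Lemma nearly_add t p q h p' q' h' : nearly t p q h -> nearly t p' q' h' ->
  nearly t (p + p') (q + q') (fun x => h x + h' x).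
Proof. by move=> hh hh' x hx; rewrite hh // hh' //; case: ifP => // _; case: ifP => // _; rewrite addr0. Qed.

Lemma nearly_iterA t b p q h : nearly (t + b) p q h -> nearly t p q (iter b gap_up h).
Proof.
elim: b t => [|b IH] t; first by rewrite addn0.
by rewrite addnS -addSn => /IH /nearly_A.
Qed.

Lemma nearly_S t b p q h : (0 < t)%N -> nearly (t + b) p q h ->
  nearly t (p + ((1 < t) && (0 < b))%N%:R * q) q (gap_valley b h).
Proof.
case: b => [|b] ht; first by rewrite addn0 andbF mul0r addr0.
move=> hh; have h1 := nearly_iterA hh.
have [p' h2] : exists p', nearly t.+1 p' q (gap_valley b h).
  elim: b t {h1} ht hh => [|b IH] t ht hh; first by exists p; rewrite -addn1.
  have h1 : nearly t.+1 p q (iter b.+1 gap_up h) by apply: nearly_iterA; rewrite addSnnS.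
  have [p' h2] := IH t.+1 isT (eq_ind _ (fun n => nearly n p q h) hh _ (esym (addSnnS t b.+1))).
  eexists; have := nearly_add h1 (nearly_Bk (ltn0Sn t) h2); rewrite addr0; exact.
by have := nearly_add h1 (nearly_Bk ht h2); rewrite addr0 andbT.
Qed.

Lemma nearly_J t p q h : (0 < t)%N -> nearly t.+1 p q h ->
  nearly t (p + (1 < t)%N%:R * q) q (gap_move h).
Proof. by move=> ht hh; have := nearly_add (nearly_A hh) (nearly_Bk ht hh); rewrite addr0. Qed.

(** Each block of length y contributes q once for its first step and once more if y > 1, that
    is, min(y, 2) times; the correction concerns a first step from the shape with one cell. *)
Lemma nearly_PJ t a p q h : (0 < t)%N -> all (leq 1) a -> nearly (t + sumn a) p q h ->
  nearly t (p + q * (list5N a - ((t == 1%N) && (a != [::]))%:R)) q (gap_blocks a h).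
Proof.
elim: a t => [|y a IH] t ht /=; first by rewrite addn0 /list5N big_nil andbF subr0 mulr0 addr0.
move=> /andP[hy ha] hh.
have h1 : nearly (t + y) (p + q * list5N a) q (gap_blocks a h).
  have := IH (t + y)%N _ ha; rewrite -addnA => /(_ _ hh).
  by rewrite (_ : (t + y == 1)%N = false) ?subr0; [apply; lia|lia].
have h2 := nearly_S (t := t.+1) (b := y.-1) isT.
have e : (t.+1 + y.-1 = t + y)%N by lia.
rewrite e in h2; have := nearly_J ht (h2 _ _ _ h1); congr (nearly t _ _ _).
rewrite /list5N big_cons -/(list5N a) andbT.
have -> : (minn y 2)%:R = 1 + (0 < y.-1)%N%:R :> int by case: y hy {hh h1 h2 e} => [|[|y]].
by have -> : (1 < t)%N%:R = 1 - (t == 1%N)%:R :> int; [case: t ht {hh h1 h2 e} => [|[|t]]|rewrite ltnS ht /=; ring].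
Qed.

Lemma gap_count_nearly a p q h : all (leq 1) a -> (2 < sumn a)%N -> nearly (sumn a) p q h ->
  gap_count a h = p + q * (list5N a - 2).
Proof.
case: a => // x a /= /andP[hx ha] hn hh.
have hh' := nearly_PJ hx ha hh.
have := nearly_S (t := 1) (b := x.-1) isT; rewrite add1n prednK // => /(_ _ _ _ hh') /(_ 0%N isT) -> /=.
rewrite mul0r addr0 /list5N big_cons -/(list5N a); congr (_ + _ * _).
case: x hx hn {hh hh'} => [|[|x]] // _ hn; last by rewrite (minn_idPr _) //=; ring.
have -> : a != [::] by case: (a) hn.
by rewrite (_ : minn 1 2 = 1%N) //=; ring.
Qed.

Lemma tab_count_row a : all (leq 1) a -> (2 < sumn a)%N -> tab_count [:: sumn a] a = 1.
Proof.
move=> ha hn; have an : a != [::] by case: a hn {ha}.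
have := @sum_two_row a (fun k => (k == 0%N)%:R) (fun x => (x.+1 == sumn a)%:R) ha an.
rewrite (@gap_count_nearly a 1 0) ?mul0r ?addr0 //; last first.
  by move=> x hx; case: eqP => //; case: ifP.
move=> <-; last by move=> k hk; congr (_%:R); lia.
rewrite big_nat_recl //= mul1r big1 ?addr0 // => i _; by rewrite mul0r.
Qed.

(** The coefficients 2 and 1 make the correction at the first block vanish. *)
Lemma tab_count_near_row a : all (leq 1) a -> (2 < sumn a)%N ->
  2 * tab_count [:: sumn a] a + tab_count [:: (sumn a - 1)%N; 1%N] a = list5N a.
Proof.
move=> ha hn; have an : a != [::] by case: a hn {ha}.
pose h x : int := if (x.+1 == sumn a)%N then 2 else if (x + 3 == sumn a)%N then 1 else 0.
have := @sum_two_row a (fun k => if k == 0%N then 2 else (k == 1%N)%:R) h ha an.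
rewrite (@gap_count_nearly a 2 1) // ?mul1r.
rewrite addrC subrK => <-; last first.
  move=> k hk; rewrite /h.
  have -> : ((sumn a - 2 * k).-1.+1 == sumn a)%N = (k == 0%N) by lia.
  have -> : ((sumn a - 2 * k).-1 + 3 == sumn a)%N = (k == 1%N) by lia.
  by case: (k == 1%N).
have -> : ((sumn a %/ 2).+1 = (sumn a %/ 2).-1.+2)%N by lia.
rewrite big_nat_recl // big_nat_recl // big1 ?addr0 => [|i _]; last by rewrite mul0r.
by rewrite /= mul1r.
Qed.

(** * Symmetry of the counts *)

Definition symmetric_count (E : seq nat -> int) : Prop :=
  forall a b, all (leq 1) a -> perm_eq a b -> E a = E b.

Lemma perm_sumn (a b : seq nat) : perm_eq a b -> sumn a = sumn b.
Proof. by move=> h; rewrite !sumnE; apply: perm_big. Qed.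

Lemma perm_pos (a b : seq nat) : perm_eq a b -> all (leq 1) a -> all (leq 1) b.
Proof. by move=> h; rewrite (perm_all _ h). Qed.

Lemma list2N_sym : symmetric_count (fun a => gap_count a (iter (sumn a).+1 gap_move gap0)).
Proof.
move=> a b ha hab; case: (a =P [::]) => [ea|/eqP an].
  by move: hab; rewrite ea perm_sym => /perm_nilP->.
have bn : b != [::] by apply: contraNneq an => eb; move: hab; rewrite eb => /perm_nilP->.
by rewrite -(perm_sumn hab) !iterS !gap_count_move // (gap_blocks_perm _ hab).
Qed.

Lemma list3N_sym : symmetric_count list3N.
Proof. by move=> a b _ h; rewrite /list3N (perm_size h) (perm_big _ h). Qed.

Lemma list5N_sym : symmetric_count list5N.
Proof. by move=> a b _ h; rewrite /list5N (perm_big _ h). Qed.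

Lemma sumn_sym (f : nat -> int) : symmetric_count (fun a => f (sumn a)).
Proof. by move=> a b _ h; rewrite (perm_sumn h). Qed.

Lemma perm_count_all_sym : symmetric_count (perm_count [::]).
Proof.
move=> a b ha hab; have hb := perm_pos hab ha.
apply: (@mulfI _ (2 ^+ size a)); first by rewrite expf_neq0.
rewrite (perm_count_all ha) (perm_size hab) (perm_count_all hb) (perm_sumn hab); congr (_ * _)%N%:R.
have h := multinom_fact (leqnn (sumn a)); have h' := multinom_fact (leqnn (sumn b)).
rewrite subnn !muln1 in h h'; rewrite -(perm_sumn hab) -h -(perm_big _ hab) /= in h'.
have : (0 < \prod_(x <- a) x`!)%N by rewrite prodn_gt0 // => i; apply: fact_gt0.
move=> h0; rewrite subnn muln1 in h'; rewrite -(perm_sumn hab).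
by move/eqP: h'; rewrite eqn_pmul2r // eq_sym => /eqP.
Qed.

(** A pattern of size 3 needs three positions. *)
Lemma perm_count_small P a : (sumn a <= 2)%N -> perm_count P a = perm_count [::] a.
Proof.
move=> hs; rewrite /perm_count; apply: perm_big; apply: uniq_perm; try exact: level_uniq.
move=> s; rewrite !mem_level [X in _ = _ && X]/= andbT; apply: andb_idr => hp.
apply/allP => t _; apply/negP => /containswP[i [j [k [h1 h2 h3 _]]]].
by move: h3; rewrite (isperm_size hp); lia.
Qed.

(** * Counts for the listed sets *)

(** The restriction to sizes above 2 is needed for the constant counts; smaller sizes are
    covered by [perm_count_small]. *)
Definition counts_as (P : seq (seq nat)) (E : seq nat -> int) : Prop :=
  forall a, all (leq 1) a -> (2 < sumn a)%N -> perm_count P a = E a.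

Lemma counts_as_nonempty P E : (forall a, all (leq 1) a -> a != [::] -> perm_count P a = E a) -> counts_as P E.
Proof. by move=> h a ha hn; apply: h => //; case: a hn {ha}. Qed.

Lemma counts_as_rev P P' E : symmetric_count E -> all (fun t => (size t == 3) && uniq t) P ->
  P' =i map rev P -> counts_as P E -> counts_as P' E.
Proof.
move=> hE hP e h a ha hn; rewrite (perm_count_eqi _ e) perm_count_rev // h ?all_rev ?sumn_rev //.
by apply: hE; rewrite ?all_rev // perm_rev.
Qed.

Definition list2N a := gap_count a (iter (sumn a).+1 gap_move gap0).

Definition words2 := [:: [:: w123]; [:: w213]; [:: w312]; [:: w321]].
Definition words3 := [:: [:: w213; w132]; [:: w231; w312]; [:: w123; w132];
      [:: w132; w312]; [:: w213; w231]; [:: w231; w321]].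
Definition words4 := [:: [:: w132; w231]].
Definition words5 := [:: [:: w123; w132; w312]; [:: w123; w213; w231];
      [:: w132; w312; w321]; [:: w132; w213; w321];
      [:: w132; w213; w312]; [:: w123; w231; w312];
      [:: w213; w231; w321]; [:: w213; w231; w312]].
Definition words6 := [:: [:: w123; w132; w231]; [:: w132; w213; w231];
      [:: w132; w231; w312]; [:: w132; w231; w321]].
Definition words7 := [:: [:: w123; w132; w213; w231]; [:: w123; w132; w231; w312];
      [:: w132; w213; w231; w312]; [:: w132; w213; w231; w321];
      [:: w132; w231; w312; w321]].
Definition words8 := [:: [:: w123; w132; w213; w231; w312]; [:: w132; w213; w231; w312; w321]].

Lemma counts_as_123 : counts_as [:: w123] list2N.
Proof. by apply: counts_as_nonempty => a ha an; rewrite perm_count_123_213 // perm_count_list2. Qed.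

Lemma counts_as_words2 ws : ws \in words2 -> counts_as ws list2N.
Proof.
have h213 : counts_as [:: w213] list2N by apply: counts_as_nonempty => a ha an; exact: perm_count_list2.
rewrite !inE => /or4P[] /eqP->; [exact: counts_as_123|exact: h213| |].
  exact: (counts_as_rev list2N_sym _ _ h213).
exact: (counts_as_rev list2N_sym _ _ counts_as_123).
Qed.

Lemma counts_as_words3 ws : ws \in words3 -> counts_as ws list3N.
Proof.
have h1 := counts_as_nonempty perm_count_132_312; have h2 := counts_as_nonempty perm_count_132_213; have h3 := counts_as_nonempty perm_count_123_132_list3.
have h2' : counts_as [:: w213; w132] list3N.
  by move=> a ha hn; rewrite -h2 //; apply: perm_count_eqi; apply: perm_mem.
have r P P' := @counts_as_rev P P' _ list3N_sym.
rewrite !inE => /orP[/eqP->|/orP[/eqP->|/or4P[] /eqP->]] //.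
- by apply: (r _ _ _ _ h2) => //; apply: perm_mem.
- by apply: (r _ _ _ _ h1) => //; apply: perm_mem.
- by apply: (r _ _ _ _ h3) => //; apply: perm_mem.
Qed.

Lemma counts_as_words4 ws : ws \in words4 -> counts_as ws (fun a => 2 ^+ (sumn a).-1).
Proof. by rewrite inE => /eqP->; apply: counts_as_nonempty perm_count_list4. Qed.

Lemma counts_as_words5 ws : ws \in words5 -> counts_as ws list5N.
Proof.
have h1 : counts_as [:: w123; w132; w312] list5N by apply: counts_as_nonempty => a ha an; case: (perm_count_list5 ha an).
have h2 : counts_as [:: w132; w312; w321] list5N by apply: counts_as_nonempty => a ha an; case: (perm_count_list5 ha an).
have h3 : counts_as [:: w132; w213; w321] list5N by apply: counts_as_nonempty => a ha an; case: (perm_count_list5 ha an).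
have h4 : counts_as [:: w132; w213; w312] list5N by apply: counts_as_nonempty => a ha an; case: (perm_count_list5 ha an).
have r P P' := @counts_as_rev P P' _ list5N_sym.
rewrite !inE => /or4P[/eqP->|/eqP->|/eqP->|/orP[/eqP->|/or4P[] /eqP->]] //.
- by apply: (r _ _ _ _ h2) => //; apply: perm_mem.
- by apply: (r _ _ _ _ h3) => //; apply: perm_mem.
- by apply: (r _ _ _ _ h1) => //; apply: perm_mem.
- by apply: (r _ _ _ _ h4) => //; apply: perm_mem.
Qed.

Lemma counts_as_words6 ws : ws \in words6 -> counts_as ws (fun a => (sumn a)%:R).
Proof.
have h1 : counts_as [:: w123; w132; w231] (fun a => (sumn a)%:R) by move=> a ha hn; rewrite perm_count_list6 // ltnW.
have h2 : counts_as [:: w132; w231; w312] (fun a => (sumn a)%:R) by move=> a ha hn; case: (perm_count_constants ha hn).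
have r P P' := @counts_as_rev P P' _ (sumn_sym (fun n => n%:R)).
rewrite !inE => /or4P[] /eqP-> //.
- by apply: (r _ _ _ _ h2) => //; apply: perm_mem.
- by apply: (r _ _ _ _ h1) => //; apply: perm_mem.
Qed.

Lemma counts_as_words7 ws : ws \in words7 -> counts_as ws (fun=> 2).
Proof.
have h1 : counts_as [:: w123; w132; w231; w312] (fun=> 2) by move=> a ha hn; case: (perm_count_constants ha hn).
have h2 : counts_as [:: w132; w231; w312; w321] (fun=> 2) by move=> a ha hn; case: (perm_count_constants ha hn).
have h3 : counts_as [:: w132; w213; w231; w312] (fun=> 2) by move=> a ha hn; case: (perm_count_constants ha hn).
have r P P' := @counts_as_rev P P' _ (sumn_sym (fun=> 2)).
rewrite !inE => /or4P[/eqP->|/eqP->|/eqP->|/orP[] /eqP->] //.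
- by apply: (r _ _ _ _ h2) => //; apply: perm_mem.
- by apply: (r _ _ _ _ h1) => //; apply: perm_mem.
Qed.

Lemma counts_as_words8 ws : ws \in words8 -> counts_as ws (fun=> 1).
Proof.
have h1 : counts_as [:: w123; w132; w213; w231; w312] (fun=> 1) by move=> a ha hn; case: (perm_count_constants ha hn).
have r P P' := @counts_as_rev P P' _ (sumn_sym (fun=> 1)).
rewrite !inE => /orP[] /eqP-> //.
by apply: (r _ _ _ _ h1) => //; apply: perm_mem.
Qed.

(** * Sets of patterns *)

Lemma oneline_inj n : injective (@oneline n).
Proof. by move=> p q; rewrite !oneline_word => /(inj_map succn_inj)/word_inj. Qed.

Lemma words_of_perms3 ws : {subset ws <= all6} -> words_of (perms3 ws) =i ws.
Proof.
move=> hws t; apply/mapP/idP => [[p]|ht]; first by rewrite mem_enum inE => hp ->.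
have : all (fun u => isperm 3 (map predn u) && (map succn (map predn u) == u)) all6 by [].
move/allP/(_ t (hws t ht)) => /andP[/word_surj[p hp] /eqP e].
have ep : oneline p = t by rewrite oneline_word hp.
by exists p; rewrite ?ep // mem_enum inE ep.
Qed.

Lemma oneline_all6 (p : 'S_3) : oneline p \in all6.
Proof.
rewrite oneline_word; have := isperm_word p; move: (word p) => [|x [|y [|z []]]] //.
by move: x y z => [|[|[|x]]] [|[|[|y]]] [|[|[|z]]]; rewrite /isperm /= ?andbF.
Qed.

Lemma mem_words_of Pi (p : 'S_3) : (oneline p \in words_of Pi) = (p \in Pi).
Proof. by rewrite /words_of (mem_map (@oneline_inj 3)) mem_enum. Qed.

Lemma eq_perms3 Pi ws : (forall t, t \in all6 -> (t \in words_of Pi) = (t \in ws)) -> Pi = perms3 ws.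
Proof. by move=> h; apply/setP => p; rewrite inE -mem_words_of h // oneline_all6. Qed.

Lemma perms3_nil : perms3 [::] = set0.
Proof. by apply/setP => p; rewrite !inE. Qed.

Lemma words_of_set0 : words_of set0 = [::].
Proof. by rewrite /words_of enum_set0. Qed.

Lemma list_counts_as L E Pi : all (all (mem all6)) L -> (forall ws, ws \in L -> counts_as ws E) ->
  Pi \in map perms3 L -> counts_as (words_of Pi) E.
Proof.
move=> /allP hL h /mapP[ws hws ->] a ha hn.
by rewrite (perm_count_eqi _ (words_of_perms3 (allP (hL _ hws)))) h.
Qed.

(** * Symmetric series *)

Lemma expword_perm (m m' : monom) (s : nat -> nat) : bijective s ->
  (forall i, m' (s i) = m i) -> perm_eq (expword m) (expword m').
Proof.
move=> hs e; have hinj := bij_inj hs.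
have h1 : perm_eq (expword m) (map m' (map s (finsupp m))).
  rewrite /expword -map_comp (@eq_map _ _ (m' \o s) m) //.
  by apply: perm_map; rewrite perm_sort.
apply: perm_trans h1 _; apply: perm_map; rewrite perm_sym perm_sort perm_sym.
apply: uniq_perm; rewrite ?map_inj_uniq ?fset_uniq // => x.
case: hs => g gK Kg; apply/mapP/idP => [[i hi ->]|hx].
  by rewrite mem_finsupp in hi; rewrite mem_finsupp e.
by exists (g x); rewrite ?Kg // mem_finsupp -e Kg -mem_finsupp.
Qed.

Lemma sym_avoidR Pi n : symmetric_count (perm_count (words_of Pi)) -> sym_series (avoidR Pi n).
Proof.
move=> h s hs m m' e; have hp := expword_perm hs e.
rewrite !avoidR_coef (perm_sumn hp) (perm_size hp).
by rewrite (h _ _ (expword_pos m) hp).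
Qed.

Lemma symmetric_counts_as P E : counts_as P E -> symmetric_count E -> symmetric_count (perm_count P).
Proof.
move=> hv hE a b ha hab; have hb := perm_pos hab ha.
case: (leqP (sumn a) 2) => hs.
  by rewrite !perm_count_small -?(perm_sumn hab) //; apply: perm_count_all_sym.
by rewrite !hv -?(perm_sumn hab) //; apply: hE.
Qed.

(** * Expansions into Schur Q-functions *)

(** The common form of the two kinds of series, see [avoidR_coef] and [schurQ_coef]. *)
Definition scaled (n : nat) (X : seq nat -> int) : series := fun m =>
  if sumn (expword m) == n then 2 ^+ (size (expword m)).-1.+1 * X (expword m) else 0.

Lemma schurQ_scaled n l m : sorted gtn l -> sumn l = n -> schurQ l m = scaled n (tab_count l) m.
Proof. by move=> h <-; apply: schurQ_coef. Qed.

Lemma eq_scaled n X Y m : (forall a, all (leq 1) a -> sumn a = n -> X a = Y a) ->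
  scaled n X m = scaled n Y m.
Proof. by move=> h; rewrite /scaled; case: eqP => // e; rewrite h // expword_pos. Qed.

Lemma scaled_scale n c X m : c * scaled n X m = scaled n (fun a => c * X a) m.
Proof. by rewrite /scaled; case: eqP => _; rewrite ?mulr0 // mulrCA. Qed.

Lemma scaled_add n X Y m : scaled n X m + scaled n Y m = scaled n (fun a => X a + Y a) m.
Proof. by rewrite /scaled; case: eqP => _; rewrite ?addr0 // mulrDr. Qed.

Lemma scaled_sum n I (r : seq I) (P : pred I) (X : I -> seq nat -> int) m :
  \sum_(i <- r | P i) scaled n (X i) m = scaled n (fun a => \sum_(i <- r | P i) X i a) m.
Proof. by rewrite /scaled; case: eqP => _; [rewrite mulr_sumr|rewrite big1]. Qed.

Lemma avoidR_counts_as Pi E n m : counts_as (words_of Pi) E -> (2 < n)%N -> avoidR Pi n m = scaled n E m.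
Proof.
move=> hv hn; rewrite avoidR_coef -/(scaled n (perm_count (words_of Pi)) m).
by apply: eq_scaled => a ha hs; rewrite hv // hs.
Qed.

Lemma avoidR_all (Pi : {set 'S_3}) n m : (n <= 2)%N || (Pi == set0) -> avoidR Pi n m =
  \sum_(b : bword n | is_strict n (parts b))
     2 ^+ (n - size (parts b)) * (#|SShT (parts b)|)%:Z * schurQ (parts b) m.
Proof.
move=> h; rewrite avoidR_coef -/(scaled n (perm_count (words_of Pi)) m).
transitivity (scaled n (perm_count [::]) m).
  apply: eq_scaled => a ha hs; case/orP: h => [h|/eqP->]; last by rewrite words_of_set0.
  by apply: perm_count_small; rewrite hs.
rewrite (@eq_scaled n _ (fun a => \sum_(b : bword n | is_strict n (parts b))
  2 ^+ (n - size (parts b)) * (#|SShT (parts b)|)%:Z * tab_count (parts b) a)).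
  rewrite -scaled_sum; apply: eq_bigr => b /andP[/andP[_ /eqP hs] ho].
  by rewrite -scaled_scale -schurQ_scaled.
by move=> a ha hs; rewrite -sum_all_shapes // hs.
Qed.

Lemma two_row_strict n k : (0 < n)%N -> (2 * k < n)%N -> is_strict n (two_row n k).
Proof.
by move=> h0 hk; rewrite /is_strict /is_comp /two_row; case: (k =P 0%N) => [_|k0] /=; lia.
Qed.

(** The term with 2k = n is not a Schur Q-function of a strict partition, but its coefficient
    vanishes. *)
Lemma two_row_expand n (c h : nat -> int) m : (0 < n)%N ->
  (forall k, (2 * k < n)%N -> c k = h (n - 2 * k).-1) ->
  (forall k, (2 * k)%N = n -> c k = 0) ->
  \sum_(0 <= k < (n %/ 2).+1) c k * schurQ (two_row n k) m = scaled n (fun a => gap_count a h) m.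
Proof.
move=> hn hc h0.
transitivity (\sum_(0 <= k < (n %/ 2).+1) scaled n (fun a => c k * tab_count (two_row n k) a) m).
  rewrite big_nat [RHS]big_nat; apply: eq_bigr => k /andP[_ hk]; rewrite -scaled_scale.
  case: (ltnP (2 * k) n) => hk'; last by rewrite h0 ?mul0r //; lia.
  have /andP[/andP[_ /eqP hs] ho] := two_row_strict hn hk'.
  by rewrite -schurQ_scaled.
rewrite scaled_sum; apply: eq_scaled => a ha hs; rewrite -hs; apply: sum_two_row => //.
  by case: a {ha} hs hn => // <-.
by rewrite hs.
Qed.

Lemma iter_gap_move_ge0 n x : 0 <= iter n gap_move gap0 x.
Proof.
elim: n x => [|n IH] x; first by rewrite /= /gap0; case: eqP.
rewrite iterS /gap_move /gap_up /gap_down Num.Theory.addr_ge0 ?IH //; by case: x.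
Qed.

(** With n replaced by n + 1 and k by k + 1, Pascal rule turns the ballot numbers into the
    coefficients of [list2]. *)
Lemma coef2E n k : (2 * k < n)%N ->
  ('C(n, k.+1))%:Z - (binpred n k)%:Z = iter n.+1 gap_move gap0 (n - 2 * k).-1.
Proof.
move=> hk; have -> : ((n - 2 * k).-1 = n.+1 - 2 * k.+1)%N by lia.
rewrite iter_gap_move; last lia.
by rewrite binS /=; case: k {hk} => [|k]; rewrite ?binS ?bin0 /=; lia.
Qed.

Lemma coef2_half n k : (2 * k)%N = n -> ('C(n, k.+1))%:Z - (binpred n k)%:Z = 0 :> int.
Proof.
move=> <-; case: k => [|k] //=; rewrite -(@bin_sub (2 * k.+1) k); last lia.
by rewrite (_ : (2 * k.+1 - k = k.+2)%N) ?subrr //; lia.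
Qed.

Lemma expand_list2 Pi n m : counts_as (words_of Pi) list2N -> (2 < n)%N -> avoidR Pi n m =
  \sum_(0 <= k < (n %/ 2).+1) (('C(n, k.+1))%:Z - (binpred n k)%:Z) * schurQ (two_row n k) m.
Proof.
move=> hv hn; rewrite (avoidR_counts_as _ hv) // (@two_row_expand n _ (iter n.+1 gap_move gap0)).
- by apply: eq_scaled => a _ hs; rewrite /list2N hs.
- by lia.
- exact: coef2E.
- exact: coef2_half.
Qed.

Lemma expand_list3 Pi n m : counts_as (words_of Pi) list3N -> (2 < n)%N -> avoidR Pi n m =
  \sum_(0 <= k < (n %/ 2).+1) (n%:Z - (2 * k)%:Z) * schurQ (two_row n k) m.
Proof.
move=> hv hn; rewrite (avoidR_counts_as _ hv) // (@two_row_expand n _ (fun x => x.+1%:R)).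
- apply: eq_scaled => a ha hs; rewrite gap_count_id //; by case: a hs hn {ha} => // <-.
- by lia.
- by move=> k hk; lia.
- by move=> k hk; lia.
Qed.

Lemma expand_row Pi n (f : nat -> int) m : counts_as (words_of Pi) (fun a => f (sumn a)) -> (2 < n)%N ->
  avoidR Pi n m = f n * schurQ [:: n] m.
Proof.
move=> hv hn; rewrite (avoidR_counts_as _ hv) // (@schurQ_scaled n) //= ?addn0 // scaled_scale.
by apply: eq_scaled => a ha hs; rewrite hs -[in tab_count _]hs tab_count_row ?mulr1 // hs.
Qed.

Lemma expand_list5 Pi n m : counts_as (words_of Pi) list5N -> (2 < n)%N ->
  avoidR Pi n m = 2 * schurQ [:: n] m + schurQ [:: (n - 1)%N; 1%N] m.
Proof.
move=> hv hn; rewrite (avoidR_counts_as _ hv) // !(@schurQ_scaled n) /= ?addn0 ?subnK //; try lia.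
rewrite scaled_scale scaled_add; apply: eq_scaled => a ha hs.
by rewrite -tab_count_near_row // hs.
Qed.

(** Terms with the same shape are collected, since the expansion is indexed by the strict
    partitions. *)
Lemma schurQ_pos_sum n (r : seq (int * seq nat)) f :
  all (fun x => (0 <= x.1) && is_strict n x.2) r ->
  (forall m, f m = \sum_(x <- r) x.1 * schurQ x.2 m) -> schurQ_pos n f.
Proof.
move=> /allP hr hf; exists (fun l => \sum_(x <- r | x.2 == l) x.1); split=> [l|m].
  by rewrite big_seq_cond Num.Theory.sumr_ge0 // => x /andP[/hr/andP[]].
rewrite hf /Qexpand.
transitivity (\sum_(b : bword n | is_strict n (parts b)) \sum_(x <- r | x.2 == parts b) x.1 * schurQ x.2 m); last first.
  apply: eq_bigr => b _; rewrite mulr_suml; apply: eq_bigr => x /eqP->.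
  by [].
rewrite (exchange_big_dep predT) //= big_seq [RHS]big_seq; apply: eq_bigr => x /hr/andP[_ hx].
have [b0 hb0] := parts_surj (proj1 (andP hx)).
rewrite (big_pred1 b0) // => b /=; apply/andP/eqP => [[_ /eqP e]|->]; last by rewrite hb0 hx.
by apply: parts_inj; rewrite hb0.
Qed.

Lemma schurQ_pos_all (Pi : {set 'S_3}) n : (n <= 2)%N || (Pi == set0) -> schurQ_pos n (avoidR Pi n).
Proof.
move=> h; exists (fun l => 2 ^+ (n - size l) * (#|SShT l|)%:Z); split=> [l|m].
  by rewrite Num.Theory.mulr_ge0 // Num.Theory.exprn_ge0.
exact: avoidR_all.
Qed.

Lemma schurQ_pos_two_row n (c : nat -> int) f : (0 < n)%N ->
  (forall k, (2 * k < n)%N -> 0 <= c k) -> (forall k, (2 * k)%N = n -> c k = 0) ->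
  (forall m, f m = \sum_(0 <= k < (n %/ 2).+1) c k * schurQ (two_row n k) m) ->
  schurQ_pos n f.
Proof.
move=> hn hc h0 hf.
apply: (@schurQ_pos_sum n [seq (c k, two_row n k) | k <- iota 0 (n %/ 2).+1 & (2 * k < n)%N]).
  by rewrite all_map all_filter; apply/allP => k _ /=; apply/implyP => hk; rewrite hc // two_row_strict.
move=> m; rewrite hf big_map big_filter /= [RHS]big_mkcond /index_iota subn0 big_seq [RHS]big_seq.
apply: eq_bigr => k; rewrite mem_iota add0n => /andP[_ hk]; case: ltnP => // hk'.
by rewrite h0 ?mul0r //; lia.
Qed.

(** * The sets that are not listed *)

Definition monom_of (a : seq nat) : monom :=
  [fsfun i in [fset j in iota 0 (size a)] => nth 0%N a i | 0%N].

Lemma monom_ofE a i : monom_of a i = nth 0%N a i.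
Proof.
rewrite fsfunE inE /= mem_iota add0n /=; case: ltnP => // h.
by rewrite nth_default.
Qed.

Lemma expword_monom a : all (leq 1) a -> expword (monom_of a) = a.
Proof.
move=> ha; rewrite /expword.
have -> : sort leq (finsupp (monom_of a)) = iota 0 (size a).
  apply: (sorted_eq leq_trans anti_leq); rewrite ?iota_sorted //; first exact: sort_sorted leq_total _.
  rewrite perm_sort; apply: uniq_perm; rewrite ?fset_uniq ?iota_uniq // => i.
  rewrite mem_finsupp monom_ofE mem_iota add0n /=; case: ltnP => h; last by rewrite nth_default.
  by have := allP ha _ (mem_nth 0%N h); rewrite lt0n.
apply: (@eq_from_nth _ 0%N); rewrite size_map size_iota // => i hi.
by rewrite (nth_map 0%N) ?size_iota // nth_iota // monom_ofE.
Qed.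

(** The transposition of two neighbouring variables exchanges two neighbouring parts. *)
Lemma perm_count_swap Pi (u v : seq nat) x y : (forall n, sym_series (avoidR Pi n)) ->
  all (leq 1) (u ++ [:: x, y & v]) ->
  perm_count (words_of Pi) (u ++ [:: x, y & v]) = perm_count (words_of Pi) (u ++ [:: y, x & v]).
Proof.
set a := u ++ _; set b := u ++ _ => hsym ha.
have hb : all (leq 1) b by move: ha; rewrite /a /b !all_cat /=; case: (all _ u) => //= /and3P[-> -> ->].
pose n := size u; pose s (i : nat) : nat := (if i == n then n.+1 else if i == n.+1 then n else i)%N.
have ss : involutive s by move=> i; rewrite /s; repeat case: eqP; lia.
have hs : bijective s by exists s.
have hm i : monom_of b (s i) = monom_of a i.
  rewrite !monom_ofE /a /b !nth_cat -/n /s.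
  case: (i =P n) => [->|h1]; first by rewrite ltnNge leqnSn /= subSnn ltnn subnn.
  case: (i =P n.+1) => [->|h2]; first by rewrite ltnn subnn /= ltnNge leqnSn /= subSnn.
  case: ltnP => // h3; have -> : (i - n = (i - n.+2).+2)%N by lia.
  by [].
have eab : sumn a = sumn b by rewrite /a /b !sumn_cat /=; congr (_ + _)%N; exact: addnCA.
have := hsym (sumn a) s hs _ _ hm; rewrite !avoidR_coef !expword_monom // eab eqxx.
have -> : size b = size a by rewrite /a /b !size_cat.
by move/mulfI => -> //; rewrite expf_neq0.
Qed.

(** A form of [perm_count] that can be evaluated. *)
Definition perm_countn (P : seq (seq nat)) (a : seq nat) : nat :=
  count (fun s => valleys a (des_bits s)) (level (perm_children P) [::] (sumn a)).

Lemma perm_count_count P a : perm_count P a = (perm_countn P a)%:R.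
Proof. by rewrite /perm_count /perm_countn; elim: (level _ _ _) => [|s r IH]; rewrite ?big_nil // big_cons IH -natrD. Qed.

(** The compositions of 4 and of 5 for which the counts are compared. *)
Definition witness (P : seq (seq nat)) : bool :=
  [|| perm_countn P [:: 3; 1] != perm_countn P [:: 1; 3], perm_countn P [:: 1; 1; 3] != perm_countn P [:: 1; 3; 1]
    | perm_countn P [:: 1; 3; 1] != perm_countn P [:: 3; 1; 1]]%N.

Lemma sym_no_witness (Pi : {set 'S_3}) ws : words_of Pi =i ws ->
  (forall n, sym_series (avoidR Pi n)) -> ~~ witness ws.
Proof.
move=> hP hs; rewrite /witness !negb_or !negbK.
have h u x y v : all (leq 1) (u ++ [:: x, y & v]) -> perm_countn ws (u ++ [:: x, y & v]) == perm_countn ws (u ++ [:: y, x & v]).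
  move=> ha; rewrite -(@Num.Theory.eqr_nat int) -!perm_count_count -!(perm_count_eqi _ hP); apply/eqP; exact: perm_count_swap.
by rewrite (h [::] 3%N 1%N [::]) // (h [:: 1%N] 1%N 3%N [::]) // (h [::] 1%N 3%N [:: 1%N]).
Qed.

Definition listed_words := [:: [::]] ++ words2 ++ words3 ++ words4 ++ words5 ++ words6 ++ words7 ++ words8.

Fixpoint sublists (T : Type) (s : seq T) : seq (seq T) :=
  if s is x :: s' then map (cons x) (sublists s') ++ sublists s' else [:: [::]].

Lemma mem_sublists (T : eqType) (p : pred T) s : filter p s \in sublists s.
Proof.
elim: s => //= x s IH; rewrite mem_cat; case: (p x); last by rewrite IH orbT.
by rewrite map_f.
Qed.

(** Evaluation for the 64 sets of patterns of size 3. *)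
Lemma all_sublists : all (fun ws => [|| (w123 \in ws) && (w321 \in ws), has (perm_eq ws) listed_words | witness ws])
  (sublists all6).
Proof. by vm_cast_no_check (erefl true). Qed.

Lemma listedE : listed = map perms3 listed_words.
Proof. by rewrite /listed_words map_cat /= perms3_nil. Qed.

Lemma sym_listed (Pi : {set 'S_3}) : ~~ (perms3 [:: w123; w321] \subset Pi) ->
  (forall n, sym_series (avoidR Pi n)) -> Pi \in listed.
Proof.
move=> hPi hs; set ws := [seq t <- all6 | t \in words_of Pi].
have hw t : t \in all6 -> (t \in words_of Pi) = (t \in ws) by move=> ht; rewrite mem_filter ht andbT.
have hP : words_of Pi =i ws.
  move=> t; rewrite mem_filter andbC; case ht: (t \in all6) => //=; apply/negbTE/mapP => -[p _ et].
  by rewrite et oneline_all6 in ht.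
have := allP all_sublists _ (mem_sublists _ all6 : ws \in _).
rewrite (negbTE (sym_no_witness hP hs)) orbF; case/orP.
  rewrite -!hP => /andP[h1 h2]; case/negP: hPi; apply/subsetP => p; rewrite !inE -mem_words_of.
  by case/orP => /eqP->.
case/hasP => ws' hws' hp; rewrite listedE; apply/mapP; exists ws' => //.
by apply: eq_perms3 => t ht; rewrite hw // (perm_mem hp).
Qed.

Lemma list1E (Pi : {set 'S_3}) : Pi \in list1 -> Pi = set0.
Proof. by rewrite inE => /eqP. Qed.

(** * Symmetry and positivity for the listed sets *)

Section Listed.
Variable Pi : {set 'S_3}.
Let V E := counts_as (words_of Pi) E.

Lemma counts_as_list2 : Pi \in list2 -> V list2N. Proof. exact: (@list_counts_as words2 _ _ isT counts_as_words2). Qed.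
Lemma counts_as_list3 : Pi \in list3 -> V list3N. Proof. exact: (@list_counts_as words3 _ _ isT counts_as_words3). Qed.
Lemma counts_as_list4 : Pi \in list4 -> V (fun a => 2 ^+ (sumn a).-1).
Proof. exact: (@list_counts_as words4 _ _ isT counts_as_words4). Qed.
Lemma counts_as_list5 : Pi \in list5 -> V list5N. Proof. exact: (@list_counts_as words5 _ _ isT counts_as_words5). Qed.
Lemma counts_as_list6 : Pi \in list6 -> V (fun a => (sumn a)%:R).
Proof. exact: (@list_counts_as words6 _ _ isT counts_as_words6). Qed.
Lemma counts_as_list7 : Pi \in list7 -> V (fun=> 2). Proof. exact: (@list_counts_as words7 _ _ isT counts_as_words7). Qed.
Lemma counts_as_list8 : Pi \in list8 -> V (fun=> 1). Proof. exact: (@list_counts_as words8 _ _ isT counts_as_words8). Qed.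

Lemma listed_sym : Pi \in listed -> symmetric_count (perm_count (words_of Pi)).
Proof.
rewrite /listed !mem_cat; case/orP => [/list1E->|]; first by rewrite words_of_set0; apply: perm_count_all_sym.
case/orP => [/counts_as_list2 h|]; first exact: symmetric_counts_as h list2N_sym.
case/orP => [/counts_as_list3 h|]; first exact: symmetric_counts_as h list3N_sym.
case/orP => [/counts_as_list4 h|]; first exact: symmetric_counts_as h (sumn_sym (fun n => 2 ^+ n.-1)).
case/orP => [/counts_as_list5 h|]; first exact: symmetric_counts_as h list5N_sym.
case/orP => [/counts_as_list6 h|]; first exact: symmetric_counts_as h (sumn_sym (fun n => n%:R)).
case/orP => [/counts_as_list7 h|/counts_as_list8 h]; first exact: symmetric_counts_as h (sumn_sym (fun=> 2)).
exact: symmetric_counts_as h (sumn_sym (fun=> 1)).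
Qed.

Lemma expand_row_pos n (f : nat -> int) : 0 <= f n -> V (fun a => f (sumn a)) -> (2 < n)%N ->
  schurQ_pos n (avoidR Pi n).
Proof.
move=> hf hv hn; apply: (@schurQ_pos_sum n [:: (f n, [:: n])]).
  by rewrite /= hf /is_strict /is_comp /= addn0 eqxx !andbT; lia.
by move=> m; rewrite big_seq1 (expand_row _ hv hn).
Qed.

Lemma listed_pos n : Pi \in listed -> schurQ_pos n (avoidR Pi n).
Proof.
case: (leqP n 2) => hn; first by move=> _; apply: schurQ_pos_all; rewrite hn.
rewrite /listed !mem_cat; case/orP => [/list1E->|]; first by apply: schurQ_pos_all; rewrite eqxx orbT.
have n0 : (0 < n)%N by lia.
case/orP => [/counts_as_list2 h|].
  apply: (@schurQ_pos_two_row n (fun k => ('C(n, k.+1))%:Z - (binpred n k)%:Z)) => // [k hk|k|m].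
  - by rewrite coef2E // iter_gap_move_ge0.
  - exact: coef2_half.
  - exact: expand_list2.
case/orP => [/counts_as_list3 h|].
  apply: (@schurQ_pos_two_row n (fun k => n%:Z - (2 * k)%:Z)) => // [k hk|k hk|m].
  - by lia.
  - by lia.
  - exact: expand_list3.
case/orP => [/counts_as_list4 h|]; first by apply: (expand_row_pos (f := fun n => 2 ^+ n.-1)) => //; apply: Num.Theory.exprn_ge0.
case/orP => [/counts_as_list5 h|].
  apply: (@schurQ_pos_sum n [:: (2, [:: n]); (1, [:: (n - 1)%N; 1%N])]).
    by rewrite /= /is_strict /is_comp /=; lia.
  by move=> m; rewrite big_cons big_seq1 mul1r (expand_list5 _ h hn).
case/orP => [/counts_as_list6 h|]; first by apply: (expand_row_pos (f := fun n => n%:R)) => //; apply: Num.Theory.ler0n.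
case/orP => [/counts_as_list7 h|/counts_as_list8 h]; first exact: (expand_row_pos (f := fun=> 2)).
exact: (expand_row_pos (f := fun=> 1)).
Qed.
End Listed.

Unset Implicit Arguments.
Set Strict Implicit.

Theorem theorem1p1 (Pi : {set 'S_3})
    (hPi : ~~ (perms3 [:: w123; w321] \subset Pi)) :
  [/\ (forall n : nat, sym_series (avoidR Pi n)) <-> Pi \in listed,
      Pi \in listed -> forall n : nat, schurQ_pos n (avoidR Pi n)
    & forall n : nat, (3 <= n)%N ->
      [/\ Pi \in list1 -> forall m : monom, avoidR Pi n m =
            \sum_(b : bword n | is_strict n (parts b))
               2 ^+ (n - size (parts b)) * (#|SShT (parts b)|)%:Z
                 * schurQ (parts b) m,
          Pi \in list2 -> forall m : monom, avoidR Pi n m =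
            \sum_(0 <= k < (n %/ 2).+1)
               (('C(n, k.+1))%:Z - (binpred n k)%:Z) * schurQ (two_row n k) m,
          Pi \in list3 -> forall m : monom, avoidR Pi n m =
            \sum_(0 <= k < (n %/ 2).+1)
               (n%:Z - (2 * k)%:Z) * schurQ (two_row n k) m
        & [/\ Pi \in list4 -> forall m : monom, avoidR Pi n m =
                2 ^+ (n - 1) * schurQ [:: n] m,
              Pi \in list5 -> forall m : monom, avoidR Pi n m =
                2 * schurQ [:: n] m + schurQ [:: (n - 1)%N; 1%N] m,
              Pi \in list6 -> forall m : monom, avoidR Pi n m =
                n%:Z * schurQ [:: n] m,
              Pi \in list7 -> forall m : monom, avoidR Pi n m =
                2 * schurQ [:: n] m
            & Pi \in list8 -> forall m : monom, avoidR Pi n m =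
                schurQ [:: n] m]]].
Proof.
split.
- split=> [|h n]; first exact: sym_listed.
  exact: sym_avoidR (listed_sym h).
- by move=> h n; apply: listed_pos.
move=> n hn; split=> [/list1E-> m|/counts_as_list2 h m|/counts_as_list3 h m|].
- by apply: avoidR_all; rewrite eqxx orbT.
- exact: expand_list2.
- exact: expand_list3.
split=> [/counts_as_list4|/counts_as_list5|/counts_as_list6|/counts_as_list7|/counts_as_list8] h m.
- by rewrite (expand_row (f := fun n => 2 ^+ n.-1) _ h) ?subn1.
- exact: expand_list5.
- by rewrite (expand_row (f := fun n => n%:R) _ h) // natz.
- exact: (expand_row (f := fun=> 2) _ h).
- by rewrite (expand_row (f := fun=> 1) _ h) ?mul1r.
Qed.
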